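(* Let $X$ be a rearrangement-invariant (r.i.) space over $\mathbb{R}^n$ such that $$\psi\in X'(0,\infty),\qquad\text{where } \psi(t)=\chi_{(0,1)}(t)\log\tfrac1t,\quad t\in(0,\infty). \tag{A}$$ Define the functional $\sigma$ by $$\sigma(f)=\left\|\int_t^\infty f^*(s)\frac{ds}{s}\right\|_{X'(0,\infty)},\qquad f\in\mathcal{M}_+(\mathbb{R}^n)$$ (the norm being taken with respect to the variable $t$). Then $\sigma$ is an r.i. norm and $M\colon X\to Y$, where $M$ is the Hardy–Littlewood maximal operator and $Y=Y(\sigma')$ is the r.i. space determined by the associate norm $\sigma'$ of $\sigma$. Moreover, $Y$ is the optimal (smallest) r.i. space over $\mathbb{R}^n$ for which $M\colon X\to Y$ holds, i.e. $Y\hookrightarrow Z$ for every r.i. space $Z$ over $\mathbb{R}^n$ such that $M\colon X\to Z$. Conversely, if (A) is not true, then there does not exist an r.i. space $Y$ over $\mathbb{R}^n$ for which $M\colon X\to Y$ holds.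
   Context: Let $R$ be $\mathbb{R}^n$ or $(0,\infty)$ with Lebesgue measure $\mu$ (also written $|\cdot|$). $\mathcal{M}(R)$ is the set of measurable functions on $R$ with values in $[-\infty,\infty]$ and $\mathcal{M}_+(R)$ the set of nonnegative ones. For $f\in\mathcal{M}(R)$, $f^*(t)=\inf\{\lambda\in(0,\infty):\mu(\{|f|>\lambda\})\le t\}$ and $f^{**}(t)=\frac1t\int_0^tf^*(s)\,ds$. An r.i. norm on $R$ is a functional $\varrho\colon\mathcal{M}_+(R)\to[0,\infty]$ such that for all $f,g,f_j\in\mathcal{M}_+(R)$ and $\lambda\ge0$: (P1) $\varrho(f)=0$ iff $f=0$ a.e., $\varrho(\lambda f)=\lambda\varrho(f)$, $\varrho(f+g)\le\varrho(f)+\varrho(g)$; (P2) $f\le g$ a.e. implies $\varrho(f)\le\varrho(g)$; (P3) $f_j\nearrow f$ a.e. implies $\varrho(f_j)\nearrow\varrho(f)$; (P4) $\varrho(\chi_E)<\infty$ whenever $\mu(E)<\infty$; (P5) if $\mu(E)<\infty$, then $\int_Ef\,d\mu\le C_E\varrho(f)$ with a constant $C_E$ independent of $f$; (P6) $\varrho(f)=\varrho(g)$ whenever $f^*=g^*$. The r.i. space determined by $\varrho$ is $X(\varrho)=\{f\in\mathcal{M}(R):\varrho(|f|)<\infty\}$, with $\|f\|_{X(\varrho)}=\varrho(|f|)$. The associate norm of $\varrho$ is $\varrho'(g)=\sup\{\int_Rfg\,d\mu: f\in\mathcal{M}_+(R),\ \varrho(f)\le1\}$, which is again an r.i. norm;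 for $X=X(\varrho)$ the associate space is $X'=X(\varrho')$, and $X''=X$. For an r.i. space $X$ over $\mathbb{R}^n$, $X(0,\infty)$ denotes its representation space, the unique r.i. space over $(0,\infty)$ with $\|f\|_X=\|f^*\|_{X(0,\infty)}$ for all $f$; $X'(0,\infty)$ is the representation space of $X'$. $T\colon X\to Y$ means there is $C>0$ with $\|Tf\|_Y\le C\|f\|_X$ for all $f\in X$; $X\hookrightarrow Y$ means this for the identity operator. The Hardy–Littlewood maximal operator is $Mf(x)=\sup_{Q\ni x}\frac1{|Q|}\int_Q|f(y)|\,dy$, $x\in\mathbb{R}^n$, for locally integrable $f$ on $\mathbb{R}^n$, the supremum being over all cubes $Q\subset\mathbb{R}^n$ containing $x$ with edges parallel to the coordinate axes. *)

(* Defs.v *)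
From HB Require Import structures.
From mathcomp Require Import all_boot all_order all_algebra.
From mathcomp Require Import all_classical all_reals all_analysis.
From mathcomp Require Import measurable_realfun.

Set Implicit Arguments.
Unset Strict Implicit.
Unset Printing Implicit Defensive.
Import Order.TTheory GRing.Theory Num.Theory.
Import numFieldNormedType.Exports.

Local Open Scope classical_set_scope.
Local Open Scope ring_scope.
Local Open Scope ereal_scope.

(** * Lebesgue measure on R^n, n >= 1

    The dimension is written n.+1; R^(n+1) is 'rV[R]_n.+1. The Lebesgue measure
    is the restriction of the Lebesgue outer measure to its Caratheodory
    (i.e. Lebesgue) measurable sets, carried by the type [euclid R n]. *)

Section lebesgue_outer_measure.
Context (R : realType) (n : nat).

Definition box (a b : 'rV[R]_n.+1) : set 'rV[R]_n.+1 :=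
  [set x | forall i, (a ord0 i <= x ord0 i <= b ord0 i)%R].

(* The box is empty, and its volume 0, as soon as b i < a i for some i. *)
Definition box_volume (a b : 'rV[R]_n.+1) : R :=
  (\prod_i Num.max 0 (b ord0 i - a ord0 i))%R.

Definition box_cover (A : set 'rV[R]_n.+1) :
    set (nat -> 'rV[R]_n.+1 * 'rV[R]_n.+1) :=
  [set c | A `<=` \bigcup_k box (c k).1 (c k).2].

Definition lebesgue_outer (A : set 'rV[R]_n.+1) : \bar R :=
  ereal_inf [set \sum_(k <oo) (box_volume (c k).1 (c k).2)%:E
            | c in box_cover A].

Lemma box_volume_ge0 a b : (0 <= box_volume a b)%R.
Proof. by apply: prodr_ge0 => i _; rewrite le_max lexx. Qed.

Lemma lebesgue_outer_ge0 A : 0 <= lebesgue_outer A.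
Proof.
apply: le_ereal_inf_tmp => _ [c _ <-].
by apply: nneseries_ge0 => k _ _; rewrite lee_fin box_volume_ge0.
Qed.

Lemma lebesgue_outer0 : lebesgue_outer set0 = 0.
Proof.
apply/eqP; rewrite eq_le lebesgue_outer_ge0 andbT.
apply: ereal_inf_lbound; exists (fun=> (0%R, 0%R)) => //.
rewrite eseries0// => k _ _.
by rewrite /box_volume /= big_ord_recl !mxE subrr maxxx mul0r.
Qed.

Lemma le_lebesgue_outer : {homo lebesgue_outer : A B / A `<=` B >-> A <= B}.
Proof.
move=> A B AB; apply/ereal_inf_le_tmp => _ [c Bc <-].
by exists c => //; exact: subset_trans Bc.
Qed.

Lemma lebesgue_outer_sigma_subadditive : sigma_subadditive lebesgue_outer.
Proof.
move=> A; have [[i ioo]|] := pselect (exists i, lebesgue_outer (A i) = +oo).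
  rewrite (eseries_pinfty _ _ ioo) ?leey// => k _.
  by rewrite -ltNye (lt_le_trans _ (lebesgue_outer_ge0 _)).
rewrite -forallNE => Aoo.
apply/lee_addgt0Pr => _/posnumP[e].
rewrite (le_trans _ (epsilon_trick _ _ _))//; last first.
  by move=> k; exact: lebesgue_outer_ge0.
pose vol (p : 'rV[R]_n.+1 * 'rV[R]_n.+1) := (box_volume p.1 p.2)%:E.
have vol_ge0 p : 0 <= vol p by rewrite lee_fin box_volume_ge0.
pose P k c := box_cover (A k) c /\
  \sum_(j <oo) vol (c j) <= lebesgue_outer (A k) + (e%:num / (2 ^ k.+1)%:R)%:E.
have [G PG] : {G & forall k, P k (G k)}.
  apply: (@choice _ _ P) => k; rewrite /P /lebesgue_outer.
  set S := (X in ereal_inf X); move infS : (ereal_inf S) => iS.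
  case: iS infS => [r Sr|Soo|Soo].
  - have en1 : (0 < e%:num / (2 ^ k.+1)%:R)%R by [].
    have /(lb_ereal_inf_adherent en1) : ereal_inf S \is a fin_num by rewrite Sr.
    move=> [x [c Ac <-] xS].
    by exists c; split => //; rewrite -Sr; exact/ltW.
  - by have := Aoo k; rewrite /lebesgue_outer Soo.
  - suff : lbound S 0 by move/le_ereal_inf_tmp; rewrite Soo.
    move=> /= _ [c Ac <-]; apply: nneseries_ge0 => j _ _.
    exact: (vol_ge0 (c j)).
apply: (@le_trans _ _ (\esum_(i in setT) (vol \o uncurry G) i)).
  rewrite /lebesgue_outer; apply: ereal_inf_lbound => /=.
  have /card_esym/ppcard_eqP[f] := card_nat2.
  exists (uncurry G \o f).
    move=> t [i _] /((PG i).1) [j _ Bt]; exists (f^-1%FUN (i, j)) => //=.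
    by rewrite invK ?inE.
  rewrite -(esum_pred_image (vol \o uncurry G) _ xpredT) ?[fun=> _]set_true//.
    by rewrite image_eq.
  by move=> j _; exact: vol_ge0.
rewrite (_ : esum _ _ = \sum_(i <oo) \sum_(j <oo) vol (G i j)); last first.
  pose J : nat -> set (nat * nat) := fun i => [set (i, j) | j in setT].
  rewrite (_ : setT = \bigcup_k J k); last first.
    by rewrite predeqE => -[a b]; split => // _; exists a => //; exists b.
  rewrite esum_bigcupT /=; last 2 first.
    - apply/trivIsetP => i j _ _ ij.
      rewrite predeqE => -[k m] /=; split => //= -[] [_] _ [<-{k} _].
      by move=> [m' _] [] /esym/eqP; rewrite (negbTE ij).
    - by move=> /= [k m]; exact: vol_ge0.
  rewrite -(image_id [set: nat]) -fun_true esum_pred_image//; last first.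
    by move=> k _; exact: esum_ge0.
  apply: eq_eseriesr => /= j _.
  rewrite -(esum_pred_image (vol \o uncurry G) (pair j) predT)//=; last first.
    by move=> ? ? _ _; exact: (@can_inj _ _ _ snd).
  by congr esum; rewrite predeqE => -[a b]; split; move=> [i _ <-]; exists i.
apply: lee_nneseries => [i _ _|i _]; last exact: (PG i).2.
exact: nneseries_ge0.
Qed.

HB.instance Definition _ := isOuterMeasure.Build R 'rV[R]_n.+1 lebesgue_outer
  lebesgue_outer0 lebesgue_outer_ge0 le_lebesgue_outer
  lebesgue_outer_sigma_subadditive.

Definition euclid := caratheodory_type lebesgue_outer.

HB.instance Definition _ := Measurable.on euclid.

Definition lebesgue_euclid (A : set euclid) : \bar R := lebesgue_outer A.

HB.instance Definition _ := isMeasure.Build _ euclid R lebesgue_euclid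
  (@caratheodory_measure0 _ _ lebesgue_outer)
  (@caratheodory_measure_ge0 _ _ lebesgue_outer)
  (@caratheodory_measure_sigma_additive _ _ lebesgue_outer).

End lebesgue_outer_measure.

(** * Rearrangement-invariant norms

    The underlying measure space is (D, mu), with D a measurable subset of T;
    elements of M(D) are functions on T, whose values outside of D are
    irrelevant. Functionals on M_+(D) are total functions, whose values outside
    of M_+(D) are irrelevant. *)

Section ri_norm.
Context d (T : measurableType d) (R : realType).
Variables (mu : {measure set T -> \bar R}) (D : set T).
Implicit Types (f g : T -> \bar R) (rho : (T -> \bar R) -> \bar R).

Definition Mplus : set (T -> \bar R) :=
  [set f : T -> \bar R | measurable_fun D f /\ forall x, D x -> 0 <= f x].

Definition rearr f (t : R) : \bar R :=
  ereal_inf [set l%:E | l in [set l : R | (0 < l)%R /\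
    mu (D `&` [set x | l%:E < `|f x|]) <= t%:E]].

Record is_ri_norm rho : Prop := {
  ri_ge0 : forall f, Mplus f -> 0 <= rho f ;
  ri_eq0 : forall f, Mplus f ->
    rho f = 0 <-> {ae mu, forall x, D x -> f x = 0} ;
  ri_homo : forall f (l : R), Mplus f -> (0 <= l)%R ->
    rho (fun x => l%:E * f x) = l%:E * rho f ;
  ri_triangle : forall f g, Mplus f -> Mplus g ->
    rho (fun x => f x + g x) <= rho f + rho g ;
  ri_le : forall f g, Mplus f -> Mplus g ->
    {ae mu, forall x, D x -> f x <= g x} -> rho f <= rho g ;
  ri_fatou : forall (f_ : (T -> \bar R)^nat) f,
    (forall j, Mplus (f_ j)) -> Mplus f ->
    {ae mu, forall x, D x ->
      nondecreasing_seq (f_ ^~ x) /\ f_ ^~ x @ \oo --> f x} ->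
    nondecreasing_seq (rho \o f_) /\ rho \o f_ @ \oo --> rho f ;
  ri_indic : forall E, measurable E -> E `<=` D -> mu E < +oo ->
    rho (EFin \o \1_E) < +oo ;
  ri_integral : forall E, measurable E -> E `<=` D -> mu E < +oo ->
    exists2 C : R, (0 < C)%R &
      forall f, Mplus f -> \int[mu]_(x in E) f x <= C%:E * rho f ;
  ri_rearr : forall f g, Mplus f -> Mplus g ->
    (forall t, (0 < t)%R -> rearr f t = rearr g t) -> rho f = rho g }.

Definition space_norm rho f : \bar R := rho (fun x => `|f x|).

Definition ri_space rho : set (T -> \bar R) :=
  [set f : T -> \bar R | measurable_fun D f /\ space_norm rho f < +oo].

Definition associate rho g : \bar R :=
  ereal_sup [set \int[mu]_(x in D) (f x * g x)
            | f in [set f | Mplus f /\ rho f <= 1]].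

(* Op : X(rho1) -> X(rho2) *)
Definition bounded_op (Op : (T -> \bar R) -> (T -> \bar R)) rho1 rho2 : Prop :=
  exists2 C : R, (0 < C)%R & forall f, ri_space rho1 f ->
    space_norm rho2 (Op f) <= C%:E * space_norm rho1 f.

Definition embedded rho1 rho2 : Prop := bounded_op id rho1 rho2.

End ri_norm.

(** * R.i. norms on (0, oo) and on R^n, and the maximal operator *)

(* R with its Lebesgue measurable sets: the carrier of
   [completed_lebesgue_measure] *)
Notation lline R := (caratheodory_type (@wlength R idfun)^*%mu).

Section half_line.
Context (R : realType).
Implicit Types (r : (lline R -> \bar R) -> \bar R) (h : lline R -> \bar R).

Definition half_line : set (lline R) := `]0%R, +oo[.

Definition is_ri_norm_half_line r : Prop :=
  is_ri_norm (@completed_lebesgue_measure R) half_line r.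

Definition psi (t : lline R) : \bar R :=
  (\1_(`]0%R, 1%R[%classic : set R) t * ln (t^-1))%:E.

Definition tail_average h (t : lline R) : \bar R :=
  \int[@completed_lebesgue_measure R]_(s in (`]t, +oo[ : set R))
    (h s * (s^-1)%:E).

End half_line.
Arguments half_line R _ : clear implicits.
Arguments psi R t : clear implicits.

Section euclidean_space.
Context (R : realType) (n : nat).
Local Notation En := (euclid R n).
Local Notation mu := (@lebesgue_euclid R n).
Implicit Types (rho : (En -> \bar R) -> \bar R).
Implicit Types (r : (lline R -> \bar R) -> \bar R).

Definition is_ri_norm_euclid rho : Prop := is_ri_norm mu setT rho.

Definition associate_euclid rho : (En -> \bar R) -> \bar R :=
  associate mu setT rho.

Definition is_representation rho r : Prop :=
  is_ri_norm_half_line r /\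
  forall f : En -> \bar R, measurable_fun setT f ->
    space_norm rho f = space_norm r (rearr mu setT f).

(* The representation norm exists when rho is an r.i. norm, and its values on
   M_+(0, oo) are uniquely determined by rho. *)
Definition representation rho : (lline R -> \bar R) -> \bar R :=
  get (is_representation rho).

Definition cube (a : 'rV[R]_n.+1) (l : R) : set En :=
  box a (a + const_mx l)%R.

(* The average over Q is computed in [0, +oo], so that [maximal f] is defined
   for every f. By ri_integral, any f in an r.i. space is locally integrable. *)
Definition maximal (f : En -> \bar R) (x : En) : \bar R :=
  ereal_sup [set ((fine (mu Q))^-1)%:E * \int[mu]_(y in Q) `|f y|
            | Q in [set Q | Q x /\ exists a l, (0 < l)%R /\ Q = cube a l]].

Definition sigma r (f : En -> \bar R) : \bar R :=
  space_norm r (tail_average (rearr mu setT f)).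

End euclidean_space.
Arguments maximal {R n} f x.

(* Main.v *)
From HB Require Import structures.
Require Import Defs.
From mathcomp Require Import all_boot all_order all_algebra.
From mathcomp Require Import all_classical all_reals all_analysis.
From mathcomp Require Import measurable_realfun.


From mathcomp Require Import ring lra.

Import Order.TTheory GRing.Theory Num.Theory.
Import numFieldNormedType.Exports.

Set Implicit Arguments.
Unset Strict Implicit.
Unset Printing Implicit Defensive.

Local Open Scope classical_set_scope.
Local Open Scope ring_scope.
Local Open Scope ereal_scope.

(** Apart from the maximal operator, everything takes place on a measure space
    that carries a gauge ([is_gauge]): a nonnegative function [tau] such that
    the set [tau < t] has measure [t] for all [t > 0]. On the Euclidean space
    of dimension [n.+1] it is [(2 |x|) ^ n.+1], with the sup norm [|x|], and
    [tau <= t] is the cube of measure [t] centred at the origin. A gauge makes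
    the half line unnecessary: [sym f], the composition of the rearrangement
    of [f] with [tau], is equimeasurable with [f], and norms on the half line
    correspond to norms on the space through the composition with [tau]
    ([pull], [representation_is_ri_norm]). The representation norm being
    unique ([representation_unique]), [sigma f] is, with [rho] the norm of [X]
    and [rho'] its associate, [rho' (tailop (sym f))], where [tailop G x] is
    the integral of [G y / tau y] over [tau y > tau x]; this is [tail_norm f].

    The transpose of [tailop] ([hardy_duality]) is [avgop], which averages over
    the sets [tau < t] and maps [sym h] to the maximal rearrangement of [h].
    With the inequality of Hardy and Littlewood this gives
    [tail_norm f = sup { \int avgop (sym h) * sym f | rho h <= 1 }]
    ([avgop_le_tail_norm], [tail_norm_le]). The weights [avgop (sym h)] are
    nonincreasing functions of [tau], so each of these integrals is a supremum
    of [\int k * f] over functions [k] with prescribed bounds on their level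
    sets ([resonance]), and therefore subadditive in [f] ([avgop_symD]). Hence
    [tail_norm] is an r.i. norm as soon as it is finite on sets of finite
    measure. For a set of measure [a] the function under the norm is
    [max 0 (ln (a / t))] ([tail_average_indic]), so that this finiteness is
    precisely the condition on [psi].

    Boundedness. Vitali's covering lemma gives the weak type estimate for [M]
    ([maximal_weak_type]), and cutting [f] at the height of its rearrangement
    turns it into [sym (M f) <= (3 ^ n.+1 + 1) * avgop (sym f)]
    ([sym_maximal_le]). Then, up to this constant, [\int M f * g] is at most
    [\int avgop (sym f) * sym g = \int sym f * tailop (sym g)], hence at most
    [rho f * tail_norm g] ([associate_tail_norm_bound]).

    Optimality and necessity. The sets [tau <= t] are cubes, so that
    [avgop (sym h) <= M (sym h)] ([avgop_le_maximal]). If [M] maps [X] to [Z],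
    then [avgop (sym h)] is bounded in [Z] for [rho h <= 1], and the formula for
    [tail_norm] gives [tail_norm g <= C * rhoZ' g] ([tail_norm_le_associate]).
    For the indicator of the unit cube the right-hand side is finite, which is
    the condition on [psi] ([psi_in_space]). Passing to associate norms
    reverses the inequality and gives [rhoZ'' <= C * (tail_norm)']; the theorem
    of Lorentz and Luxemburg [rhoZ <= rhoZ''] ([lorentz_luxemburg]) then yields
    the embedding. The latter is proved by projecting a bounded function, in
    the sense of least squares, onto the unit ball of the norm: the residual is
    a functional that attains its norm on the ball at the projection. *)

(** * Volumes of boxes *)

Section box_measure.
Context {R : realType} {n : nat}.
Local Notation En := (euclid R n).
Local Notation mu := (@lebesgue_euclid R n).
Implicit Types (a b x : 'rV[R]_n.+1).

(** Interpolates between the indicator of the box and its volume: the first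
    [m] factors of the product of one-dimensional indicators are replaced by
    lengths. *)
Definition partial_volume (m : nat) a b x : R :=
  (\prod_(i < n.+1) (if (i < m)%N then Num.max 0 (b ord0 i - a ord0 i)
   else \1_(`[a ord0 i, b ord0 i]%classic : set R) (x ord0 i)))%R.

Lemma partial_volume_ge0 m a b x : (0 <= partial_volume m a b x)%R.
Proof.
by apply: prodr_ge0 => i _; case: ifP => _; rewrite ?le_max ?lexx ?indicE.
Qed.

Lemma partial_volume0 a b x : partial_volume 0 a b x = \1_(box a b) x.
Proof.
rewrite /partial_volume indicE; have [xab|xab] := boolP (x \in box a b).
  rewrite big1// => i _; rewrite /= indicE mem_set//=.
  by move: xab; rewrite inE => /(_ i); rewrite in_itv.
have [i xi] : exists i, ~~ (a ord0 i <= x ord0 i <= b ord0 i)%R.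
  apply: contrapT => xabN; move/negP: xab; apply; rewrite inE => i.
  by apply: contrapT => /negP ?; apply: xabN; exists i.
rewrite (bigD1 i)//= indicE memNset ?mul0r//=.
by apply/negP; rewrite in_itv.
Qed.

Lemma partial_volumeT a b x : partial_volume n.+1 a b x = box_volume a b.
Proof. by apply: eq_bigr => i _; rewrite ltn_ord. Qed.

Lemma integral_partial_volume (i : 'I_n.+1) a b x :
  \int[@lebesgue_measure R]_t
     (partial_volume i a b (\row_j (if j == i then t else x ord0 j)))%:E =
  (partial_volume i.+1 a b x)%:E.
Proof.
have maxE : lebesgue_measure (`[a ord0 i, b ord0 i]%classic : set R) =
    (Num.max 0 (b ord0 i - a ord0 i))%:E.
  rewrite lebesgue_measure_itv/= lte_fin; case: ltP => ab.
    by rewrite -EFinB max_r// subr_ge0 ltW.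
  by rewrite max_l// subr_le0.
rewrite /partial_volume [in RHS](bigD1 i)//= leqnn EFinM.
under eq_integral => t _.
  rewrite (bigD1 i)//= ltnn mxE eqxx mulrC.
  rewrite (eq_bigr (fun j : 'I_n.+1 => if (j < i.+1)%N
    then Num.max 0 (b ord0 j - a ord0 j)
    else \1_(`[a ord0 j, b ord0 j]%classic : set R) (x ord0 j))%R); last first.
    move=> j ji; rewrite mxE (negbTE ji) ltnS.
    by rewrite [in RHS]leq_eqVlt (_ : (j : nat) == i = false)//; apply/negbTE.
  rewrite EFinM.
  over.
rewrite ge0_integralZl_EFin//.
- rewrite muleC integral_indic//; congr (_ * _).
  by rewrite setIT; exact: maxE.
- exact/measurable_EFinP.
- by apply: prodr_ge0 => j _; case: ifP => _; rewrite ?le_max ?lexx ?indicE.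
Qed.

Lemma measurable_partial_volume (i : 'I_n.+1) a b x :
  measurable_fun setT (fun t : R =>
    (partial_volume i a b (\row_j (if j == i then t else x ord0 j)))%:E).
Proof.
apply/measurable_EFinP; apply: measurable_prod => j _.
case: (j < i)%N; first exact: measurable_cst.
have [->|ji] := eqVneq j i.
  by rewrite [X in measurable_fun _ X](_ : _ =
    \1_(`[a ord0 i, b ord0 i]%classic : set R))//; apply/funext => t;
    rewrite mxE eqxx.
rewrite [X in measurable_fun _ X](_ : _ = cst
    (\1_(`[a ord0 j, b ord0 j]%classic : set R) (x ord0 j)))//.
by apply/funext => t; rewrite mxE (negbTE ji).
Qed.

(** Integrating out one coordinate at a time turns an inequality between
    indicators of boxes into the same inequality between their volumes, by
    monotone convergence. *)
Lemma box_volume_le_series a b (c : nat -> 'rV[R]_n.+1 * 'rV[R]_n.+1) :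
  box a b `<=` \bigcup_k box (c k).1 (c k).2 ->
  (box_volume a b)%:E <= \sum_(k <oo) (box_volume (c k).1 (c k).2)%:E.
Proof.
move=> abc.
suff H m : (m <= n.+1)%N -> forall x, (partial_volume m a b x)%:E <=
    \sum_(k <oo) (partial_volume m (c k).1 (c k).2 x)%:E.
  have := H n.+1 (leqnn _) 0%R; rewrite partial_volumeT.
  by under eq_eseriesr do rewrite partial_volumeT.
elim: m => [_ x|m IH mn x].
  rewrite partial_volume0 indicE; have [|_] := boolP (x \in box a b).
    rewrite inE => /abc[k _ xk].
    rewrite (nneseriesD1 (n := k))//; last first.
      by move=> j _; rewrite lee_fin partial_volume_ge0.
    rewrite partial_volume0 indicE mem_set//= leeDl//.
    by apply: nneseries_ge0 => j *; rewrite lee_fin partial_volume_ge0.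
  by apply: nneseries_ge0 => j *; rewrite lee_fin partial_volume_ge0.
pose i : 'I_n.+1 := Ordinal mn.
rewrite -(integral_partial_volume i).
under eq_eseriesr do rewrite -(integral_partial_volume i).
rewrite -integral_nneseries//; last 2 first.
- by move=> k; exact: measurable_partial_volume.
- by move=> k t _; rewrite lee_fin partial_volume_ge0.
apply: ge0_le_integral => //.
- by move=> t _; rewrite lee_fin partial_volume_ge0.
- exact: measurable_partial_volume.
- apply: ge0_emeasurable_sum => [k t _ _|k _].
    by rewrite lee_fin partial_volume_ge0.
  exact: measurable_partial_volume.
- by move=> t _; apply: IH; exact: ltnW.
Qed.

Lemma lebesgue_outer_box a b : lebesgue_outer (box a b) = (box_volume a b)%:E.
Proof.
apply/eqP; rewrite eq_le; apply/andP; split; last first.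
  by apply: le_ereal_inf_tmp => _ [c cab <-]; exact: box_volume_le_series.
apply: ereal_inf_lbound.
exists (fun k : nat => if (k == 0)%N then (a, b)
    else (0%R, const_mx (-1)%R)) => /=.
  by move=> x xab; exists 0%N.
rewrite (nneseriesD1 (n := 0%N))//=; last first.
  by move=> k _; rewrite lee_fin box_volume_ge0.
rewrite eseries0 ?adde0// => -[//|k _ _].
by rewrite /box_volume big_ord_recl !mxE/= subr0 max_l ?mul0r// lerN10.
Qed.

(** A hyperplane orthogonal to an axis cuts each box of a cover into two boxes
    whose volumes add up. *)
Lemma measurable_half_space (i : 'I_n.+1) (r : R) :
  measurable ([set x | (x ord0 i <= r)%R] : set En).
Proof.
apply: le_caratheodory_measurable => X.
apply: le_ereal_inf_tmp => _ [c Xc <-].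
pose lo k : 'rV[R]_n.+1 :=
  \row_j (if j == i then Num.min ((c k).2 ord0 j) r else (c k).2 ord0 j).
pose hi k : 'rV[R]_n.+1 :=
  \row_j (if j == i then Num.max ((c k).1 ord0 j) r else (c k).1 ord0 j).
rewrite (eq_eseriesr (g := fun k => (box_volume (c k).1 (lo k))%:E +
    (box_volume (hi k) (c k).2)%:E)); last first.
  move=> k _; rewrite -EFinD; congr (_%:E).
  rewrite /box_volume !(bigD1 (P := predT) i)//= !mxE eqxx.
  under [X in _ = (_ * X + _)%R]eq_bigr => j ji do rewrite mxE (negbTE ji).
  under [X in _ = (_ + _ * X)%R]eq_bigr => j ji do rewrite mxE (negbTE ji).
  rewrite -mulrDl; congr (_ * _)%R.
  set u := (c k).1 ord0 i; set v := (c k).2 ord0 i.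
  have maxE (t : R) : Num.max 0%R t = (if (0 <= t)%R then t else 0%R).
    by case: leP.
  rewrite !maxE; case: (leP v r) => vr; case: (leP u r) => ur;
    do ! case: ifPn => ?; lra.
rewrite nneseriesD//; last 2 first.
- by move=> k _; rewrite lee_fin box_volume_ge0.
- by move=> k _; rewrite lee_fin box_volume_ge0.
apply: leeD.
- apply: ereal_inf_lbound; exists (fun k => ((c k).1, lo k)) => //.
  move=> x [/Xc[k _ xk] /= xr]; exists k => // j /=; rewrite mxE.
  have := xk j; case: eqP => [->|//] /andP[-> /=].
  by rewrite le_min => ->.
- apply: ereal_inf_lbound; exists (fun k => (hi k, (c k).2)) => //.
  move=> x [/Xc[k _ xk] /= /negP]; rewrite -ltNge => /ltW xr.
  exists k => // j /=; rewrite mxE.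
  have := xk j; case: eqP => [->|//] /andP[+ ->].
  by rewrite ge_max xr andbT => ->.
Qed.

Lemma measurable_coord (i : 'I_n.+1) :
  measurable_fun setT (fun x : En => (x : 'rV[R]_n.+1) ord0 i).
Proof.
apply: (measurability _ (@RGenOInfty.measurableE R)) => _ [_ [r ->] <-].
rewrite setTI (_ : _ @^-1` _ = ~` [set x : En | ((x : 'rV[R]_n.+1) ord0 i <= r)%R]).
  by apply: measurableC; exact: measurable_half_space.
apply/seteqP; split=> x /=; rewrite in_itv/= andbT ltNge => /negP //.
Qed.

Lemma measurable_box a b : measurable (box a b : set En).
Proof.
rewrite (_ : box a b = \bigcap_(i in [set: 'I_n.+1])
    ((fun x : En => (x : 'rV[R]_n.+1) ord0 i) @^-1` `[a ord0 i, b ord0 i])).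
  apply: fin_bigcap_measurable => // i _; rewrite -[X in measurable X]setTI.
  exact: measurable_coord.
by apply/seteqP; split=> x /= H i => [_|]; have := H i; rewrite /= in_itv//=; apply.
Qed.

Lemma lebesgue_euclid_box a b : mu (box a b) = (box_volume a b)%:E.
Proof. exact: lebesgue_outer_box. Qed.

Lemma box_coverT :
  \bigcup_k (box (const_mx (- k%:R)%R) (const_mx k%:R) : set En) = setT.
Proof.
apply/seteqP; split=> // x _; have [k xk] : exists k : nat, forall i,
    (`|(x : 'rV[R]_n.+1) ord0 i| <= k%:R)%R.
  exists (\max_i (Num.truncn `|(x : 'rV[R]_n.+1) ord0 i|).+1) => i.
  apply: (@le_trans _ _ (Num.truncn `|(x : 'rV[R]_n.+1) ord0 i|).+1%:R).
    by apply/ltW; rewrite truncnS_gt.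
  rewrite ler_nat.
  exact: (leq_bigmax (F := fun i => (Num.truncn `|(x : 'rV[R]_n.+1) ord0 i|).+1)).
by exists k => // i; rewrite !mxE -ler_norml.
Qed.

Lemma lebesgue_euclid_sigma_finite : sigma_finite setT mu.
Proof.
exists (fun k => box (const_mx (- k%:R)%R) (const_mx k%:R)).
  by rewrite box_coverT.
move=> k; split; first exact: measurable_box.
by rewrite lebesgue_euclid_box ltry.
Qed.

HB.instance Definition _ := @Measure_isSigmaFinite.Build _ En R mu
  lebesgue_euclid_sigma_finite.

End box_measure.

(** * Lebesgue measurable sets of the line *)

Section lebesgue_line.
Context {R : realType}.
Local Notation lam := (@completed_lebesgue_measure R).

Lemma measurable_lline_borel (A : set R) :
  measurable (A : set (measurableTypeR R)) -> measurable (A : set (lline R)).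
Proof. by move=> mA; apply: sub_caratheodory. Qed.

Lemma completed_lebesgueE (A : set R) :
  lam A = @lebesgue_measure R A.
Proof. by []. Qed.

(** The Caratheodory measurable sets of the line are the Borel sets completed
    by subsets of null sets. This is how statements on Lebesgue sets are
    reduced to Borel sets, on which measures are determined by intervals. *)
Lemma lline_borel_null (A : set (lline R)) : measurable A ->
  exists B N F : set R, [/\ measurable (B : set (measurableTypeR R)),
    measurable (F : set (measurableTypeR R)), @lebesgue_measure R F = 0,
    N `<=` F & A = B `|` N].
Proof.
move=> mA; have : (completed_algebra_gen (@lebesgue_measure R)).-sigma.-measurable
    (A : set R).
  by rewrite completed_caratheodory_measurable.
rewrite g_sigma_completed_algebra_genE => -[B mB [N [F [mF F0 NF]]]] <-.
by exists B, N, F.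
Qed.

Lemma measurable_idfun_lline :
  measurable_fun setT (fun t : lline R => t : R).
Proof.
by move=> _ A mA; rewrite setTI; exact: measurable_lline_borel.
Qed.

Lemma measurable_interval_lline (A : set R) :
  is_interval A -> measurable (A : set (lline R)).
Proof.
move=> iA; apply: measurable_lline_borel; exact: is_interval_measurable.
Qed.

Lemma measurable_half_line : measurable (half_line R).
Proof. by apply: measurable_lline_borel; exact: measurable_itv. Qed.

End lebesgue_line.

(** * The gauge of concentric cubes *)

Section cube_gauge.
Context {R : realType} {n : nat}.
Local Notation En := (euclid R n).
Local Notation mu := (@lebesgue_euclid R n).
Local Notation lam := (@completed_lebesgue_measure R).

(** The norm whose balls are cubes, so that sublevel sets of the gauge are
    among the sets over which the maximal operator averages. *)
Definition supnorm (x : En) : R :=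
  (\big[Num.max/0]_(i < n.+1) `|(x : 'rV[R]_n.+1) ord0 i|)%R.

Definition cube_gauge (x : En) : lline R := ((2 * supnorm x) ^+ n.+1)%R.

Definition root (t : R) : R := (t `^ (n.+1%:R^-1))%R.

Lemma root_ge0 t : (0 <= root t)%R. Proof. exact: powR_ge0. Qed.

Lemma rootK t : (0 <= t)%R -> (root t ^+ n.+1 = t)%R.
Proof.
by move=> t0; rewrite -powR_mulrn ?powR_ge0// -powRrM mulVf ?pnatr_eq0// powRr1.
Qed.

Lemma supnorm_ge0 x : (0 <= supnorm x)%R.
Proof. by apply: bigmax_ge_id. Qed.

Lemma cube_gauge_ge0 x : (0 <= (cube_gauge x : R))%R.
Proof. by rewrite exprn_ge0// mulr_ge0// supnorm_ge0. Qed.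

Lemma box_volume_cube (a : 'rV[R]_n.+1) (l : R) : (0 <= l)%R ->
  box_volume a (a + const_mx l) = (l ^+ n.+1)%R.
Proof.
move=> l0; rewrite /box_volume (eq_bigr (fun=> l)).
  by rewrite prodr_const card_ord.
by move=> i _; rewrite !mxE addrAC subrr add0r max_r.
Qed.

Lemma lebesgue_euclid_cube (a : 'rV[R]_n.+1) (l : R) : (0 <= l)%R ->
  mu (cube a l) = (l ^+ n.+1)%:E.
Proof. by move=> l0; rewrite lebesgue_euclid_box box_volume_cube. Qed.

Lemma cube_gauge_le_cube (r : R) : (0 <= r)%R ->
  [set x | ((cube_gauge x : R) <= r ^+ n.+1)%R] = cube (const_mx (- (r / 2))%R) r.
Proof.
move=> r0.
have E : ((const_mx (- (r / 2)) + const_mx r)%R : 'rV[R]_n.+1) =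
    const_mx (r / 2)%R.
  by apply/matrixP => i j; rewrite !mxE; lra.
apply/seteqP; split => x /=.
  rewrite /cube_gauge ler_pXn2r ?nnegrE ?mulr_ge0 ?supnorm_ge0// => xr i.
  have xr2 : (supnorm x <= r / 2)%R by lra.
  have /bigmax_leP[_ /(_ i isT)] := xr2.
  by rewrite E !mxE ler_norml.
rewrite /cube E => H.
rewrite /cube_gauge ler_pXn2r ?nnegrE ?mulr_ge0 ?supnorm_ge0//.
suff : (supnorm x <= r / 2)%R by lra.
apply/bigmax_leP; split => [|i _]; first lra.
by have := H i; rewrite !mxE ler_norml.
Qed.

Lemma measurable_cube_gauge_le (t : R) : measurable [set x | ((cube_gauge x : R) <= t)%R].
Proof.
have [t0|t0] := leP 0%R t.
  by rewrite -(rootK t0) cube_gauge_le_cube ?root_ge0//; exact: measurable_box.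
rewrite (_ : [set _ | _] = set0)//; apply/seteqP; split => // x /=.
by move=> /le_lt_trans/(_ t0); rewrite ltNge cube_gauge_ge0.
Qed.

Lemma measure_cube_gauge_le (t : R) : (0 <= t)%R ->
  mu [set x | ((cube_gauge x : R) <= t)%R] = t%:E.
Proof.
move=> t0; rewrite -{1}(rootK t0) cube_gauge_le_cube ?root_ge0//.
by rewrite lebesgue_euclid_cube ?root_ge0// rootK.
Qed.

Lemma measurable_cube_gauge_borel :
  measurable_fun setT (cube_gauge : En -> measurableTypeR R).
Proof.
apply: (measurability _ (@RGenOInfty.measurableE R)) => _ [_ [r ->] <-].
rewrite setTI (_ : _ @^-1` _ = ~` [set x | ((cube_gauge x : R) <= r)%R]).
  by apply: measurableC; exact: measurable_cube_gauge_le.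
by apply/seteqP; split=> x /=; rewrite in_itv/= andbT ltNge => /negP //.
Qed.

Let neg_line : set (measurableTypeR R) := `]-oo, 0%R].

Let m_neg_line : measurable neg_line.
Proof. exact: measurable_itv. Qed.

Let pushed := measure_add
  (measure_function_pushforward__canonical__measure_function_Measure mu
    measurable_cube_gauge_borel) (mrestr (@lebesgue_measure R) m_neg_line).

Let pushed_def A : pushed A =
  mu (cube_gauge @^-1` A) + @lebesgue_measure R (A `&` neg_line).
Proof. by rewrite /pushed measure_addE. Qed.

Lemma measure_cube_gauge_itv (a b : R) : (a <= b)%R ->
  mu (cube_gauge @^-1` (`]a, b]%classic : set R)) =
  (Num.max 0 b - Num.max 0 a)%:E.
Proof.
move=> ab.
have E t : mu [set x | ((cube_gauge x : R) <= t)%R] = (Num.max 0%R t)%:E.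
  case: leP => t0; first exact: measure_cube_gauge_le.
  rewrite (_ : [set _ | _] = set0) ?measure0//; apply/seteqP; split => // x /=.
  by move=> /le_lt_trans/(_ t0); rewrite ltNge cube_gauge_ge0.
rewrite (_ : _ @^-1` _ = [set x | ((cube_gauge x : R) <= b)%R] `\`
    [set x | ((cube_gauge x : R) <= a)%R]).
  rewrite measureD//=; try exact: measurable_cube_gauge_le.
    by rewrite setIidr ?E ?EFinB// => x /= /le_trans; apply.
  by rewrite E ltry.
apply/seteqP; split => x /=; rewrite in_itv/= ltNge.
  by move=> /andP[/negP ? ?]; split.
by move=> [-> /negP ->].
Qed.

(** Lebesgue measure is characterized among the measures on the whole line,
    whereas the image of the measure under the gauge lives on the half line;
    it is completed by the Lebesgue measure of the negative half line. *)
Let pushedE A : measurable A -> @lebesgue_measure R A = pushed A.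
Proof.
apply: (lebesgue_measure_unique (mu := pushed)) => _ [[a b] _ <-].
rewrite [RHS]pushed_def /=.
have [ba|ab] := leP b a.
  rewrite (_ : `]a, b]%classic = set0).
    by rewrite preimage_set0 set0I !measure0 adde0.
  by apply/seteqP; split => // x /=; rewrite in_itv/= => /andP[/lt_le_trans h /h];
    rewrite ltNge ba.
rewrite measure_cube_gauge_itv ?(ltW ab)//.
rewrite (_ : _ `&` neg_line = `]a, Num.min b 0%R]%classic); last first.
  apply/seteqP; split => x; rewrite /neg_line/= !in_itv/= le_min.
    by move=> [/andP[-> ->] ->].
  by move=> /and3P[-> -> ->].
have leb u v : lebesgue_measure (`]u, v]%classic : set R) =
    (if (u < v)%R then v - u else 0)%R%:E.
  by rewrite lebesgue_measure_itv/= lte_fin; case: ltP.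
rewrite leb [X in _ + X]leb -EFinD ab; congr (_%:E).
have [b0|b0] := leP b 0%R; have [a0|a0] := ltP a 0%R; rewrite ?ab; lra.
Qed.

Lemma measure_cube_gauge_borel (A : set R) :
  measurable (A : set (measurableTypeR R)) -> A `<=` `]0%R, +oo[%classic ->
  mu (cube_gauge @^-1` A) = @lebesgue_measure R A.
Proof.
move=> mA A0; rewrite pushedE// pushed_def.
rewrite (_ : A `&` neg_line = set0) ?measure0 ?adde0//.
apply/seteqP; split => // x [/A0 /=]; rewrite /neg_line/= !in_itv/= andbT => x0.
by rewrite leNgt x0.
Qed.

Lemma measure_cube_gauge0 : mu (cube_gauge @^-1` [set 0%R]) = 0.
Proof.
have H := measure_cube_gauge_le (lexx 0%R).
apply/eqP; rewrite eq_le measure_ge0 andbT -[leRHS]H.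
apply: le_measure; rewrite ?inE.
- rewrite -[X in measurable X]setTI.
  by apply: (measurable_cube_gauge_borel measurableT); exact: measurable_set1.
- exact: measurable_cube_gauge_le.
- by move=> x /= ->.
Qed.

(** A Lebesgue set differs from a Borel set by a subset of a Borel null set,
    and the preimage of the latter is null. *)
Lemma measurable_cube_gauge : measurable_fun setT (cube_gauge : En -> lline R).
Proof.
move=> _ A mA; rewrite setTI.
have [B [N [F [mB mF F0 NF AE]]]] := lline_borel_null mA.
rewrite AE preimage_setU; apply: measurableU.
  by rewrite -[X in measurable X]setTI; exact: measurable_cube_gauge_borel.
have m0 : measurable (cube_gauge @^-1` [set 0%R]).
  rewrite -[X in measurable X]setTI.
  by apply: (measurable_cube_gauge_borel measurableT); exact: measurable_set1.
have null0 := measure_cube_gauge0.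
have mFP : measurable (F `&` `]0%R, +oo[%classic : set (measurableTypeR R)).
  by apply: measurableI => //; exact: measurable_itv.
have mF' : measurable (cube_gauge @^-1` (F `&` `]0%R, +oo[%classic)).
  by rewrite -[X in measurable X]setTI; exact: (measurable_cube_gauge_borel measurableT).
have nullF : mu (cube_gauge @^-1` (F `&` `]0%R, +oo[%classic)) = 0.
  rewrite measure_cube_gauge_borel//.
  by apply/eqP; rewrite eq_le measure_ge0 andbT -F0; apply: le_measure; rewrite ?inE.
apply: (@measure_is_complete_caratheodory _ _ (@lebesgue_outer R n)).
exists (cube_gauge @^-1` [set 0%R] `|` cube_gauge @^-1` (F `&` `]0%R, +oo[%classic)).
split; first exact: measurableU.
  apply/eqP; rewrite eq_le measure_ge0 andbT.
  by rewrite (le_trans (measureU2 _ _ _))//= [X in X + _]null0 [X in _ + X]nullF adde0.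
move=> x /= /NF Fx; have := cube_gauge_ge0 x; rewrite le_eqVlt => /predU1P[x0|x0].
  by left; rewrite /= -x0.
by right; split => //; rewrite /= in_itv/= x0.
Qed.

Lemma measure_cube_gauge (A : set (lline R)) : measurable A -> A `<=` half_line R ->
  mu (cube_gauge @^-1` A) = lam A.
Proof.
move=> mA A0; have [B [N [F [mB mF F0 NF AE]]]] := lline_borel_null mA.
have mP : measurable (`]0%R, +oo[%classic : set (measurableTypeR R)).
  exact: measurable_itv.
have mPF : measurable (`]0%R, +oo[%classic `&` F : set (measurableTypeR R)).
  exact: measurableI.
have B0 : B `<=` `]0%R, +oo[%classic by move=> x Bx; apply: A0; rewrite AE; left.
have lamA : lam A = @lebesgue_measure R B.
  apply/eqP; rewrite eq_le; apply/andP; split.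
    rewrite AE; apply: (le_trans (outer_measureU2 _ _ _)).
    rewrite [X in _ + X](_ : _ = 0) ?adde0//.
    apply/eqP; rewrite eq_le outer_measure_ge0 andbT -F0.
    exact: le_outer_measure.
  by rewrite AE; apply: le_outer_measure.
rewrite lamA -measure_cube_gauge_borel// AE preimage_setU.
apply/eqP; rewrite eq_le; apply/andP; split; last by apply: le_outer_measure.
apply: (le_trans (outer_measureU2 _ _ _)).
rewrite [X in _ + X](_ : _ = 0) ?adde0//.
apply/eqP; rewrite eq_le outer_measure_ge0 andbT.
apply: (@le_trans _ _ (mu (cube_gauge @^-1` (`]0%R, +oo[ `&` F)))).
  apply: le_outer_measure => x /= Nx; split; last exact: NF.
  by apply: A0; rewrite AE; right.
rewrite measure_cube_gauge_borel// -F0; apply: le_measure; rewrite ?inE//.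
Qed.

End cube_gauge.

(** * Distribution functions and rearrangements *)

Section nonnegative_extended_reals.
Context {R : realType}.
Implicit Types (a b : \bar R).

(** Nonnegative extended reals are compared through their real upper bounds,
    since rearrangements are only known through [rearr_le]. *)
Lemma lee_real_upper a b : 0 <= b ->
  (forall l : R, (0 <= l)%R -> b <= l%:E -> a <= l%:E) -> a <= b.
Proof.
case: b => [r|_ _|//]; last exact: leey.
by rewrite lee_fin => r0; apply.
Qed.

Lemma eqe_real_upper a b : 0 <= a -> 0 <= b ->
  (forall l : R, (0 <= l)%R -> (a <= l%:E) = (b <= l%:E)) -> a = b.
Proof.
move=> a0 b0 ab; apply/eqP; rewrite eq_le.
by apply/andP; split; apply: lee_real_upper => // l l0; rewrite ab.
Qed.

Lemma lee_real_lower a b : 0 <= b ->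
  (forall l : R, (0 <= l)%R -> l%:E < a -> l%:E <= b) -> a <= b.
Proof.
move=> b0 H; rewrite leNgt; apply/negP => ba.
have [c /andP[bc ca]] : exists c : R, b < c%:E < a.
  move: ba b0 {H}; case: b => [b| |]//; case: a => [a| |]//.
  - rewrite lte_fin => ba _; exists ((a + b) / 2)%R.
    by rewrite !lte_fin; apply/andP; split; lra.
  - by move=> _ _; exists (b + 1)%R; rewrite lte_fin ltry andbT ltrDl.
have c0 : (0 <= c)%R by rewrite -lee_fin (le_trans b0)// ltW.
by have := H _ c0 ca; rewrite leNgt bc.
Qed.

End nonnegative_extended_reals.

Section distribution_function.
Context d (T : measurableType d) (R : realType).
Variables (mu : {measure set T -> \bar R}) (D : set T).
Hypothesis mD : measurable D.
Implicit Types (f g : T -> \bar R).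

Definition dist f (l : R) : \bar R := mu (D `&` [set x | l%:E < `|f x|]).

Lemma distE f l : dist f l = mu (D `&` [set x | l%:E < `|f x|]).
Proof. by []. Qed.

Lemma measurable_level f (l : \bar R) : measurable_fun D f ->
  measurable (D `&` [set x | l < `|f x|]).
Proof.
move=> mf; apply: emeasurable_fun_o_infty => //.
exact: (measurableT_comp (@abse_measurable R setT) mf).
Qed.

Lemma le_dist f (l l' : R) : measurable_fun D f -> (l <= l')%R ->
  dist f l' <= dist f l.
Proof.
move=> mf ll; apply: le_measure; rewrite ?inE; try exact: measurable_level.
by move=> x [Dx /= h]; split => //=; rewrite (le_lt_trans _ h)// lee_fin.
Qed.

Lemma rearr_ge0 f t : 0 <= rearr mu D f t.
Proof. by apply: le_ereal_inf_tmp => _ [l [l0 _] <-]; rewrite lee_fin ltW. Qed.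

Lemma rearr_nonincreasing f (t t' : R) : (t <= t')%R ->
  rearr mu D f t' <= rearr mu D f t.
Proof.
move=> tt'; apply: ereal_inf_le_tmp => _ [l [l0 h] <-]; exists l => //; split => //.
by rewrite (le_trans h)// lee_fin.
Qed.

(** The rearrangement is the generalized inverse of the distribution function;
    both inequalities match since the distribution function is
    right-continuous. *)
Lemma rearr_le f (t l : R) : measurable_fun D f -> (0 <= l)%R ->
  (rearr mu D f t <= l%:E) = (dist f l <= t%:E).
Proof.
move=> mf l0; apply/idP/idP => [h|h]; last first.
  apply/lee_addgt0Pr => e e0; apply: ereal_inf_lbound; exists (l + e)%R => //.
  split; first by rewrite ltr_wpDl.
  by apply: le_trans h; apply: le_dist => //; rewrite lerDl ltW.
pose F k := D `&` [set x | (l + k.+1%:R^-1)%:E < `|f x|].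
have FE : D `&` [set x | l%:E < `|f x|] = \bigcup_k F k.
  apply/seteqP; split => [x [Dx /= lx]|x [k _ [Dx /= kx]]]; last first.
    by split => //=; rewrite (le_lt_trans _ kx)// lee_fin lerDl.
  have [k lk] : exists k, (l + k.+1%:R^-1)%:E < `|f x|; last by exists k.
  case: `|f x| lx => [r| |]//; last by exists 0%N; rewrite ltry.
  rewrite lte_fin => lr; exists (Num.truncn (r - l)^-1).
  rewrite lte_fin -ltrBrDl invf_plt ?posrE ?subr_gt0//.
  by rewrite truncnS_gt.
have mF k : measurable (F k) by exact: measurable_level.
have cF : (mu \o F) k @[k --> \oo] --> dist f l.
  rewrite /dist FE; apply: nondecreasing_cvg_mu => //.
    exact: bigcupT_measurable.
  move=> i j ij; apply/subsetPset => x [Dx /= ix]; split => //=.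
  rewrite (le_lt_trans _ ix)// lee_fin lerD2l lef_pV2 ?posrE//.
  by rewrite ler_nat.
rewrite -(cvg_lim _ cF)//; apply: lime_le; first by apply/cvg_ex; eexists; exact: cF.
apply: nearW => k /=.
have /ereal_inf_lt[_ [l' [l'0 h'] <-]] : rearr mu D f t < (l + k.+1%:R^-1)%:E.
  by rewrite (le_lt_trans h)// lte_fin ltrDl.
rewrite lte_fin => /ltW l'k.
exact: le_trans (le_dist mf l'k) h'.
Qed.

Lemma rearr_gt f (t l : R) : measurable_fun D f -> (0 <= l)%R ->
  (l%:E < rearr mu D f t) = (t%:E < dist f l).
Proof. by move=> mf l0; rewrite !ltNge rearr_le. Qed.

End distribution_function.

Section compare_rearrangements.
Context d1 d2 (T1 : measurableType d1) (T2 : measurableType d2) (R : realType).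
Variables (m1 : {measure set T1 -> \bar R}) (m2 : {measure set T2 -> \bar R}).
Variables (D1 : set T1) (D2 : set T2).
Hypotheses (mD1 : measurable D1) (mD2 : measurable D2).

Lemma le_rearr_dist (f : T1 -> \bar R) (g : T2 -> \bar R) t :
  measurable_fun D1 f -> measurable_fun D2 g ->
  (forall l, (0 <= l)%R -> dist m1 D1 f l <= dist m2 D2 g l) ->
  rearr m1 D1 f t <= rearr m2 D2 g t.
Proof.
move=> mf mg fg; apply: lee_real_upper; first exact: rearr_ge0.
by move=> l l0; rewrite !rearr_le//; apply: le_trans; exact: fg.
Qed.

Lemma eq_rearr_dist (f : T1 -> \bar R) (g : T2 -> \bar R) t :
  measurable_fun D1 f -> measurable_fun D2 g ->
  (forall l, (0 <= l)%R -> dist m1 D1 f l = dist m2 D2 g l) ->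
  rearr m1 D1 f t = rearr m2 D2 g t.
Proof.
move=> mf mg fg; apply: eqe_real_upper; rewrite ?rearr_ge0// => l l0.
by rewrite !rearr_le// fg.
Qed.

Lemma eq_dist_rearr (f : T1 -> \bar R) (g : T2 -> \bar R) :
  measurable_fun D1 f -> measurable_fun D2 g ->
  (forall t, (0 < t)%R -> rearr m1 D1 f t = rearr m2 D2 g t) ->
  forall l, (0 <= l)%R -> dist m1 D1 f l = dist m2 D2 g l.
Proof.
move=> mf mg fg l l0.
have H t : (0 < t)%R -> (t%:E < dist m1 D1 f l) = (t%:E < dist m2 D2 g l).
  by move=> t0; rewrite -!rearr_gt// fg.
apply/eqP; rewrite eq_le; apply/andP; split; apply: lee_real_lower => //;
  (try exact: measure_ge0); move=> t; rewrite le_eqVlt => /predU1P[<- _|t0 h];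
  (try exact: measure_ge0); apply: ltW.
  by rewrite -H.
by rewrite H.
Qed.

End compare_rearrangements.

Section monotone_measurable.
Context {R : realType}.

(** Monotone functions are Borel, because their level sets are intervals. *)
Lemma measurable_nonincreasing (D : set (lline R)) (phi : lline R -> \bar R) :
  is_interval (D : set R) ->
  (forall s t : R, D s -> D t -> (s <= t)%R -> phi t <= phi s) ->
  measurable_fun D phi.
Proof.
move=> iD phiD _.
have mD : measurable D by exact: measurable_interval_lline.
apply: (measurability _ (@ErealGenOInfty.measurableE R)) => // _ [_ [r ->] <-].
apply: measurable_interval_lline => x y [Dx /= xr] [Dy /= yr] z /andP[xz zy].
have Dz : D z by apply: (iD x y) => //; rewrite xz zy.
split => //=; move: yr; rewrite !in_itv/= !andbT => yr.
by rewrite (lt_le_trans yr)// phiD.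
Qed.

End monotone_measurable.

(** * Gauges and radial rearrangements *)

Section measure_gauges.
Context d (T : measurableType d) (R : realType).
Local Notation lam := (@completed_lebesgue_measure R).

(** All that is used of the geometry of the space, apart from the maximal
    operator, is a function whose sublevel sets exhaust it at unit speed. *)
Record is_gauge (mu : {measure set T -> \bar R}) (tau : T -> lline R) : Prop := {
  gauge_ge0 : forall x, (0 <= (tau x : R))%R ;
  gauge_measurable : measurable_fun setT tau ;
  gauge_null : mu (tau @^-1` [set 0%R]) = 0 ;
  gauge_measure : forall A, measurable A -> A `<=` half_line R ->
    mu (tau @^-1` A) = lam A }.

End measure_gauges.

Section radial_rearrangement.
Context d (T : measurableType d) (R : realType).
Variables (mu : {measure set T -> \bar R}) (tau : T -> lline R).
Hypothesis tauP : is_gauge mu tau.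
Local Notation lam := (@completed_lebesgue_measure R).
Implicit Types (f g : T -> \bar R).

(** Functions on the half line are transplanted to the whole space along
    [tau]; they are set to 0 on the null set where [tau] vanishes. *)
Definition pull (h : lline R -> \bar R) : T -> \bar R :=
  (h \_ (half_line R)) \o tau.

Lemma pullE h x : (0 < (tau x : R))%R -> pull h x = h (tau x).
Proof. by move=> x0; rewrite /pull/= patchE mem_set//= /half_line/= in_itv/= x0. Qed.

Lemma pull0 h x : (tau x : R) = 0%R -> pull h x = 0.
Proof.
move=> x0; rewrite /pull/= patchE memNset//= /half_line/= in_itv/= x0 ltxx.
by move=> /andP[].
Qed.

Lemma pull_Mplus h : Mplus (half_line R) h -> Mplus setT (pull h).
Proof.
move=> [mh h0]; split.
  apply: measurableT_comp; last exact: (gauge_measurable tauP).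
  exact/(measurable_restrictT _ measurable_half_line).
move=> x _; have := gauge_ge0 tauP x; rewrite le_eqVlt => /predU1P[x0|x0].
  by rewrite pull0// -x0.
by rewrite pullE// h0// /half_line/= in_itv/= x0.
Qed.

Lemma integral_pull h : Mplus (half_line R) h ->
  \int[mu]_x pull h x = \int[lam]_(t in half_line R) h t.
Proof.
move=> [mh h0].
rewrite -(@eq_measure_integral _ _ _ _ lam
  (measure_function_pushforward__canonical__measure_function_Measure mu
    (gauge_measurable tauP))); last first.
  by move=> A mA A0; rewrite /= /pushforward (gauge_measure tauP).
rewrite (ge0_integral_pushforward (gauge_measurable tauP))//; last 2 first.
- exact: measurable_half_line.
- by move=> y; rewrite inE => /h0.
rewrite [RHS]integral_mkcond; apply: eq_integral => x _.
by rewrite /pull /= !patchE.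
Qed.

Lemma half_lineE (t : R) : half_line R t = (0 < t)%R.
Proof. by rewrite /half_line/= in_itv/= andbT. Qed.

Lemma measure_gauge_setI (A : set (lline R)) : measurable A ->
  mu (tau @^-1` A) = lam (A `&` half_line R).
Proof.
move=> mA; have mh := @measurable_half_line R.
have mAh := measurableI _ _ mA mh.
have mg B : measurable B -> measurable (tau @^-1` B).
  by move=> mB; rewrite -[X in measurable X]setTI; exact: (gauge_measurable tauP).
have m0 : measurable ([set 0%R] : set (lline R)).
  by apply: measurable_lline_borel; exact: measurable_set1.
rewrite -(gauge_measure tauP)//.
apply/eqP; rewrite eq_le; apply/andP; split; last first.
  by apply: le_measure; rewrite ?inE; [exact: mg|exact: mg|move=> x []].
apply: (@le_trans _ _
    (mu (tau @^-1` (A `&` half_line R) `|` tau @^-1` [set 0%R]))).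
  apply: le_measure; rewrite ?inE; [exact: mg|apply: measurableU; exact: mg|].
  move=> x /= Ax; have := gauge_ge0 tauP x; rewrite le_eqVlt => /predU1P[x0|x0].
    by right.
  by left; split => //; rewrite half_lineE.
rewrite (le_trans (measureU2 _ _ _))//; try exact: mg.
by rewrite [X in _ + X](gauge_null tauP) adde0.
Qed.

Lemma measure_gauge_lt (s : \bar R) : 0 <= s ->
  mu [set x | (tau x : R)%:E < s] = s.
Proof.
move=> s0; rewrite (_ : [set _ | _] = tau @^-1` [set t : R | t%:E < s])//.
rewrite measure_gauge_setI; last first.
  apply: measurable_interval_lline => x y xs ys z /andP[xz zy] /=.
  by rewrite (le_lt_trans _ ys)// lee_fin.
case: s s0 => [r| |]// r0.
  rewrite (_ : _ `&` _ = `]0%R, r[%classic); last first.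
    by apply/seteqP; split => x /=; rewrite half_lineE lte_fin in_itv/=;
      [move=> [-> ->]|move=> /andP[-> ->]].
  rewrite completed_lebesgueE lebesgue_measure_itv/= lte_fin.
  case: ltP => [_|r0']; first by rewrite -EFinB subr0.
  by apply/eqP; rewrite eq_le r0 lee_fin r0'.
rewrite (_ : _ `&` _ = `]0%R, +oo[%classic); last first.
  by apply/seteqP; split => x /=; rewrite half_lineE in_itv/= andbT ltry => -[].
by rewrite completed_lebesgueE lebesgue_measure_itv/= ltry.
Qed.

Lemma measurable_gauge_lt (s : \bar R) :
  measurable [set x : T | (tau x : R)%:E < s].
Proof.
rewrite (_ : [set _ | _] = tau @^-1` [set t : R | t%:E < s])//.
rewrite -[X in measurable X]setTI; apply: (gauge_measurable tauP) => //.
apply: measurable_interval_lline => x y xs ys z /andP[xz zy] /=.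
by rewrite (le_lt_trans _ ys)// lee_fin.
Qed.

(** With the gauge of concentric cubes, this is the radial rearrangement for
    the sup norm. It stands for the rearrangement, which lives on the half
    line, while staying on the original space. *)
Definition sym f : T -> \bar R := fun x => rearr mu setT f (tau x).

Lemma symE f x : sym f x = rearr mu setT f (tau x).
Proof. by []. Qed.

Lemma sym_ge0 f x : 0 <= sym f x.
Proof. exact: rearr_ge0. Qed.

Lemma sym_gt f x (l : R) : measurable_fun setT f -> (0 <= l)%R ->
  (l%:E < sym f x) = ((tau x : R)%:E < dist mu setT f l).
Proof. by move=> mf l0; rewrite /sym rearr_gt. Qed.

Lemma measurable_sym f : measurable_fun setT (sym f).
Proof.
apply: (@measurableT_comp _ _ _ _ _ _ (rearr mu setT f : lline R -> \bar R));
  last exact: (gauge_measurable tauP).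
apply: measurable_nonincreasing => //.
by move=> s t _ _ st; exact: rearr_nonincreasing.
Qed.

Lemma sym_Mplus f : Mplus setT (sym f).
Proof. by split => [|x _]; [exact: measurable_sym|exact: sym_ge0]. Qed.

Lemma dist_sym f l : measurable_fun setT f -> (0 <= l)%R ->
  dist mu setT (sym f) l = dist mu setT f l.
Proof.
move=> mf l0; rewrite {1}/dist setTI -[RHS]measure_gauge_lt ?measure_ge0//.
by congr (mu _); apply/seteqP; split => x /=;
  rewrite gee0_abs ?sym_ge0// sym_gt.
Qed.

Lemma rearr_sym f t : measurable_fun setT f ->
  rearr mu setT (sym f) t = rearr mu setT f t.
Proof.
move=> mf; apply: eq_rearr_dist => //; first exact: measurable_sym.
by move=> l l0; exact: dist_sym.
Qed.

Lemma measurable_rearr f (D : set (lline R)) : measurable D ->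
  measurable_fun D (rearr mu setT f : lline R -> \bar R).
Proof.
move=> mD; apply: (measurable_funS measurableT (@subsetT _ D)).
apply: measurable_nonincreasing; first by [].
by move=> s t _ _ st; exact: rearr_nonincreasing.
Qed.

Lemma rearr_Mplus f :
  Mplus (half_line R) (rearr mu setT f : lline R -> \bar R).
Proof.
split; first exact/measurable_rearr/measurable_half_line.
by move=> x _; exact: rearr_ge0.
Qed.

Lemma dist_pull (h : lline R -> \bar R) l : measurable_fun (half_line R) h ->
  (0 <= l)%R ->
  dist mu setT (pull h) l = dist lam (half_line R) h l.
Proof.
move=> mh l0; have <- : mu (tau @^-1`
    (half_line R `&` [set t | l%:E < `|h t|])) = dist lam (half_line R) h l.
  apply: (gauge_measure tauP); last by move=> x [].
  by apply: measurable_level => //; exact: measurable_half_line.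
rewrite /dist setTI.
congr (mu _); apply/seteqP; split => x /=; rewrite half_lineE.
  have := gauge_ge0 tauP x; rewrite le_eqVlt => /predU1P[x0|x0].
    by rewrite pull0// abse0 ltNge lee_fin l0.
  by rewrite pullE.
by move=> [x0 h0]; rewrite pullE.
Qed.

Lemma rearr_pull (h : lline R -> \bar R) t : measurable_fun (half_line R) h ->
  rearr mu setT (pull h) t = rearr lam (half_line R) h t.
Proof.
move=> mh; apply: (eq_rearr_dist measurableT (@measurable_half_line R)).
- apply: measurableT_comp; last exact: (gauge_measurable tauP).
  exact/(measurable_restrictT _ measurable_half_line).
- exact: mh.
- by move=> l l0; exact: dist_pull.
Qed.

Lemma sym_pull_rearr f x : (0 < (tau x : R))%R ->
  pull (rearr mu setT f) x = sym f x.
Proof. by move=> x0; rewrite pullE. Qed.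

End radial_rearrangement.

#[global] Opaque sym dist rearr.

(** * Layer sums *)

Section layers.
Context {R : realType}.

(** Discrete layer-cake approximation: the multiples of [delta] below [v], up to
    the [N]-th one, each count for [delta]. *)
Definition layer (delta : R) (N : nat) (v : \bar R) : R :=
  (\sum_(i < N) delta * (((i.+1%:R * delta)%:E < v)%E)%:R)%R.

Lemma layer_ge0 (delta : R) N v : (0 <= delta)%R -> (0 <= layer delta N v)%R.
Proof. by move=> d0; apply: sumr_ge0 => i _; rewrite mulr_ge0. Qed.

Lemma layer_le_top (delta : R) N v : (0 <= delta)%R ->
  (layer delta N v <= N%:R * delta)%R.
Proof.
move=> d0; rewrite mulr_natl -[X in (_ *+ X)%R]card_ord -sumr_const.
by apply: ler_sum => i _; rewrite ler_piMr//; case: (_ < _).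
Qed.

Lemma layer_le (delta : R) N v : (0 <= delta)%R -> 0 <= v ->
  (layer delta N v)%:E <= v.
Proof.
move=> d0 v0; elim: N => [|N IH]; first by rewrite /layer big_ord0.
have [Nv|vN] := ltP (N.+1%:R * delta)%:E v.
  by rewrite (le_trans _ (ltW Nv))// lee_fin layer_le_top.
by rewrite /layer big_ord_recr /= ltNge vN mulr0 addr0.
Qed.

Lemma layer_ge (delta : R) N v (y : R) : (0 <= delta)%R -> y%:E <= v ->
  (y <= N%:R * delta)%R -> (y - delta <= layer delta N v)%R.
Proof.
move=> d0; elim: N y => [|N IH] y yv yN.
  rewrite mul0r in yN.
  by rewrite /layer big_ord0 subr_le0 (le_trans yN).
rewrite /layer big_ord_recr /=; have [yN'|yN'] := leP y (N%:R * delta)%R.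
  by rewrite (le_trans (IH _ yv yN'))// lerDl mulr_ge0.
rewrite (eq_bigr (fun=> delta)); last first.
  move=> i _ /=; rewrite (_ : (_ < v) = true) ?mulr1//; apply: lt_le_trans yv.
  by rewrite lte_fin (le_lt_trans _ yN')// ler_wpM2r// ler_nat.
rewrite sumr_const card_ord.
have : (0 <= delta * (((N.+1%:R * delta)%:E < v)%E)%:R)%R by rewrite mulr_ge0.
move: yN; rewrite -natr1 mulrDl mul1r mulr_natl.
set a := (delta *+ N)%R; set b := (delta * _)%R => *; lra.
Qed.

(** Step [1 / (m + 1)] and height [m + 1]: the sums exhaust every
    nonnegative value as [m] grows. *)
Definition layers (m : nat) : \bar R -> R :=
  layer (m.+1%:R^-1)%R (m.+1 * m.+1).

Lemma layers_ge0 m v : (0 <= layers m v)%R.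
Proof. exact: layer_ge0. Qed.

Lemma layers_le m v : 0 <= v -> (layers m v)%:E <= v.
Proof. by move=> ?; apply: layer_le. Qed.

Lemma cvg_layers v : 0 <= v -> (layers m v)%:E @[m --> \oo] --> v.
Proof.
have top m : ((m.+1 * m.+1)%N%:R * m.+1%:R^-1 = m.+1%:R :> R)%R.
  by rewrite natrM mulfK// pnatr_eq0.
case: v => [r| |//] r0.
- apply: cvg_EFin; first exact: nearW.
  apply: (@squeeze_cvgr _ _ _ _ (fun m => (r - m.+1%:R^-1)%R) (fun=> r)).
  + near=> m; apply/andP; split; last by rewrite -lee_fin layers_le.
    apply: layer_ge => //; rewrite top.
    rewrite -nat1r ler_wpDl//; near: m; exact: nbhs_infty_ger.
  + rewrite -[X in _ --> X]subr0; apply: cvgB; first exact: cvg_cst.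
    exact: cvg_harmonic.
  + exact: cvg_cst.
- apply/cvgeyPge => A; near=> m; rewrite lee_fin.
  apply: (@le_trans _ _ (m.+1%:R - m.+1%:R^-1)%R); last first.
    by apply: layer_ge => //; rewrite ?leey ?top.
  apply: (@le_trans _ _ m%:R); first by near: m; exact: nbhs_infty_ger.
  by rewrite -natr1 lerBrDr lerD2l invf_le1// -?natr1 ?ler1n// lerDr.
Unshelve. all: by end_near. Qed.

Lemma cvg_layersM v w : 0 <= v -> 0 <= w ->
  (layers m v * layers m w)%:E @[m --> \oo] --> v * w.
Proof.
move=> v0 w0.
have z m : layers m (0 : \bar R) = 0%R.
  by apply/eqP; rewrite eq_le layers_ge0 andbT -lee_fin layers_le.
have [->|vn0] := eqVneq v 0.
  by under eq_fun do rewrite z mul0r; rewrite mul0e; exact: cvg_cst.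
have [->|wn0] := eqVneq w 0.
  by under eq_fun do rewrite z mulr0; rewrite mule0; exact: cvg_cst.
under eq_fun do rewrite EFinM.
apply: cvgeM; try exact: cvg_layers.
by rewrite mule_defE (negbTE vn0) (negbTE wn0).
Qed.

Lemma ge0_cvgeMl (a : \bar R) (u : (\bar R)^nat) l : 0 <= a ->
  (forall k, 0 <= u k <= l) -> u @ \oo --> l -> a * u k @[k --> \oo] --> a * l.
Proof.
move=> a0 u0l ul; have [->|an0] := eqVneq a 0.
  by under eq_fun do rewrite mul0e; rewrite mul0e; exact: cvg_cst.
have [l0|ln0] := eqVneq l 0.
  have u0 k : u k = 0 by have := u0l k; rewrite l0 => /le_anti.
  by under eq_fun do rewrite u0 mule0; rewrite l0 mule0; exact: cvg_cst.
apply: cvgeM => //; first by rewrite mule_defE (negbTE an0) (negbTE ln0).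
exact: cvg_cst.
Qed.

Lemma measurable_layers m d (T : measurableType d) (f : T -> \bar R) :
  measurable_fun setT f -> measurable_fun setT (fun x => layers m (f x)).
Proof.
move=> mf; apply: measurable_sum => i; apply: measurable_funM => //.
apply: (measurableT_comp (f := fun b : bool => (b%:R : R))) => //.
exact: measurable_fun_lte.
Qed.

Lemma limn_einf_le (u : (\bar R)^nat) c : (forall k, u k <= c) ->
  limn_einf u <= c.
Proof.
move=> uc; rewrite limn_einf_lim; apply: lime_le; first exact: is_cvg_einfs.
apply: nearW => k; apply: le_trans (uc k).
by apply: ereal_inf_lbound; exists k => /=.
Qed.

End layers.

Section layer_integral.
Context d (T : measurableType d) (R : realType).
Variable mu : {measure set T -> \bar R}.
Implicit Types (f g : T -> \bar R).

(** The integral of a product only sees the measures of the intersections of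
    level sets; estimates for such intersections give estimates for integrals. *)
Lemma integral_layer (delta : R) N f g : (0 <= delta)%R ->
  measurable_fun setT f -> measurable_fun setT g ->
  \int[mu]_x (layer delta N (f x) * layer delta N (g x))%:E =
  \sum_(i < N) \sum_(j < N) (delta * delta)%:E *
    mu ([set x | (i.+1%:R * delta)%:E < f x] `&`
        [set x | (j.+1%:R * delta)%:E < g x]).
Proof.
move=> d0 mf mg.
pose A (h : T -> \bar R) (i : nat) := [set x | (i.+1%:R * delta)%:E < h x].
have mA h i : measurable_fun setT h -> measurable (A h i).
  by move=> mh; rewrite -[A h i]setTI; exact: emeasurable_fun_o_infty.
have mAB i j : measurable (A f i `&` A g j) by apply: measurableI; exact: mA.
have m1 i j : measurable_fun setT
    (fun x => (delta * delta)%:E * (\1_(A f i `&` A g j) x)%:E : \bar R).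
  apply: emeasurable_funM => //; apply/measurable_EFinP.
  exact: measurable_indic.
have ge01 i j x : 0 <= (delta * delta)%:E * (\1_(A f i `&` A g j) x)%:E :> \bar R.
  by rewrite mule_ge0// lee_fin ?mulr_ge0.
transitivity (\int[mu]_x (\sum_(i < N) \sum_(j < N) (delta * delta)%:E *
    (\1_(A f i `&` A g j) x)%:E)).
  apply: eq_integral => x _; rewrite /layer mulr_suml -sumEFin.
  apply: eq_bigr => i _; rewrite mulr_sumr -sumEFin; apply: eq_bigr => j _.
  rewrite indicI/= mulrACA EFinM; congr (_ * _%:E).
  by rewrite !indicE /A /= !mem_setE.
rewrite ge0_integral_sum//; last 2 first.
- by move=> i; apply: emeasurable_sum => j; exact: m1.
- by move=> i x _; apply: sume_ge0 => j _; exact: ge01.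
apply: eq_bigr => i _; rewrite ge0_integral_sum//.
apply: eq_bigr => j _; rewrite ge0_integralZl_EFin ?mulr_ge0//; last first.
  by apply/measurable_EFinP; exact: measurable_indic.
by rewrite integral_indic// setIT.
Qed.

Lemma integral_le_layers f g c : Mplus setT f -> Mplus setT g ->
  (forall m, \int[mu]_x (layers m (f x) * layers m (g x))%:E <= c) ->
  \int[mu]_x (f x * g x) <= c.
Proof.
move=> [mf f0] [mg g0] H.
have -> : \int[mu]_x (f x * g x) = \int[mu]_x (limn_einf
    (fun m => (layers m (f x) * layers m (g x))%:E)).
  apply: eq_integral => x _; have := cvg_layersM (f0 x I) (g0 x I).
  by move=> /cvg_limn_einf_sup[-> _].
apply: le_trans (fatou _ _ _ _) _ => //.
- move=> m; apply/measurable_EFinP.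
  by apply: measurable_funM; exact: measurable_layers.
- by move=> m x _; rewrite lee_fin mulr_ge0// layers_ge0.
- exact: limn_einf_le.
Qed.

End layer_integral.

(** * Rearrangements and almost everywhere monotonicity *)

Section almost_everywhere_monotone.
Context d (T : measurableType d) (R : realType).
Variables (mu : {measure set T -> \bar R}) (D : set T).
Hypothesis mD : measurable D.
Implicit Types (f g : T -> \bar R).

Lemma ae_le_measure (A B : set T) : measurable A -> measurable B ->
  {ae mu, forall x, A x -> B x} -> mu A <= mu B.
Proof.
move=> mA mB [N [mN N0 AB]].
apply: (@le_trans _ _ (mu (B `|` N))); last first.
  by apply: (le_trans (measureU2 _ mB mN)); rewrite [X in _ + X]N0 adde0.
apply: le_measure; rewrite ?inE//; first exact: measurableU.
move=> x Ax; have [Bx|Bx] := pselect (B x); [by left|right].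
by apply: AB => /= /(_ Ax).
Qed.

Lemma ae_le_dist f g l : Mplus D f -> Mplus D g ->
  {ae mu, forall x, D x -> f x <= g x} -> dist mu D f l <= dist mu D g l.
Proof.
move=> [mf f0] [mg g0] fg; apply: ae_le_measure; try exact: measurable_level.
apply: filterS fg => x fg [Dx /=]; have fgx := fg Dx.
by rewrite !gee0_abs ?f0 ?g0// => lf; split => //=; exact: lt_le_trans fgx.
Qed.

Lemma ae_le_rearr f g t : Mplus D f -> Mplus D g ->
  {ae mu, forall x, D x -> f x <= g x} -> rearr mu D f t <= rearr mu D g t.
Proof.
move=> Mf Mg fg; apply: le_rearr_dist => //; [exact: Mf.1|exact: Mg.1|].
by move=> l l0; exact: ae_le_dist.
Qed.

Lemma rearr_ae_cvg_le (f_ : (T -> \bar R)^nat) f t c : 0 <= c ->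
  (forall j, Mplus D (f_ j)) -> Mplus D f ->
  {ae mu, forall x, D x -> nondecreasing_seq (f_ ^~ x) /\ f_ ^~ x @ \oo --> f x} ->
  (forall j, rearr mu D (f_ j) t <= c) -> rearr mu D f t <= c.
Proof.
move=> c0 Mf_ Mf ff H; apply: lee_real_upper => // l l0 cl.
rewrite rearr_le//; last exact: Mf.1.
pose A j := D `&` [set x | l%:E < `|f_ j x|].
have mA j : measurable (A j) by apply: measurable_level => //; exact: (Mf_ j).1.
pose B j := \bigcup_(i < j.+1) A i.
have mB j : measurable (B j) by apply: bigcup_measurable => i _.
have BA j : mu (B j) <= mu (A j).
  apply: ae_le_measure => //; apply: filterS ff => x ff [i /= ij [Dx /=]].
  have [nd _] := ff Dx.
  rewrite !gee0_abs; [|by apply: (Mf_ _).2..] => lf; split => //=.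
  rewrite gee0_abs; last exact: (Mf_ _).2.
  by apply: lt_le_trans lf _; apply: nd; rewrite -ltnS.
have cB : (mu \o B) j @[j --> \oo] --> mu (\bigcup_j B j).
  apply: nondecreasing_cvg_mu => //; first exact: bigcupT_measurable.
  move=> i j ij; apply/subsetPset => x [k /= ki Ax]; exists k => //=.
  exact: leq_trans ki _.
apply: (@le_trans _ _ (mu (\bigcup_j B j))).
  apply: ae_le_measure => //; first by apply: measurable_level => //; exact: Mf.1.
    exact: bigcupT_measurable.
  apply: filterS ff => x ff [Dx /=]; have [nd cf] := ff Dx.
  rewrite gee0_abs ?Mf.2// => lf.
  suff [j jx] : exists j, l%:E < f_ j x.
    exists j => //; exists j => //=; split => //=.
    by rewrite gee0_abs//; exact: (Mf_ _).2.
  apply: contrapT => /forallNP nf; move: lf; rewrite ltNge => /negP; apply.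
  rewrite -(cvg_lim _ cf)//; apply: lime_le; first by apply/cvg_ex; exists (f x).
  by apply: nearW => j; rewrite leNgt; apply/negP.
rewrite -(cvg_lim _ cB)//; apply: lime_le; first by apply/cvg_ex; eexists; exact: cB.
apply: nearW => j /=; apply: le_trans (BA j) _.
have := H j; move=> /le_trans/(_ cl); rewrite rearr_le//; exact: (Mf_ j).1.
Qed.

(** The distribution functions increase to the distribution function of the
    limit by continuity of the measure from below, and the rearrangements are
    their generalized inverses. *)
Lemma rearr_ae_cvg (f_ : (T -> \bar R)^nat) f :
  (forall j, Mplus D (f_ j)) -> Mplus D f ->
  {ae mu, forall x, D x -> nondecreasing_seq (f_ ^~ x) /\ f_ ^~ x @ \oo --> f x} ->
  forall t, nondecreasing_seq (fun j => rearr mu D (f_ j) t) /\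
    rearr mu D (f_ j) t @[j --> \oo] --> rearr mu D f t.
Proof.
move=> Mf_ Mf ff t.
have nd : nondecreasing_seq (fun j => rearr mu D (f_ j) t).
  move=> i j ij; apply: ae_le_rearr => //.
  by apply: filterS ff => x ff /ff[nd _]; exact: nd.
split => //; have cv := ereal_nondecreasing_cvgn nd.
set S := ereal_sup _ in cv; suff -> : rearr mu D f t = S by [].
apply/eqP; rewrite eq_le; apply/andP; split.
  apply: (@rearr_ae_cvg_le f_) => //.
    apply: (@le_trans _ _ (rearr mu D (f_ 0%N) t)); first exact: rearr_ge0.
    by apply: ereal_sup_ubound; exists 0%N.
  by move=> j; apply: ereal_sup_ubound; exists j.
apply: ge_ereal_sup => _ [j _ <-]; apply: ae_le_rearr => //.
apply: filterS ff => x ff Dx; have [nd' cf] := ff Dx.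
rewrite -(cvg_lim _ cf)// (cvg_lim _ (ereal_nondecreasing_cvgn nd'))//.
by apply: ereal_sup_ubound; exists j.
Qed.

End almost_everywhere_monotone.

(** * The inequality of Hardy and Littlewood *)

Section hardy_littlewood.
Context d (T : measurableType d) (R : realType).
Variables (mu : {measure set T -> \bar R}) (tau : T -> lline R).
Hypothesis tauP : is_gauge mu tau.
Local Notation sym := (sym mu tau).
Implicit Types (f g F : T -> \bar R).

(** The level sets of functions of the form [sym f] are sublevel sets of the
    gauge, hence nested: the smaller one is the intersection. *)
Lemma level_sym_setI f g (l l' : R) : measurable_fun setT f ->
  measurable_fun setT g -> (0 <= l)%R -> (0 <= l')%R ->
  mu ([set x | l%:E < sym f x] `&` [set x | l'%:E < sym g x]) =
  mine (dist mu setT f l) (dist mu setT g l').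
Proof.
move=> mf mg l0 l'0.
rewrite -[RHS](measure_gauge_lt tauP) ?le_min ?measure_ge0//.
by congr (mu _); apply/seteqP; split => x /=; rewrite !sym_gt// lt_min => /andP.
Qed.

Lemma integral_layer_sym (delta : R) N f g : (0 <= delta)%R ->
  measurable_fun setT f -> measurable_fun setT g ->
  \int[mu]_x (layer delta N (sym f x) * layer delta N (sym g x))%:E =
  \sum_(i < N) \sum_(j < N) (delta * delta)%:E *
    mine (dist mu setT f (i.+1%:R * delta)) (dist mu setT g (j.+1%:R * delta)).
Proof.
move=> d0 mf mg; rewrite integral_layer//; try exact: (measurable_sym tauP).
apply: eq_bigr => i _; apply: eq_bigr => j _; congr (_ * _).
by apply: level_sym_setI; rewrite ?mulr_ge0.
Qed.

Lemma dist_Mplus f l : Mplus setT f -> dist mu setT f l = mu [set x | l%:E < f x].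
Proof.
move=> [mf f0]; rewrite distE setTI; congr (mu _).
by apply/seteqP; split => x /=; rewrite gee0_abs// f0.
Qed.

(** The intersection of two level sets is at most as large as the smaller of
    the two, with equality for [sym f] and [sym g]; sum over the layers. *)
Theorem hardy_littlewood f g : Mplus setT f -> Mplus setT g ->
  \int[mu]_x (f x * g x) <= \int[mu]_x (sym f x * sym g x).
Proof.
move=> Mf Mg; have [mf f0] := Mf; have [mg g0] := Mg.
apply: integral_le_layers => // m.
apply: (@le_trans _ _
    (\int[mu]_x (layers m (sym f x) * layers m (sym g x))%:E)); last first.
  apply: ge0_le_integral => //.
  - by move=> x _; rewrite lee_fin mulr_ge0// layers_ge0.
  - by apply/measurable_EFinP/measurable_funM; apply: measurable_layers;
      exact: (measurable_sym tauP).
  - by apply: emeasurable_funM; exact: (measurable_sym tauP).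
  - move=> x _; rewrite EFinM lee_pmul ?lee_fin ?layers_ge0//;
      by apply: layers_le; exact: sym_ge0.
rewrite /layers integral_layer_sym// integral_layer//.
apply: lee_sum => i _; apply: lee_sum => j _; apply: lee_wpmul2l => //.
have mS (h : T -> \bar R) l : measurable_fun setT h ->
    measurable [set x | l < h x].
  by move=> mh; rewrite -[X in measurable X]setTI; exact: emeasurable_fun_o_infty.
rewrite le_min !dist_Mplus//; apply/andP; split; apply: le_measure;
  rewrite ?inE; try (by move=> x []);
  try (by apply: measurableI; exact: mS); exact: mS.
Qed.

End hardy_littlewood.

(** * Resonance: the converse of the Hardy-Littlewood inequality *)

Section resonance.
Context d (T : measurableType d) (R : realType).
Variables (mu : {measure set T -> \bar R}) (tau : T -> lline R).
Hypothesis tauP : is_gauge mu tau.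
Local Notation sym := (sym mu tau).
Implicit Types (f g F : T -> \bar R).

Local Notation below t := [set x | (tau x : R)%:E < t].

Lemma measurable_below (t : \bar R) : measurable (below t).
Proof. exact: (measurable_gauge_lt tauP). Qed.

Lemma measure_below (t : R) : mu (below t%:E) = (Num.max 0%R t)%:E.
Proof.
have [t0|t0] := leP 0%R t.
  by rewrite (measure_gauge_lt tauP).
rewrite (_ : [set _ | _] = set0) ?measure0//; apply/seteqP; split => // x /=.
by rewrite lte_fin => /lt_trans/(_ t0); rewrite ltNge (gauge_ge0 tauP).
Qed.

Lemma cut_lipschitz (A : set T) (s t : R) : measurable A -> mu A < +oo ->
  (`|fine (mu (A `&` below t%:E)) - fine (mu (A `&` below s%:E))| <= `|t - s|)%R.
Proof.
move=> mA Aoo; wlog st : s t / (s <= t)%R => [H|].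
  have [st|/ltW ts] := leP s t; first exact: H.
  by rewrite distrC [leRHS]distrC; exact: H.
have fA u : mu (A `&` below u%:E) \is a fin_num.
  rewrite ge0_fin_numE//; apply: le_lt_trans Aoo; apply: le_measure; rewrite ?inE//.
  by apply: measurableI => //; exact: measurable_below.
have sub : below s%:E `<=` below t%:E.
  by move=> x /= /lt_le_trans; apply; rewrite lee_fin.
have ms := measurableI _ _ mA (measurable_below s%:E).
have mt := measurableI _ _ mA (measurable_below t%:E).
have mts : measurable (below t%:E `\` below s%:E).
  by apply: measurableD; exact: measurable_below.
have H1 : mu (A `&` below s%:E) <= mu (A `&` below t%:E).
  by apply: le_measure; rewrite ?inE//; exact: setIS.
have H2 : mu (A `&` below t%:E) <=
    mu (A `&` below s%:E) + mu (below t%:E `\` below s%:E).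
  apply: le_trans (measureU2 _ ms mts); apply: le_measure; rewrite ?inE//.
    exact: measurableU.
  move=> x [Ax xt]; have [xs|xs] := pselect ((tau x : R)%:E < s%:E).
    by left.
  by right.
have H3 : mu (below t%:E `\` below s%:E) =
    (Num.max 0%R t)%:E - (Num.max 0%R s)%:E.
  rewrite measureD; [|exact: measurable_below..|]; last first.
    by rewrite [ltLHS]measure_below ltry.
  by rewrite setIidr// [X in X - _]measure_below [X in _ - X]measure_below.
rewrite !ger0_norm ?subr_ge0//; last first.
  by rewrite fine_le.
move: H2; rewrite H3 -(fineK (fA t)) -(fineK (fA s)) -EFinB -EFinD lee_fin.
move=> H2; rewrite lerBlDl (le_trans H2)// lerD2l.
have maxE (u : R) : Num.max 0%R u = (if (0 <= u)%R then u else 0%R).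
  by case: leP.
by rewrite !maxE; do ! case: ifPn => ?; lra.
Qed.

(** Sublevel sets of the gauge cut a set of finite measure into pieces of any
    prescribed measure: this is where non-atomicity enters. *)
Lemma cut_measure (A : set T) c : measurable A -> mu A < +oo ->
  0 <= c <= mu A -> exists t : \bar R, mu (A `&` below t) = c.
Proof.
move=> mA Aoo /andP[c0]; rewrite le_eqVlt => /predU1P[->|cA].
  exists +oo; congr (mu _); apply/seteqP; split => x; first by case.
  by move=> Ax; split => //=; rewrite ltry.
have fA u : mu (A `&` below u%:E) \is a fin_num.
  rewrite ge0_fin_numE//; apply: le_lt_trans Aoo; apply: le_measure; rewrite ?inE//.
  by apply: measurableI => //; exact: measurable_below.
have mAk t := measurableI _ _ mA (measurable_below t).
have cvA : (fun k : nat => mu (A `&` below k%:R%:E)) @ \oo --> mu A.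
  have -> : A = \bigcup_k (A `&` below k%:R%:E).
    apply/seteqP; split => [x Ax|x [k _ []]//].
    exists (Num.truncn (tau x : R)).+1 => //; split => //=.
    by rewrite lte_fin truncnS_gt.
  have -> : (fun k => mu ((\bigcup_k0 (A `&` below k0%:R%:E)) `&` below k%:R%:E)) =
      mu \o (fun k => A `&` below k%:R%:E).
    apply/funext => k /=; congr (mu _); apply/seteqP; split => x.
      by move=> [[j _ [Ax _]] xk].
    by move=> [Ax xk]; split => //; exists k.
  apply: nondecreasing_cvg_mu => //; first exact: bigcupT_measurable.
  move=> i j ij; apply/subsetPset => x [Ax /= xi]; split => //=.
  by apply: lt_le_trans xi _; rewrite lee_fin ler_nat.
have [k ck] : exists k : nat, c < mu (A `&` below k%:R%:E).
  apply: contrapT => /forallNP H; move: cA; rewrite ltNge => /negP; apply.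
  rewrite -(cvg_lim _ cvA)//; apply: lime_le; first by apply/cvg_ex; exists (mu A).
  by apply: nearW => k; rewrite leNgt; apply/negP.
pose U t := fine (mu (A `&` below t%:E)).
have cE : c = (fine c)%:E.
  by rewrite fineK// ge0_fin_numE// (lt_trans ck)// -ge0_fin_numE.
have U0 : U 0%R = 0%R.
  rewrite /U (_ : _ `&` _ = set0) ?measure0//; apply/seteqP; split => // x [_ /=].
  by rewrite lte_fin ltNge (gauge_ge0 tauP).
have cU : continuous U.
  move=> t; apply/cvgrPdist_le => e e0.
  apply/nbhs_ballP; exists e => //= s; rewrite /ball/= => ts.
  exact: le_trans (cut_lipschitz s t mA Aoo) (ltW ts).
have [|t _ Ut] := @IVT _ U 0%R k%:R (fine c) (ler0n _ _) (continuous_subspaceT cU).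
  rewrite U0 min_l; last by rewrite /U fine_ge0.
  rewrite fine_ge0//= le_max; apply/orP; right.
  by rewrite -lee_fin -cE fineK// ltW.
by exists t%:E; rewrite cE -Ut fineK.
Qed.

(** The level set of [g] above [v], completed by a part of the plateau of
    height [v]. These sets form a chain which contains the level sets of [g]
    and in which every measure is attained. *)
Definition upper g (v : R) (t : \bar R) : set T :=
  [set x | v%:E < g x] `|` [set x | g x = v%:E /\ (tau x : R)%:E < t].

Lemma measurable_upper g v t : measurable_fun setT g -> measurable (upper g v t).
Proof.
move=> mg; apply: measurableU.
  by rewrite -[X in measurable X]setTI; exact: emeasurable_fun_o_infty.
rewrite (_ : [set _ | _] = ([set x | g x <= v%:E] `&` [set x | v%:E <= g x])
    `&` below t).
  apply: measurableI; last exact: measurable_below.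
  rewrite -[X in measurable X]setTI setIIr; apply: measurableI.
    exact: emeasurable_fun_infty_c.
  exact: emeasurable_fun_c_infty.
apply/seteqP; split => x /= => [[-> ->]|]; first by rewrite lexx.
by move=> [[xv vx] ?]; split => //; apply/eqP; rewrite eq_le xv vx.
Qed.

Lemma upper_total g v t v' t' :
  upper g v t `<=` upper g v' t' \/ upper g v' t' `<=` upper g v t.
Proof.
have lt_upper (w w' : R) s s' : (w < w')%R -> upper g w' s' `<=` upper g w s.
  move=> ww' x [/= h|/= [gx _]]; left => /=; last by rewrite gx lte_fin.
  by rewrite (lt_trans _ h)// lte_fin.
have [vv|vv|->] := ltgtP v v'; [by right; exact: lt_upper|
  by left; exact: lt_upper|].
have [tt|tt] := leP t t'; [left|right] => x [h|/= [gx xt]]; try (by left);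
  by right; split => //; apply: lt_le_trans xt _; rewrite // ltW.
Qed.

Lemma upper_level g l : upper g l 0 = [set x | l%:E < g x].
Proof.
apply/seteqP; split => x; last by left.
by move=> [//|/= [_]]; rewrite lte_fin ltNge (gauge_ge0 tauP).
Qed.

(** The height [v] is the value of the rearrangement of [g] at [c]; the
    missing measure is taken from the plateau of height [v], by
    [cut_measure]. *)
Lemma upper_measure g (N : R) c : Mplus setT g -> (forall x, g x <= N%:E) ->
  dist mu setT g 0 < +oo -> 0 <= c <= dist mu setT g 0 ->
  exists vt, mu (upper g vt.1 vt.2) = c.
Proof.
move=> Mg gN g0 /andP[c0 cg]; have [mg gge0] := Mg.
have cE : c = (fine c)%:E by rewrite fineK// ge0_fin_numE// (le_lt_trans cg).
have mS l : measurable [set x | l < g x].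
  by rewrite -[X in measurable X]setTI; exact: emeasurable_fun_o_infty.
have distS l : dist mu setT g l = mu [set x | l%:E < g x] by exact: dist_Mplus.
have rN : rearr mu setT g (fine c) <= (Num.max 0%R N)%:E.
  rewrite rearr_le// ?le_max ?lexx// distS (_ : [set _ | _] = set0).
    by rewrite measure0 -cE.
  apply/seteqP; split => // x /=; rewrite ltNge => /negP; apply.
  by rewrite (le_trans (gN x))// lee_fin le_max lexx orbT.
pose v := fine (rearr mu setT g (fine c)).
have vE : rearr mu setT g (fine c) = v%:E.
  by rewrite fineK// ge0_fin_numE ?rearr_ge0// (le_lt_trans rN) ?ltry.
have v0 : (0 <= v)%R by rewrite fine_ge0// rearr_ge0.
have gv : mu [set x | v%:E < g x] <= c.
  by rewrite cE -distS -rearr_le// vE.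
move: v0; rewrite le_eqVlt => /predU1P[v0|v0].
  exists (0%R, 0); rewrite upper_level; apply/eqP; rewrite eq_le.
  by rewrite {1}v0 gv -distS.
pose A := [set x | g x = v%:E].
have mA : measurable A.
  rewrite (_ : A = [set x | g x <= v%:E] `&` [set x | v%:E <= g x]).
    rewrite -[X in measurable X]setTI setIIr; apply: measurableI.
      exact: emeasurable_fun_infty_c.
    exact: emeasurable_fun_c_infty.
  apply/seteqP; split => x /= => [->|]; first by rewrite lexx.
  by move=> [xv vx]; apply/eqP; rewrite eq_le xv vx.
have Aoo : mu A < +oo.
  apply: le_lt_trans g0; rewrite distS; apply: le_measure; rewrite ?inE//.
  by move=> x /= ->; rewrite lte_fin.
have gvoo : mu [set x | v%:E < g x] < +oo.
  by apply: (le_lt_trans gv); apply: (le_lt_trans cg).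
have cvA : c <= mu [set x | v%:E < g x] + mu A.
  have -> : mu [set x | v%:E < g x] + mu A = mu [set x | v%:E <= g x].
    rewrite -measureU//; last first.
      apply/seteqP; split => // x [/= + xv]; rewrite xv.
      by rewrite ltxx.
    congr (mu _); apply/seteqP; split => x /=.
      by move=> [/ltW//|->].
    by rewrite le_eqVlt => /orP[/eqP/esym gx|]; [right|left].
  pose G k := [set x | (v - v / k.+1%:R)%:E < g x].
  have -> : [set x | v%:E <= g x] = \bigcap_k G k.
    apply/seteqP; split => [x /= vg k _|x /= H].
      by apply: lt_le_trans vg; rewrite lte_fin ltrBlDr ltrDl divr_gt0.
    rewrite leNgt; apply/negP => gvx.
    have [r gr] : exists r : R, g x = r%:E.
      exists (fine (g x)); rewrite fineK// ge0_fin_numE ?gge0//.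
      by rewrite (lt_trans gvx) ?ltry.
    move: gvx; rewrite gr lte_fin => rv.
    have := H (Num.truncn (v / (v - r))) I; rewrite /G/= gr lte_fin.
    apply/negP; rewrite -leNgt lerBrDr addrC -lerBrDr.
    rewrite ler_pdivrMr// mulrC -ler_pdivrMr ?subr_gt0//.
    by rewrite ltW// truncnS_gt.
  have mG k : measurable (G k) by exact: mS.
  have cG : (mu \o G) k @[k --> \oo] --> mu (\bigcap_k G k).
    apply: nonincreasing_cvg_mu => //.
    - apply: le_lt_trans g0; rewrite distS; apply: le_measure; rewrite ?inE//.
      by move=> x; rewrite /G /mkset divr1 subrr.
    - exact: bigcapT_measurable.
    - move=> i j ij; apply/subsetPset => x /=; apply: le_lt_trans.
      rewrite lee_fin lerD2l lerN2 ler_pM2l// lef_pV2 ?posrE//.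
      by rewrite ler_nat.
  rewrite -(cvg_lim _ cG)//; apply: lime_ge; first by apply/cvg_ex; eexists; exact: cG.
  apply: nearW => k /=; rewrite cE ltW// -distS -rearr_gt//.
    by rewrite vE lte_fin ltrBlDr ltrDl divr_gt0.
  by rewrite subr_ge0 ler_pdivrMr// ler_peMr ?ler1n// ltW.
have [|t tA] := @cut_measure A (c - mu [set x | v%:E < g x]) mA Aoo.
  rewrite leeBlDl ?ge0_fin_numE// cvA andbT sube_ge0//.
  by rewrite ge0_fin_numE// gvoo.
exists (v, t); rewrite /upper/= measureU//; last 2 first.
- rewrite (_ : [set _ | _] = A `&` below t)//; apply: measurableI => //.
  exact: measurable_below.
- apply/seteqP; split => // x [/= + [xv _]]; rewrite xv.
  by rewrite ltxx.
rewrite [X in _ + X](_ : _ = c - mu [set x | v%:E < g x])//.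
transitivity (c - mu [set x | v%:E < g x] + mu [set x | v%:E < g x]).
  exact: addeC.
by apply: subeK; rewrite ge0_fin_numE.
Qed.


Lemma sum_indic_lt (N p : nat) (a : nat -> bool) :
  (forall i, (i < N)%N -> a i -> (i < p)%N) -> (\sum_(i < N) a i <= p)%N.
Proof.
move=> ap; elim: N ap => [|N IH] ap; first by rewrite big_ord0.
rewrite big_ord_recr /=; have [aN|aN] := boolP (a N); last first.
  by rewrite addn0 IH// => i iN; apply: ap; exact: ltnW.
apply: (@leq_trans N.+1); last exact: ap.
by rewrite addn1 ltnS -[leqRHS]card_ord -sum1_card leq_sum// => i _; case: (a i).
Qed.

(** The level sets of [F] are rearranged, with their measures, into the chain
    of sets [upper], which contains the level sets of [g]. Two sets of a chain
    intersect in the smaller one, which is the case of equality in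
    [hardy_littlewood]. *)
Lemma resonance_bounded F g (N : R) c : measurable_fun setT F ->
  Mplus setT g -> (forall x, g x <= N%:E) -> dist mu setT g 0 < +oo ->
  (forall k, Mplus setT k ->
    (forall l, (0 <= l)%R -> dist mu setT k l <= dist mu setT F l) ->
    \int[mu]_x (k x * g x) <= c) ->
  \int[mu]_x (sym F x * sym g x) <= c.
Proof.
move=> mF Mg gN g0 H; have [mg gge0] := Mg.
have [vt vtP] : {vt : \bar R -> R * \bar R & forall a,
    0 <= a <= dist mu setT g 0 -> mu (upper g (vt a).1 (vt a).2) = a}.
  apply: (@choice _ _ (fun a vt => 0 <= a <= dist mu setT g 0 ->
    mu (upper g vt.1 vt.2) = a)) => a.
  have [ag|ag] := pselect (0 <= a <= dist mu setT g 0); last by exists (0%R, 0).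
  by have [vt] := upper_measure Mg gN g0 ag; exists vt.
apply: integral_le_layers; try exact: (sym_Mplus tauP).
move=> p; rewrite /layers; set delta := (p.+1%:R^-1)%R; set K := (p.+1 * p.+1)%N.
have d0 : (0 < delta)%R by rewrite invr_gt0.
(* The chain only attains measures up to that of the support of [g]; outside of
   it the level sets of [F] do not contribute. *)
pose m (i : nat) : \bar R :=
  mine (dist mu setT F (i.+1%:R * delta)) (dist mu setT g 0).
have m0 i : 0 <= m i <= dist mu setT g 0.
  by rewrite /m ge_min lexx orbT andbT le_min ?measure_ge0.
pose A i := upper g (vt (m i)).1 (vt (m i)).2.
have mA i : measurable (A i) by exact: measurable_upper.
have muA i : mu (A i) = m i by exact: vtP.
have A_nested i j : (i <= j)%N -> A j `<=` A i.
  move=> ij; have mji : m j <= m i.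
    rewrite /m le_min !ge_min lexx orbT andbT; apply/orP; left.
    by apply: le_dist => //; rewrite ler_pM2r// ler_nat.
  have [E|ne] := eqVneq (m j) (m i); first by rewrite /A E.
  have [//|AiAj] := upper_total g (vt (m j)).1 (vt (m j)).2 (vt (m i)).1 (vt (m i)).2.
  have : m i <= m j by rewrite -!muA; apply: le_measure; rewrite ?inE.
  by move=> mij; case/eqP: ne; apply/eqP; rewrite eq_le mji mij.
pose k x : R := (\sum_(i < K) delta * \1_(A i) x)%R.
have k_ge0 x : (0 <= k x)%R.
  by apply: sumr_ge0 => i _; rewrite mulr_ge0// ltW.
have mk : measurable_fun setT k.
  apply: measurable_sum => i; apply: measurable_funM; first exact: measurable_cst.
  exact: measurable_indic.
have Mk : Mplus setT (EFin \o k).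
  by split=> [|x _]; [exact/measurable_EFinP|rewrite lee_fin].
apply: le_trans (H _ Mk _); last first.
  (* The [A i] are nested, so that [k x > l] forces [x] into [A q]. *)
  move=> l l0; pose q := Num.truncn (l / delta).
  have lq : (l < q.+1%:R * delta)%R by rewrite -ltr_pdivrMr// truncnS_gt.
  have ql : (q%:R * delta <= l)%R.
    by rewrite -ler_pdivlMr// truncn_le// divr_ge0// ltW.
  apply: (@le_trans _ _ (mu (A q))); last first.
    by rewrite muA /m ge_min; apply/orP; left; apply: le_dist => //; exact: ltW.
  rewrite dist_Mplus//; apply: le_measure; rewrite ?inE//.
    rewrite -[X in measurable X]setTI.
    by apply: emeasurable_fun_o_infty => //; exact: Mk.1.
  move=> x /=; rewrite lte_fin => lk; apply: contrapT => Aqx.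
  move: lk; rewrite ltNge => /negP; apply; apply: le_trans ql.
  rewrite /k -mulr_sumr mulrC ler_pM2r//.
  rewrite (eq_bigr (fun i : 'I_K => (nat_of_bool (x \in A i))%:R)%R); last first.
    by move=> i _; rewrite indicE.
  rewrite -natr_sum ler_nat; apply: (sum_indic_lt (a := fun i => x \in A i)).
  move=> i _; rewrite inE => Aix; rewrite ltnNge; apply/negP => qi.
  by apply: Aqx; exact: A_nested Aix.
apply: (@le_trans _ _ (\int[mu]_x (k x * layer delta K (g x))%:E)); last first.
  apply: ge0_le_integral => //.
  - by move=> x _; rewrite lee_fin mulr_ge0// layer_ge0// ltW.
  - apply/measurable_EFinP/measurable_funM => //.
    exact: (measurable_layers p).
  - by apply: emeasurable_funM => //; exact: Mk.1.
  - move=> x _; rewrite EFinM /= lee_wpmul2l ?lee_fin//.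
    by apply: layer_le; [exact: ltW|exact: gge0].
rewrite (integral_layer_sym tauP) ?(ltW d0)//.
pose B (j : nat) := [set x | (j.+1%:R * delta)%:E < g x].
have mB j : measurable (B j).
  by rewrite -[X in measurable X]setTI; exact: emeasurable_fun_o_infty.
have mAB i j : measurable (A i `&` B j) by exact: measurableI.
have m1 i j : measurable_fun setT
    (fun x => (delta * delta)%:E * (\1_(A i `&` B j) x)%:E : \bar R).
  apply: emeasurable_funM => //; apply/measurable_EFinP.
  exact: measurable_indic.
have ge01 i j x : 0 <= (delta * delta)%:E * (\1_(A i `&` B j) x)%:E :> \bar R.
  by rewrite mule_ge0// lee_fin ?mulr_ge0// ltW.
rewrite [leRHS](_ : _ = \int[mu]_x (\sum_(i < K) \sum_(j < K)
    (delta * delta)%:E * (\1_(A i `&` B j) x)%:E)); last first.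
  apply: eq_integral => x _; rewrite /k /layer mulr_suml -sumEFin.
  apply: eq_bigr => i _; rewrite mulr_sumr -sumEFin; apply: eq_bigr => j _.
  rewrite indicI/= mulrACA EFinM; congr (_ * _%:E).
  by rewrite !indicE /B /= mem_setE.
rewrite ge0_integral_sum//; last 2 first.
- by move=> i; apply: emeasurable_sum => j; exact: m1.
- by move=> i x _; apply: sume_ge0 => j _; exact: ge01.
apply: lee_sum => i _; rewrite ge0_integral_sum//.
apply: lee_sum => j _; rewrite ge0_integralZl_EFin ?mulr_ge0 ?(ltW d0)//; last first.
  by apply/measurable_EFinP; exact: measurable_indic.
apply: lee_wpmul2l; first by rewrite lee_fin mulr_ge0 ?(ltW d0).
rewrite integral_indic// setIT.
have gj : dist mu setT g (j.+1%:R * delta) = mu (B j) by exact: dist_Mplus.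
have gj0 : dist mu setT g (j.+1%:R * delta) <= dist mu setT g 0.
  by apply: le_dist => //; rewrite mulr_ge0// ltW.
have := upper_total g (vt (m i)).1 (vt (m i)).2 (j.+1%:R * delta)%R 0.
rewrite upper_level -/(A i) -/(B j) => -[AB|BA].
  rewrite (setIidl AB) muA /m le_min ge_min lexx/=.
  by rewrite ge_min gj0 orbT.
by rewrite (setIidr BA) -gj ge_min lexx orbT.
Qed.

(** Truncation in height and in support, both at [N], so that the truncated
    functions are bounded and live on sets of finite measure. *)
Definition truncate g (N : nat) x : \bar R :=
  mine (g x) N%:R%:E * (\1_(below N%:R%:E) x)%:E.

Lemma truncate_Mplus g N : Mplus setT g -> Mplus setT (truncate g N).
Proof.
move=> [mg gge0]; split=> [|x _]; last first.
  by apply: mule_ge0; rewrite ?lee_fin// le_min gge0//= lee_fin.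
apply: emeasurable_funM; first exact: measurable_mine.
by apply/measurable_EFinP/measurable_indic; exact: measurable_below.
Qed.

Lemma truncate_le g N x : Mplus setT g -> truncate g N x <= g x.
Proof.
move=> [_ gge0]; rewrite /truncate indicE.
case: (x \in _); rewrite ?mule1 ?mule0 ?gge0//.
by rewrite ge_min lexx.
Qed.

Lemma truncate_le_top g N x : truncate g N x <= (N%:R * \1_(below N%:R%:E) x)%:E.
Proof.
rewrite /truncate indicE; case: (x \in _); rewrite ?mule1 ?mule0 ?mulr1 ?mulr0//.
by rewrite ge_min lexx orbT.
Qed.

Lemma truncate_nondecreasing g x : Mplus setT g ->
  nondecreasing_seq (truncate g ^~ x).
Proof.
move=> [_ gge0] i j ij; rewrite /truncate; apply: lee_pmul; rewrite ?lee_fin//.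
- by rewrite le_min gge0//= lee_fin.
- rewrite le_min !ge_min lexx/=; apply/orP; right.
  by rewrite lee_fin ler_nat.
rewrite !indicE; have [xi|xi] := pselect (below i%:R%:E x).
  rewrite (mem_set xi) (mem_set (A := below j%:R%:E))//=.
  by apply: lt_le_trans xi _; rewrite lee_fin ler_nat.
by rewrite (memNset xi).
Qed.

Lemma cvg_truncate g x : Mplus setT g -> truncate g ^~ x @ \oo --> g x.
Proof.
move=> [_ gge0].
have near1 : \forall N \near \oo, truncate g N x = mine (g x) N%:R%:E.
  near=> N; rewrite /truncate indicE mem_set ?mule1//= lte_fin.
  by near: N; exact: nbhs_infty_gtr.
have := gge0 x I; case gx : (g x) near1 => [r| |//] near1 _.
  apply: cvg_near_cst; apply: filterS2 near1 (nbhs_infty_ger r) => N -> rN.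
  by rewrite min_l// lee_fin.
apply/cvgeyPge => A; apply: filterS2 near1 (nbhs_infty_ger A) => N -> AN.
by rewrite min_r ?leey// lee_fin.
Unshelve. all: by end_near. Qed.

(** The converse of [hardy_littlewood] on a non-atomic space: the right-hand
    side of that inequality is the supremum of the left-hand side over the
    functions whose level sets are no larger than those of [F]. It is deduced
    from the bounded case by monotone convergence. *)
Theorem resonance F g c : measurable_fun setT F -> Mplus setT g ->
  (forall k, Mplus setT k ->
    (forall l, (0 <= l)%R -> dist mu setT k l <= dist mu setT F l) ->
    \int[mu]_x (k x * g x) <= c) ->
  \int[mu]_x (sym F x * sym g x) <= c.
Proof.
move=> mF Mg H; have [mg gge0] := Mg.
pose g_ := truncate g.
have Mg_ N : Mplus setT (g_ N) by exact: truncate_Mplus.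
have g_nd x : nondecreasing_seq (g_ ^~ x) by exact: truncate_nondecreasing.
have g_cvg x : g_ ^~ x @ \oo --> g x by exact: cvg_truncate.
have symg_ := rearr_ae_cvg (mu := mu) measurableT Mg_ Mg
   (aeW _ (fun x _ => conj (g_nd x) (g_cvg x))).
have HN N : \int[mu]_x (sym F x * sym (g_ N) x) <= c.
  apply: (@resonance_bounded _ _ N%:R) => //.
  - move=> x; apply: le_trans (truncate_le_top g N x) _.
    by rewrite lee_fin ler_piMr// indicE; case: (x \in _).
  - rewrite dist_Mplus//; apply: (@le_lt_trans _ _ (mu (below N%:R%:E))).
      apply: le_measure; rewrite ?inE; [|exact: measurable_below|].
        rewrite -[X in measurable X]setTI.
        by apply: emeasurable_fun_o_infty => //; exact: (Mg_ N).1.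
      move=> x /= /lt_le_trans/(_ (truncate_le_top g N x)).
      rewrite lte_fin indicE; have [|_] := boolP (x \in _); first by rewrite inE.
      by rewrite mulr0 ltxx.
    by rewrite [ltLHS]measure_below ltry.
  - move=> k Mk kF; apply: le_trans (H _ Mk kF); apply: ge0_le_integral => //.
    + by move=> x _; rewrite mule_ge0//; [exact: Mk.2|exact: (Mg_ N).2].
    + by apply: emeasurable_funM; [exact: Mk.1|exact: (Mg_ N).1].
    + by apply: emeasurable_funM => //; exact: Mk.1.
    + move=> x _; apply: lee_wpmul2l; first exact: Mk.2.
      exact: truncate_le.
have -> : \int[mu]_x (sym F x * sym g x) =
    \int[mu]_x (limn (fun N => sym F x * sym (g_ N) x)).
  apply: eq_integral => x _; apply/esym/cvg_lim => //.
  have [nd cv] := symg_ (tau x); apply: ge0_cvgeMl; rewrite ?sym_ge0//.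
  move=> N; rewrite sym_ge0 !symE /=.
  rewrite -(cvg_lim _ cv)// (cvg_lim _ (ereal_nondecreasing_cvgn nd))//.
  by apply: ereal_sup_ubound; exists N.
rewrite monotone_convergence//; last 3 first.
- move=> N; apply: emeasurable_funM; exact: (measurable_sym tauP).
- by move=> N x _; rewrite mule_ge0// sym_ge0.
- move=> x _ i j ij; apply: lee_wpmul2l; first exact: sym_ge0.
  by rewrite !symE; exact: (symg_ (tau x)).1.
apply: lime_le; last by apply: nearW => N; exact: HN.
apply: ereal_nondecreasing_is_cvgn => i j ij; apply: ge0_le_integral.
- exact: measurableT.
- by move=> x _; rewrite mule_ge0// sym_ge0.
- apply: emeasurable_funM; exact: (measurable_sym tauP).
- apply: emeasurable_funM; exact: (measurable_sym tauP).
- move=> x _; apply: lee_wpmul2l; first exact: sym_ge0.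
  by rewrite !symE; exact: (symg_ (tau x)).1.
Qed.

End resonance.

(** * Associate norms *)

Section associate_norm.
Context d (T : measurableType d) (R : realType).
Variables (mu : {measure set T -> \bar R}) (tau : T -> lline R).
Hypothesis tauP : is_gauge mu tau.
Local Notation sym := (sym mu tau).
Local Notation rho' rho := (associate mu setT rho).
Implicit Types (f g F : T -> \bar R) (rho : (T -> \bar R) -> \bar R).

Lemma Mplus_indic (E : set T) : measurable E -> Mplus setT (EFin \o \1_E : T -> \bar R).
Proof.
by move=> mE; split=> [|x _]; [exact/measurable_EFinP/measurable_indic|
  rewrite lee_fin].
Qed.

Lemma MplusD f g : Mplus setT f -> Mplus setT g -> Mplus setT (fun x => f x + g x).
Proof.
move=> [mf f0] [mg g0]; split=> [|x _]; first exact: emeasurable_funD.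
by rewrite adde_ge0 ?f0 ?g0.
Qed.

Lemma MplusM f g : Mplus setT f -> Mplus setT g -> Mplus setT (fun x => f x * g x).
Proof.
move=> [mf f0] [mg g0]; split=> [|x _]; first exact: emeasurable_funM.
by rewrite mule_ge0 ?f0 ?g0.
Qed.

Lemma MplusZ (l : R) f : (0 <= l)%R -> Mplus setT f ->
  Mplus setT (fun x => l%:E * f x).
Proof.
move=> l0 [mf f0]; split=> [|x _]; first exact: measurable_funeM.
by rewrite mule_ge0 ?f0.
Qed.

Lemma le_integral_Mplus f g : Mplus setT f -> Mplus setT g ->
  (forall x, f x <= g x) -> \int[mu]_x f x <= \int[mu]_x g x.
Proof.
move=> [mf f0] [mg g0] fg; apply: ge0_le_integral; [exact: measurableT|
  exact: f0|exact: mf|exact: mg|by move=> x _; exact: fg].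
Qed.

Lemma associate_ub rho f g : Mplus setT f -> rho f <= 1 ->
  \int[mu]_x (f x * g x) <= rho' rho g.
Proof. by move=> Mf f1; apply: ereal_sup_ubound; exists f. Qed.

Section fixed_norm.
Variable rho : (T -> \bar R) -> \bar R.
Hypothesis rhoP : is_ri_norm mu setT rho.

Lemma ri_zero : rho (cst 0) = 0.
Proof.
apply/(ri_eq0 rhoP); last exact: aeW.
by split=> [|x _] //; exact: measurable_cst.
Qed.

Lemma ri_mono f g : Mplus setT f -> Mplus setT g ->
  (forall x, f x <= g x) -> rho f <= rho g.
Proof. by move=> Mf Mg fg; apply: (ri_le rhoP) => //; apply: aeW => x _. Qed.

Lemma ri_sym f : Mplus setT f -> rho (sym f) = rho f.
Proof.
move=> Mf; apply: (ri_rearr rhoP) => //; first exact: (sym_Mplus tauP).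
by move=> t _; rewrite (rearr_sym tauP)//; exact: Mf.1.
Qed.

Lemma le_sym_dist f g x : measurable_fun setT f -> measurable_fun setT g ->
  (forall l, (0 <= l)%R -> dist mu setT f l <= dist mu setT g l) ->
  sym f x <= sym g x.
Proof. by move=> mf mg fg; rewrite !symE; exact: le_rearr_dist. Qed.

(** Smaller level sets give a smaller rearrangement, and on the space itself
    the latter is represented by [sym]. *)
Lemma ri_le_dist f g : Mplus setT f -> Mplus setT g ->
  (forall l, (0 <= l)%R -> dist mu setT f l <= dist mu setT g l) ->
  rho f <= rho g.
Proof.
move=> Mf Mg fg; rewrite -ri_sym// -(ri_sym Mg).
apply: ri_mono; try exact: (sym_Mplus tauP).
by move=> x; apply: le_sym_dist => //; [exact: Mf.1|exact: Mg.1].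
Qed.

Lemma hoelder f g : Mplus setT f -> Mplus setT g -> rho f < +oo ->
  \int[mu]_x (f x * g x) <= rho f * rho' rho g.
Proof.
move=> Mf Mg foo; have f0 := ri_ge0 rhoP Mf.
have : rho f = (fine (rho f))%:E by rewrite fineK// ge0_fin_numE.
set r := fine _ => fE; have r0 : (0 <= r)%R by rewrite fine_ge0.
move: r0; rewrite le_eqVlt => /predU1P[r0|r0].
  have /(ri_eq0 rhoP Mf) fz : rho f = 0 by rewrite fE -r0.
  rewrite fE -r0 mul0e (_ : \int[mu]_x _ = 0)//.
  rewrite -[RHS](integral0 mu setT); apply: ge0_ae_eq_integral => //.
  - by have [] := MplusM Mf Mg.
  - by have [_ h] := MplusM Mf Mg.
  - by apply: filterS fz => x fz xT; rewrite /= fz// mul0e.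
have Mf' : Mplus setT (fun x => (r^-1)%:E * f x).
  by apply: MplusZ => //; rewrite invr_ge0 ltW.
have rf : rho (fun x => (r^-1)%:E * f x) <= 1.
  rewrite (ri_homo rhoP) ?invr_ge0 ?(ltW r0)// fE -EFinM mulVf ?lexx//.
    by rewrite gt_eqF.
have := associate_ub g Mf' rf; rewrite fE.
have -> : \int[mu]_x ((r^-1)%:E * f x * g x) =
    (r^-1)%:E * \int[mu]_x (f x * g x).
  under eq_integral do rewrite -muleA.
  have [? ?] := MplusM Mf Mg.
  by rewrite ge0_integralZl_EFin// invr_ge0 ltW.
by rewrite -lee_pdivlMl ?invr_gt0// invrK.
Qed.

(** Rearrangement-invariant form of the associate norm. This inequality rests
    on [hardy_littlewood], the converse [sym_le_associate] on [resonance]. *)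
Lemma associate_le_sym g c : Mplus setT g ->
  (forall f, Mplus setT f -> rho f <= 1 ->
    \int[mu]_x (sym f x * sym g x) <= c) -> rho' rho g <= c.
Proof.
move=> Mg H; apply: ge_ereal_sup => _ [f [Mf f1] <-].
by apply: le_trans (H f Mf f1); exact: (hardy_littlewood tauP).
Qed.

Lemma sym_le_associate f g : Mplus setT f -> Mplus setT g -> rho f <= 1 ->
  \int[mu]_x (sym f x * sym g x) <= rho' rho g.
Proof.
move=> Mf Mg f1; apply: (resonance tauP) => //; first exact: Mf.1.
move=> k Mk kf; apply: associate_ub => //.
by apply: le_trans f1; exact: ri_le_dist.
Qed.

Lemma associate_ge0 g : Mplus setT g -> 0 <= rho' rho g.
Proof.
move=> Mg; have M0 : Mplus setT (cst 0 : T -> \bar R).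
  by split=> [|x _] //; exact: measurable_cst.
apply: le_trans (associate_ub g M0 _); last by rewrite ri_zero.
by apply: integral_ge0 => x _; rewrite mul0e.
Qed.

Lemma measurable_integral_indic E g : measurable E ->
  \int[mu]_x ((\1_E x)%:E * g x) = \int[mu]_(x in E) g x.
Proof.
move=> mE; rewrite [RHS]integral_mkcond; apply: eq_integral => x _.
by rewrite patchE indicE; case: (x \in E); rewrite ?mul1e ?mul0e.
Qed.

Lemma associate_integral E g : measurable E -> mu E < +oo -> Mplus setT g ->
  \int[mu]_(x in E) g x <= rho (EFin \o \1_E) * rho' rho g.
Proof.
move=> mE Eoo Mg; rewrite -measurable_integral_indic//.
by apply: (hoelder (Mplus_indic mE)) => //; exact: (ri_indic rhoP).
Qed.

Lemma ae_eq0_below g : Mplus setT g ->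
  (forall N : nat, \int[mu]_(x in [set x | (tau x : R)%:E < N%:R%:E]) g x = 0) ->
  {ae mu, forall x, setT x -> g x = 0}.
Proof.
move=> [mg gge0] int0.
have H (N : nat) : {ae mu, forall x, (tau x : R)%:E < N%:R%:E -> g x = 0}.
  pose E := [set x | (tau x : R)%:E < N%:R%:E].
  have mE : measurable E by exact: (measurable_gauge_lt tauP).
  have : \int[mu]_(x in E) `|g x| = 0.
    by rewrite -[RHS](int0 N); apply: eq_integral => x _; rewrite gee0_abs// gge0.
  move/(ae_eq_integral_abs mu mE).
  by move=> /(_ (measurable_funS measurableT (@subsetT _ E) mg)).
have ALL : {ae mu, forall x (N : nat), (tau x : R)%:E < N%:R%:E -> g x = 0}.
  exact: ae_foralln.
apply: filterS ALL => x gx _; apply: (gx (Num.truncn (tau x : R)).+1).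
by rewrite lte_fin truncnS_gt.
Qed.

Lemma associate_eq0 g : Mplus setT g -> rho' rho g = 0 ->
  {ae mu, forall x, setT x -> g x = 0}.
Proof.
move=> Mg g0; apply: ae_eq0_below => // N.
pose E := [set x | (tau x : R)%:E < N%:R%:E].
have mE : measurable E by exact: (measurable_gauge_lt tauP).
have Eoo : mu E < +oo by rewrite [ltLHS](measure_gauge_lt tauP)// ltry.
have := associate_integral mE Eoo Mg; rewrite g0 mule0 => int0.
by apply/eqP; rewrite eq_le int0 integral_ge0// => x _; exact: Mg.2.
Qed.

Lemma associate_le f g : Mplus setT f -> Mplus setT g ->
  {ae mu, forall x, setT x -> f x <= g x} -> rho' rho f <= rho' rho g.
Proof.
move=> Mf Mg fg; apply: ge_ereal_sup => _ [h [Mh h1] <-].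
apply: le_trans (associate_ub g Mh h1).
have [mhf hf0] := MplusM Mh Mf; have [mhg hg0] := MplusM Mh Mg.
apply: ae_ge0_le_integral; [exact: measurableT|exact: hf0|exact: mhf|
  exact: hg0|exact: mhg|].
by apply: filterS fg => x fg xT; rewrite lee_wpmul2l ?Mh.2// fg.
Qed.

Lemma associate_homo_le g (l : R) : Mplus setT g -> (0 < l)%R ->
  rho' rho (fun x => l%:E * g x) <= l%:E * rho' rho g.
Proof.
move=> Mg l0; apply: ge_ereal_sup => _ [f [Mf f1] <-].
under eq_integral do rewrite muleCA.
have [mfg fg0] := MplusM Mf Mg.
rewrite ge0_integralZl_EFin// ?(ltW l0)//.
by apply: lee_wpmul2l; [rewrite lee_fin ltW|exact: associate_ub].
Qed.

(** A supremum of integrals inherits monotone convergence. *)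
Lemma associate_fatou (g_ : (T -> \bar R)^nat) g :
  (forall j, Mplus setT (g_ j)) -> Mplus setT g ->
  {ae mu, forall x, setT x ->
    nondecreasing_seq (g_ ^~ x) /\ g_ ^~ x @ \oo --> g x} ->
  nondecreasing_seq (rho' rho \o g_) /\ rho' rho \o g_ @ \oo --> rho' rho g.
Proof.
move=> Mg_ Mg gg.
have g_le j : {ae mu, forall x, setT x -> g_ j x <= g x}.
  apply: filterS gg => x gg Dx; have [nd' cf] := gg Dx.
  rewrite -(cvg_lim _ cf)// (cvg_lim _ (ereal_nondecreasing_cvgn nd'))//.
  by apply: ereal_sup_ubound; exists j.
have nd : nondecreasing_seq (rho' rho \o g_).
  move=> i j ij; apply: associate_le => //.
  by apply: filterS gg => x /[apply] -[+ _]; apply.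
split=> //; have := ereal_nondecreasing_cvgn nd.
set S := ereal_sup _; suff -> : rho' rho g = S by [].
apply/eqP; rewrite eq_le; apply/andP; split; last first.
  by apply: ge_ereal_sup => _ [j _ <-]; exact: associate_le.
apply: ge_ereal_sup => _ [f [Mf f1] <-].
have [mfg fg0] := MplusM Mf Mg.
have mfg_ j : measurable_fun setT (fun x => f x * g_ j x).
  by have [] := MplusM Mf (Mg_ j).
have fg_0 j x : 0 <= f x * g_ j x by have [_] := MplusM Mf (Mg_ j); apply.
have mlim : measurable_fun setT (fun x => limn_einf (fun j => f x * g_ j x)).
  apply: measurableT_comp; first exact: oppe_measurable.
  apply: measurable_fun_limn_esup => j.
  by apply: measurableT_comp; [exact: oppe_measurable|exact: mfg_].
apply: (@le_trans _ _ (\int[mu]_x limn_einf (fun j => f x * g_ j x))).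
  apply: ae_ge0_le_integral; [exact: measurableT|exact: fg0|exact: mfg| |
    exact: mlim|].
    move=> x _; rewrite limn_einf_lim; apply: lime_ge; first exact: is_cvg_einfs.
    by apply: nearW => k; apply: le_ereal_inf_tmp => _ [j _ <-].
  have ALL : {ae mu, forall x j, g_ j x <= g x}.
    by apply: ae_foralln => j; apply: filterS (g_le j) => x; apply.
  apply: filterS2 ALL gg => x gx /[apply] -[_ cg].
  have : f x * g_ j x @[j --> \oo] --> f x * g x.
    apply: ge0_cvgeMl => //; first exact: Mf.2.
    by move=> k; rewrite gx (Mg_ k).2.
  by move=> /cvg_limn_einf_sup[-> _].
apply: le_trans (fatou mu measurableT mfg_ _) _; first by move=> j x _.
apply: limn_einf_le => j; apply: le_trans (associate_ub (g_ j) Mf f1) _.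
by apply: ereal_sup_ubound; exists j.
Qed.

(** Invariance under rearrangements follows from [associate_le_sym] and
    [sym_le_associate], which describe the associate norm in terms of [sym].
    Duality exchanges the roles of [ri_indic] and [ri_integral]. *)
Lemma associate_is_ri_norm : is_ri_norm mu setT (rho' rho).
Proof.
split.
- exact: associate_ge0.
- move=> g Mg; split; first exact: associate_eq0.
  move=> g0; apply/eqP; rewrite eq_le associate_ge0// andbT.
  apply: ge_ereal_sup => _ [f [Mf f1] <-].
  have [mfg fg0] := MplusM Mf Mg.
  rewrite (_ : \int[mu]_(x in setT) _ = 0)// -[RHS](integral0 mu setT).
  apply: ge0_ae_eq_integral => //.
  by apply: filterS g0 => x g0 xT; rewrite /= g0// mule0.
- move=> g l Mg; rewrite le_eqVlt => /predU1P[<-|l0].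
    rewrite mul0e (_ : (fun _ => _) = cst 0); last first.
      by apply/funext => x; rewrite mul0e.
    apply/eqP; rewrite eq_le associate_ge0// andbT; apply: ge_ereal_sup => _ [f _ <-].
    by under eq_integral do rewrite mule0; rewrite integral0.
  apply/eqP; rewrite eq_le associate_homo_le//=.
  have Mlg := MplusZ (ltW l0) Mg.
  have li0 : (0 < l^-1)%R by rewrite invr_gt0.
  have := associate_homo_le Mlg li0.
  rewrite (_ : (fun x => _ * (_ * _)) = g); last first.
    by apply/funext => x; rewrite muleA -EFinM mulVf ?gt_eqF// mul1e.
  by rewrite lee_pdivlMl.
- move=> f g Mf Mg; apply: ge_ereal_sup => _ [h [Mh h1] <-].
  have [mhf hf0] := MplusM Mh Mf; have [mhg hg0] := MplusM Mh Mg.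
  rewrite (eq_integral (fun x => h x * f x + h x * g x)); last first.
    by move=> x _; rewrite ge0_muleDr ?Mf.2 ?Mg.2.
  by rewrite ge0_integralD//; apply: leeD; exact: associate_ub.
- exact: associate_le.
- exact: associate_fatou.
- move=> E mE _ Eoo; have [C C0 HC] := ri_integral rhoP mE (@subsetT _ E) Eoo.
  apply: (@le_lt_trans _ _ C%:E); last exact: ltry.
  apply: ge_ereal_sup => _ [f [Mf f1] <-].
  under eq_integral do rewrite muleC.
  rewrite measurable_integral_indic//; apply: le_trans (HC f Mf) _.
  by rewrite -[leRHS]mule1; apply: lee_wpmul2l => //; rewrite lee_fin ltW.
- move=> E mE _ Eoo.
  have rE := ri_indic rhoP mE (@subsetT _ E) Eoo.
  have rE0 := ri_ge0 rhoP (Mplus_indic mE).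
  exists (fine (rho (EFin \o \1_E)) + 1)%R.
    by rewrite ltr_wpDl// fine_ge0.
  move=> g Mg; apply: le_trans (associate_integral mE Eoo Mg) _.
  apply: lee_wpmul2r; first exact: associate_ge0.
  by rewrite EFinD fineK ?leeDl// ge0_fin_numE.
- move=> f g Mf Mg fg.
  have [mf _] := Mf; have [mg _] := Mg.
  have E x : sym f x = sym g x.
    have D := eq_dist_rearr measurableT measurableT mf mg fg.
    by rewrite !symE; exact: eq_rearr_dist.
  apply/eqP; rewrite eq_le; apply/andP; split; apply: associate_le_sym => // h Mh h1.
    by under eq_integral do rewrite E; exact: sym_le_associate.
  by under eq_integral do rewrite -E; exact: sym_le_associate.
Qed.

End fixed_norm.
End associate_norm.

(** * Norms on the half line *)

Section representation.
Context d (T : measurableType d) (R : realType).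
Variables (mu : {measure set T -> \bar R}) (tau : T -> lline R).
Hypothesis tauP : is_gauge mu tau.
Local Notation lam := (@completed_lebesgue_measure R).
Local Notation half := (half_line R).
Local Notation sym := (sym mu tau).
Local Notation pull := (pull tau).
Variable rho : (T -> \bar R) -> \bar R.
Hypothesis rhoP : is_ri_norm mu setT rho.
Implicit Types (f g : T -> \bar R) (h : lline R -> \bar R).

Let mhalf := @measurable_half_line R.

(** Null sets of the half line pull back to null sets of the space. *)
Lemma ae_pull (P : lline R -> Prop) : {ae lam, forall t, half t -> P t} ->
  {ae mu, forall x, (0 < (tau x : R))%R -> P (tau x)}.
Proof.
move=> [N [mN N0 NP]].
have mNh : measurable (N `&` half) by exact: measurableI.
exists (tau @^-1` (N `&` half)); split.
- by rewrite -[X in measurable X]setTI; exact: (gauge_measurable tauP).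
- rewrite (gauge_measure tauP)//; apply/eqP; rewrite eq_le measure_ge0 andbT -N0.
  by apply: le_measure; rewrite ?inE// => x [].
- move=> x /= /not_implyP[x0 nP]; split; last by rewrite half_lineE.
  by apply: NP => /=; rewrite half_lineE => /(_ x0).
Qed.

Lemma pull_map2 (op : \bar R -> \bar R -> \bar R) h h' : op 0 0 = 0 ->
  pull (fun t => op (h t) (h' t)) = (fun x => op (pull h x) (pull h' x)).
Proof.
move=> op0; apply/funext => x; have := gauge_ge0 tauP x.
rewrite le_eqVlt => /predU1P[x0|x0]; first by rewrite !pull0.
by rewrite !pullE.
Qed.

Lemma ae_pull_rearr_sym f :
  {ae mu, forall x, setT x -> pull (rearr mu setT f) x = sym f x}.
Proof.
exists (tau @^-1` [set 0%R]); split.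
- rewrite -[X in measurable X]setTI; apply: (gauge_measurable tauP) => //.
  by apply: measurable_lline_borel; exact: measurable_set1.
- exact: gauge_null tauP.
- move=> x /= /not_implyP[_ ne]; have := gauge_ge0 tauP x.
  rewrite le_eqVlt => /predU1P[//|x0].
  by case: ne; exact: sym_pull_rearr.
Qed.

Lemma pull_rearr_sym f : measurable_fun setT f ->
  rho (pull (rearr mu setT f)) = rho (sym f).
Proof.
move=> mf; have Mp := pull_Mplus tauP (rearr_Mplus mu f).
have Ms := sym_Mplus tauP f; have E := ae_pull_rearr_sym f.
by apply/eqP; rewrite eq_le; apply/andP; split; apply: (ri_le rhoP) => //;
  apply: filterS E => x /[apply] ->.
Qed.

Lemma integral_pull_setI (E : set (lline R)) h : measurable E -> E `<=` half ->
  Mplus half h -> \int[lam]_(t in E) h t = \int[mu]_(x in tau @^-1` E) pull h x.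
Proof.
move=> mE Eh [mh h0].
have -> : \int[lam]_(t in E) h t = \int[lam]_(t in half) (h \_ E) t.
  by rewrite -integral_mkcondr (setIidr Eh).
rewrite -(integral_pull tauP); last first.
  split; last by move=> t tt; rewrite patchE; case: ifP => // _; exact: h0.
  apply/(measurable_restrict _ mE mhalf).
  by rewrite (setIidr Eh); exact: measurable_funS mh.
rewrite [RHS]integral_mkcond; apply: eq_integral => x _.
rewrite [RHS]patchE; have [xE|xE] := pselect (E (tau x)).
  rewrite (mem_set (A := tau @^-1` E))//.
  have x0 : (0 < (tau x : R))%R by rewrite -half_lineE; exact: Eh.
  by rewrite !pullE// patchE mem_set.
rewrite (memNset (A := tau @^-1` E))//; have := gauge_ge0 tauP x.
rewrite le_eqVlt => /predU1P[x0|x0]; first by rewrite pull0.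
by rewrite pullE// patchE memNset.
Qed.

(** Every r.i. norm is transplanted to the half line along the gauge: the
    axioms are inherited because [pull] preserves the pointwise structure,
    integrals and rearrangements. *)
Lemma representation_is_ri_norm : is_ri_norm lam half (rho \o pull).
Proof.
have Mp h : Mplus half h -> Mplus setT (pull h) by exact: (pull_Mplus tauP).
split => /=.
- by move=> h /Mp; exact: ri_ge0 rhoP _.
- move=> h Mh; rewrite (ri_eq0 rhoP (Mp _ Mh)); split => h0.
    have mZ : measurable (half `&` [set t | 0 < `|h t|]).
      exact: (measurable_level mhalf _ Mh.1).
    exists (half `&` [set t | 0 < `|h t|]); split => //.
      rewrite -(gauge_measure tauP)//.
      apply/eqP; rewrite eq_le measure_ge0 andbT -[leRHS](@measure0 _ _ _ mu).
      apply: ae_le_measure => //.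
        by rewrite -[X in measurable X]setTI; exact: (gauge_measurable tauP).
      apply: filterS h0 => x /(_ I) hx [x0 /=]; rewrite half_lineE in x0.
      by move: hx; rewrite pullE// => ->; rewrite abse0 ltxx.
    move=> t /= /not_implyP[tt ht]; split => //=.
    by rewrite lt_neqAle abse_ge0 andbT eq_sym abse_eq0; apply/eqP.
  apply: filterS (ae_pull h0) => x hx _; have := gauge_ge0 tauP x.
  by rewrite le_eqVlt => /predU1P[x0|x0]; [rewrite pull0|rewrite pullE// hx].
- move=> h l Mh l0; rewrite -(ri_homo rhoP)//; last exact: Mp.
  congr rho; exact: (pull_map2 (op := fun _ b => l%:E * b) h h (mule0 _)).
- move=> h h' Mh Mh'; rewrite (pull_map2 h h' (adde0 0)).
  by apply: (ri_triangle rhoP); exact: Mp.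
- move=> h h' Mh Mh' hh'; apply: (ri_le rhoP); [exact: Mp|exact: Mp|].
  apply: filterS (ae_pull hh') => x hx _; have := gauge_ge0 tauP x.
  by rewrite le_eqVlt => /predU1P[x0|x0]; [rewrite !pull0|rewrite !pullE// hx].
- move=> h_ h Mh_ Mh hh.
  have := @ri_fatou _ _ _ _ _ _ rhoP (fun j => pull (h_ j)) (pull h)
    (fun j => Mp _ (Mh_ j)) (Mp _ Mh); apply.
  apply: filterS (ae_pull hh) => x hx _; have := gauge_ge0 tauP x.
  rewrite le_eqVlt => /predU1P[x0|x0].
    have -> : (fun j => pull (h_ j) x) = cst 0.
      by apply/funext => j; rewrite pull0.
    by rewrite pull0//; split => //; exact: cvg_cst.
  have -> : (fun j => pull (h_ j) x) = h_ ^~ (tau x).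
    by apply/funext => j; rewrite pullE.
  by rewrite pullE//; exact: hx.
- move=> E mE Eh Eoo.
  have -> : pull (EFin \o \1_E) = EFin \o \1_(tau @^-1` E).
    apply/funext => x; have := gauge_ge0 tauP x.
    rewrite le_eqVlt => /predU1P[x0|x0].
      rewrite pull0//= indicE memNset//= => /Eh; rewrite half_lineE -x0.
      by rewrite ltxx.
    by rewrite pullE//= !indicE mem_setE.
  apply: (ri_indic rhoP) => //; last by rewrite (gauge_measure tauP).
  by rewrite -[X in measurable X]setTI; exact: (gauge_measurable tauP).
- move=> E mE Eh Eoo.
  have mE' : measurable (tau @^-1` E).
    by rewrite -[X in measurable X]setTI; exact: (gauge_measurable tauP).
  have [|C C0 HC] := ri_integral rhoP mE' (@subsetT _ _).
    by rewrite (gauge_measure tauP).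
  by exists C => // h Mh; rewrite integral_pull_setI//; apply: HC; exact: Mp.
- move=> h h' Mh Mh' hh'; apply: (ri_rearr rhoP); [exact: Mp|exact: Mp|].
  by move=> t t0; rewrite !(rearr_pull tauP) ?hh'//; [exact: Mh'.1|exact: Mh.1].
Qed.

Lemma representation_rearr f : measurable_fun setT f ->
  space_norm rho f = space_norm (rho \o pull) (rearr mu setT f).
Proof.
move=> mf; rewrite /space_norm /=.
have mf' : measurable_fun setT (fun x => `|f x|) by exact: measurableT_comp.
have -> : (fun t => `|rearr mu setT f t|) = rearr mu setT (fun x => `|f x|).
  apply/funext => t; rewrite gee0_abs ?rearr_ge0//.
  apply: eq_rearr_dist => // l l0; rewrite !distE; congr (mu _).
  by apply/seteqP; split => x [_ /=]; rewrite abse_id; split.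
by rewrite pull_rearr_sym// (ri_sym tauP rhoP).
Qed.

(** Every [h] on the half line is equimeasurable with the rearrangement of
    the function [pull h] on the space, so that the representation identity
    fixes the value at [h]. *)
Lemma representation_unique r : is_ri_norm lam half r ->
  (forall f, measurable_fun setT f ->
    space_norm rho f = space_norm r (rearr mu setT f)) ->
  forall h, Mplus half h -> r h = rho (pull h).
Proof.
move=> rP rE h Mh; have Mp := pull_Mplus tauP Mh; have [mp p0] := Mp.
have := rE _ mp; rewrite /space_norm.
have -> : (fun x => `|pull h x|) = pull h.
  by apply/funext => x; rewrite gee0_abs// p0.
have -> : (fun t => `|rearr mu setT (pull h) t|) = rearr mu setT (pull h).
  by apply/funext => t; rewrite gee0_abs// rearr_ge0.
move=> ->; apply: (ri_rearr rP) => //; first exact: rearr_Mplus.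
move=> t t0.
rewrite -(rearr_pull tauP _ Mh.1).
have <- := rearr_pull tauP (h := rearr mu setT (pull h)) t
  (rearr_Mplus mu (pull h)).1.
rewrite -[LHS](rearr_sym tauP)//.
have Mpr := pull_Mplus tauP (rearr_Mplus mu (pull h)).
have Ms := sym_Mplus tauP (pull h); have E := ae_pull_rearr_sym (pull h).
by apply/eqP; rewrite eq_le; apply/andP; split; apply: ae_le_rearr => //;
  apply: filterS E => x /[apply] ->.
Qed.

End representation.

(** * Bounded functions supported in a set of finite measure *)

Section bounded_functions.
Context d (T : measurableType d) (R : realType).
Variables (mu : {measure set T -> \bar R}) (B : set T).
Hypotheses (mB : measurable B) (Boo : mu B < +oo).
Implicit Types (u v : T -> R).

Definition bounded_on u := measurable_fun setT u /\
  exists M : R, forall x, (`|u x| <= M * \1_B x)%R.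

Local Notation "\I u" := (\int[mu]_x u x)%R (at level 10, u at level 9).

Lemma bounded_on_integrable u : bounded_on u -> mu.-integrable setT (EFin \o u).
Proof.
move=> [mu_ [M uM]]; apply/integrableP; split; first exact/measurable_EFinP.
apply: (@le_lt_trans _ _ (\int[mu]_x (`|M| * \1_B x)%:E)).
  apply: ge0_le_integral => //.
  - by apply: measurableT_comp => //; exact/measurable_EFinP.
  - by apply/measurable_EFinP/measurable_funM.
  - by move=> x _ /=; rewrite lee_fin (le_trans (uM x))// ler_wpM2r// ler_norm.
under eq_integral do rewrite EFinM.
rewrite ge0_integralZl_EFin//; last exact/measurable_EFinP.
by rewrite integral_indic// setIT lte_mul_pinfty// lee_fin.
Qed.

Lemma bounded_onL a b u v : bounded_on u -> bounded_on v ->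
  bounded_on (fun x => a * u x + b * v x)%R.
Proof.
move=> [mu_ [M uM]] [mv [N vN]]; split.
  by apply: measurable_funD; apply: measurable_funM.
exists (`|a| * M + `|b| * N)%R => x; rewrite (le_trans (ler_normD _ _))//.
by rewrite mulrDl !normrM -!mulrA lerD// ler_wpM2l.
Qed.

Lemma bounded_onM u v : bounded_on u -> bounded_on v ->
  bounded_on (fun x => u x * v x)%R.
Proof.
move=> [mu_ [M uM]] [mv [N vN]]; split; first exact: measurable_funM.
exists (M * N)%R => x; rewrite normrM (le_trans (ler_pM _ _ (uM x) (vN x)))//.
by rewrite mulrACA indicE; case: (x \in B); rewrite ?mulr1 ?mulr0.
Qed.

Lemma bounded_on_abs u : bounded_on u -> bounded_on (fun x => `|u x|)%R.
Proof.
move=> [mu_ [M uM]]; split; first exact: measurableT_comp.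
by exists M => x; rewrite normr_id.
Qed.

Lemma bounded_on_indic : bounded_on (\1_B : T -> R).
Proof.
split; first exact: measurable_indic.
by exists 1%R => x; rewrite mul1r ger0_norm.
Qed.

Lemma bounded_on_le u v : measurable_fun setT u -> bounded_on v ->
  (forall x, 0 <= u x <= v x)%R -> bounded_on u.
Proof.
move=> mu_ [mv [M vM]] uv; split => //; exists M => x.
apply: le_trans (vM x); have /andP[u0 uvx] := uv x.
by rewrite !ger0_norm// (le_trans u0).
Qed.

Lemma Rintegral_lin a b u v : bounded_on u -> bounded_on v ->
  \I (fun x => a * u x + b * v x)%R = (a * \I u + b * \I v)%R.
Proof.
move=> bu bv; have b0 w c : bounded_on w -> bounded_on (fun x => c * w x)%R.
  move=> bw; have := bounded_onL c 0 bw bw.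
  by under eq_fun do rewrite mul0r addr0.
rewrite RintegralD//; try (by apply: bounded_on_integrable; exact: b0).
by rewrite !RintegralZl//; exact: bounded_on_integrable.
Qed.

Lemma le_Rintegral_bounded u v : bounded_on u -> bounded_on v ->
  (forall x, (u x <= v x)%R) -> (\I u <= \I v)%R.
Proof.
by move=> bu bv uv; apply: le_Rintegral => //; exact: bounded_on_integrable.
Qed.

Lemma integral_bounded u : bounded_on u -> \int[mu]_x (u x)%:E = (\I u)%:E.
Proof.
by move=> bu; rewrite fineK//; exact: (integrable_fin_num _ (bounded_on_integrable bu)).
Qed.

End bounded_functions.

Notation "\I_[ mu ] u" := (\int[mu]_x u x)%R (at level 10, u at level 9, mu at level 9).

(** * The theorem of Lorentz and Luxemburg *)

Section projection.
Context d (T : measurableType d) (R : realType).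
Variables (mu : {measure set T -> \bar R}) (tau : T -> lline R).
Hypothesis tauP : is_gauge mu tau.
Variable rho : (T -> \bar R) -> \bar R.
Hypothesis rhoP : is_ri_norm mu setT rho.
Variables (B : set T) (N : R) (f : T -> R).
Hypotheses (mB : measurable B) (Boo : mu B < +oo).
Hypotheses (mf : measurable_fun setT f) (f_ge0 : forall x, (0 <= f x)%R).
Hypothesis f_le : forall x, (f x <= N * \1_B x)%R.
Implicit Types (g h : T -> R).

Local Notation bdd := (bounded_on B).
Local Notation "\I u" := (\I_[mu] u) (at level 10, u at level 9).

(** The competitors of the projection: restricting them to functions
    below [f] loses nothing, since taking the minimum with [f] decreases both
    the norm and the distance to [f]. *)
Definition minorant g := [/\ measurable_fun setT g,
  forall x, (0 <= g x <= f x)%R & rho (EFin \o g) <= 1].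

Lemma bounded_f : bdd f.
Proof. by split => //; exists N => x; rewrite ger0_norm. Qed.

Lemma minorant_bounded g : minorant g -> bdd g.
Proof. by move=> [mg gf _]; apply: bounded_on_le bounded_f gf. Qed.

Definition distance g : R := \I (fun x => (f x - g x) * (f x - g x))%R.

Lemma bounded_onB g h : bdd g -> bdd h -> bdd (fun x => g x - h x)%R.
Proof.
move=> bg bh; have := bounded_onL 1 (-1) bg bh.
by under eq_fun do rewrite mul1r mulN1r.
Qed.

Lemma bounded_distance g : bdd g -> bdd (fun x => (f x - g x) * (f x - g x))%R.
Proof. by move=> bg; apply: bounded_onM; apply: bounded_onB => //; exact: bounded_f. Qed.

Lemma distance_ge0 g : (0 <= distance g)%R.
Proof. by apply: Rintegral_ge0 => x _; rewrite -expr2 sqr_ge0. Qed.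

Lemma Mplus_real g : measurable_fun setT g -> (forall x, 0 <= g x)%R ->
  Mplus setT (EFin \o g).
Proof. by move=> mg g0; split=> [|x _]; [exact/measurable_EFinP|rewrite lee_fin]. Qed.

Lemma ri_convex g h (t : R) : (0 <= t <= 1)%R ->
  measurable_fun setT g -> (forall x, 0 <= g x)%R -> rho (EFin \o g) <= 1 ->
  measurable_fun setT h -> (forall x, 0 <= h x)%R -> rho (EFin \o h) <= 1 ->
  rho (EFin \o (fun x => (1 - t) * g x + t * h x)%R) <= 1.
Proof.
move=> /andP[t0 t1] mg g0 g1 mh h0 h1.
have Mg := Mplus_real mg g0; have Mh := Mplus_real mh h0.
have t1' : (0 <= 1 - t)%R by rewrite subr_ge0.
have -> : EFin \o (fun x => (1 - t) * g x + t * h x)%R =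
    (fun x => (1 - t)%:E * (EFin \o g) x + t%:E * (EFin \o h) x).
  by apply/funext.
apply: le_trans (ri_triangle rhoP (MplusZ t1' Mg) (MplusZ t0 Mh)) _.
rewrite !(ri_homo rhoP)//.
have -> : 1%E = (1 - t)%:E * 1 + t%:E * 1 :> \bar R.
  by rewrite !mule1 -EFinD subrK.
by apply: leeD; apply: lee_wpmul2l; rewrite ?lee_fin.
Qed.

Lemma minorant0 : minorant (cst 0%R).
Proof.
split => [|x|]; first exact: measurable_cst.
  by rewrite lexx f_ge0.
by rewrite (_ : EFin \o _ = cst 0)// (ri_zero rhoP).
Qed.

Let D := [set distance g | g in minorant].
Let delta := inf D.

Let D_lb : has_lbound D.
Proof. by exists 0%R => _ [g _ <-]; exact: distance_ge0. Qed.

Let delta_le g : minorant g -> (delta <= distance g)%R.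
Proof. by move=> mg; apply: ge_inf => //; exists g. Qed.

Let s (k : nat) : R := ((2 ^ k)%:R^-1)%R.

Let s_gt0 k : (0 < s k)%R.
Proof. by rewrite invr_gt0 ltr0n expn_gt0. Qed.

Lemma minimizing_sequence : {g_ : nat -> T -> R & forall k,
  minorant (g_ k) /\ (distance (g_ k) <= delta + s k ^+ 2)%R}.
Proof.
apply: (@choice _ _ (fun k g =>
  minorant g /\ (distance g <= delta + s k ^+ 2)%R)) => k.
have hD : has_inf D.
  by split => //; exists (distance (cst 0%R)), (cst 0%R) => //; exact: minorant0.
have [_ [g mg <-] gd] := inf_adherent (exprn_gt0 2 (s_gt0 k)) hD.
by exists g; split => //; exact: ltW.
Qed.

(** The midpoint of two minorants is a minorant, so that the parallelogram
    identity forces nearly optimal minorants to be close to each other. *)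
Lemma parallelogram g h e : minorant g -> minorant h ->
  (distance g <= delta + e)%R -> (distance h <= delta + e)%R ->
  (\I (fun x => (g x - h x) * (g x - h x)) <= 4 * e)%R.
Proof.
move=> Mg Mh ge he; have bg := minorant_bounded Mg; have bh := minorant_bounded Mh.
have Mm : minorant (fun x => (1 - 2^-1) * g x + 2^-1 * h x)%R.
  have [mg gf g1] := Mg; have [mh hf h1] := Mh; split.
  - by apply: measurable_funD; apply: measurable_funM.
  - by move=> x; have := gf x; have := hf x; lra.
  - apply: ri_convex => //; first lra.
      by move=> x; have /andP[] := gf x.
    by move=> x; have /andP[] := hf x.
have := delta_le Mm; rewrite /distance.
have bm := minorant_bounded Mm.
have E : (\I (fun x => (g x - h x) * (g x - h x)) =
    2 * distance g + 2 * distance h - 4 *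
    \I (fun x => (f x - ((1 - 2^-1) * g x + 2^-1 * h x)) *
              (f x - ((1 - 2^-1) * g x + 2^-1 * h x))))%R.
  have b1 := bounded_distance bg; have b2 := bounded_distance bh.
  have b3 := bounded_distance bm.
  have := Rintegral_lin mB Boo 1 (-4) (bounded_onL 2 2 b1 b2) b3.
  rewrite (Rintegral_lin mB Boo 2 2 b1 b2) mul1r mulNr => <-.
  by apply: eq_Rintegral => x _; field.
rewrite E; move: ge he; lra.
Qed.

(** The inequality between arithmetic and geometric means; it replaces the
    Cauchy-Schwarz inequality in passing from squares to absolute values. *)
Lemma abs_le_square (u c : R) : (0 < c)%R -> (`|u| <= 2^-1 * c + (2^-1 / c) * (u * u))%R.
Proof.
move=> c0; have : (0 <= (`|u| - c) ^+ 2 / c)%R by rewrite divr_ge0 ?sqr_ge0// ltW.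
have -> : ((`|u| - c) ^+ 2 / c = u * u / c - 2 * `|u| + c)%R.
  have -> : (u * u = `|u| * `|u|)%R by rewrite -normrM ger0_norm// -expr2 sqr_ge0.
  by field; rewrite gt_eqF.
have -> : (2^-1 / c * (u * u) = 2^-1 * (u * u / c))%R by field; rewrite gt_eqF.
lra.
Qed.


Let s_nonincr k : (s k.+1 <= s k)%R.
Proof. by rewrite lef_pV2 ?posrE ?ltr0n ?expn_gt0// ler_nat leq_exp2l. Qed.

Let gap : R := (2^-1 * fine (mu B) + 2)%R.

Let gap_ge0 : (0 <= gap)%R.
Proof. by rewrite addr_ge0// mulr_ge0// fine_ge0. Qed.

Lemma consecutive_minorants (g_ : nat -> T -> R) k :
  (forall k, minorant (g_ k) /\ (distance (g_ k) <= delta + s k ^+ 2)%R) ->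
  (\I (fun x => `|g_ k x - g_ k.+1 x|) <= gap * s k)%R.
Proof.
move=> gP; have [M1 d1] := gP k; have [M2 d2] := gP k.+1.
have b1 := minorant_bounded M1; have b2 := minorant_bounded M2.
have bB := @bounded_on_indic _ _ R _ mB.
have bu := bounded_onB b1 b2; have buu := bounded_onM bu bu.
have H : (\I (fun x => (g_ k x - g_ k.+1 x) * (g_ k x - g_ k.+1 x)) <= 4 * s k ^+ 2)%R.
  apply: parallelogram => //; apply: le_trans d2 _.
  by rewrite lerD2l; apply: lerXn2r; rewrite ?nnegrE ?(ltW (s_gt0 _)).
apply: (@le_trans _ _ (\I (fun x => (2^-1 * s k) * \1_B x + (2^-1 / s k) *
    ((g_ k x - g_ k.+1 x) * (g_ k x - g_ k.+1 x)))%R)).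
  apply: (le_Rintegral_bounded mB Boo); first exact: bounded_on_abs.
    exact: bounded_onL.
  move=> x; have [xB|xB] := pselect (B x).
    by rewrite indicE mem_set// mulr1; exact: abs_le_square.
  have z g : minorant g -> g x = 0%R.
    move=> [_ /(_ x)/andP[g0 gf] _]; apply/eqP; rewrite eq_le g0 andbT.
    by rewrite (le_trans gf)// (le_trans (f_le x))// indicE memNset// mulr0.
  by rewrite indicE memNset// (z _ M1) (z _ M2) !subr0 normr0 !mulr0 addr0.
rewrite (Rintegral_lin mB Boo _ _ bB buu).
have -> : (\I (\1_B))%R = fine (mu B).
  by rewrite /Rintegral integral_indic// setIT.
apply: (@le_trans _ _ (2^-1 * s k * fine (mu B) + 2^-1 / s k * (4 * s k ^+ 2))%R).
  by rewrite lerD2l ler_wpM2l// mulr_ge0// invr_ge0 ltW.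
rewrite le_eqVlt; apply/orP; left; apply/eqP; rewrite /gap.
by field; rewrite gt_eqF.
Qed.

(** A sequence that minimizes the distance at a geometric rate has summable
    consecutive L1 distances. Its pointwise lower limit [G] is a minorant by
    the Fatou property of the norm, and it is close to the tails of the
    sequence. *)
Lemma minimizer_exists : exists2 g, minorant g & (distance g <= delta)%R.
Proof.
have [g_ gP] := minimizing_sequence.
pose u x j : \bar R := (g_ j x)%:E.
have u_ge0 x j : 0 <= u x j by have [[_ /(_ x)/andP[? _] _] _] := gP j; rewrite lee_fin.
have u_le x j : u x j <= (f x)%:E.
  by have [[_ /(_ x)/andP[_ ?] _] _] := gP j; rewrite lee_fin.
pose H k x := einfs (u x) k; pose Ginf x := limn_einf (u x).
have H_ge0 k x : 0 <= H k x by apply: le_ereal_inf_tmp => _ [j _ <-].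
have H_le k x : H k x <= u x k by apply: ereal_inf_lbound; exists k => /=.
have cvH x : H ^~ x @ \oo --> Ginf x by rewrite /Ginf limn_einf_lim; exact: is_cvg_einfs.
have ndH x : nondecreasing_seq (H ^~ x) by exact: nondecreasing_einfs.
have H_Ginf k x : H k x <= Ginf x.
  rewrite -(cvg_lim _ (cvH x))// (cvg_lim _ (ereal_nondecreasing_cvgn (ndH x)))//.
  by apply: ereal_sup_ubound; exists k.
have Ginf_le x : Ginf x <= (f x)%:E by apply: limn_einf_le => j; exact: u_le.
have mu_ j : measurable_fun setT (u ^~ j).
  by have [[? _ _] _] := gP j; exact/measurable_EFinP.
have mH k : measurable_fun setT (H k) by exact: measurable_fun_einfs.
have mG : measurable_fun setT Ginf.
  apply: measurableT_comp; first exact: oppe_measurable.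
  apply: measurable_fun_limn_esup => j.
  by apply: measurableT_comp; [exact: oppe_measurable|exact: mu_].
have fin_le (a : \bar R) (b : R) : 0 <= a -> a <= b%:E -> a = (fine a)%:E.
  by move=> a0 ab; rewrite fineK// ge0_fin_numE// (le_lt_trans ab)// ltry.
pose G x := fine (Ginf x); pose h k x := fine (H k x).
have GE x : Ginf x = (G x)%:E.
  by apply: (fin_le _ (f x)) => //; apply: le_trans (H_Ginf 0%N x).
have hE k x : H k x = (h k x)%:E.
  by apply: (fin_le _ (g_ k x)) => //; exact: H_le.
have mGr : measurable_fun setT G.
  by apply: measurableT_comp => //; exact: fine_measurable.
have mhr k : measurable_fun setT (h k).
  by apply: measurableT_comp => //; exact: fine_measurable.
have Gb x : (0 <= G x <= f x)%R.
  by rewrite -!lee_fin -GE Ginf_le andbT (le_trans _ (H_Ginf 0%N x)).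
have hb k x : (0 <= h k x <= g_ k x)%R by rewrite -!lee_fin -hE H_ge0 H_le.
have hG k x : (h k x <= G x)%R by rewrite -lee_fin -GE -hE.
have MG : minorant G.
  split => //; have -> : EFin \o G = Ginf by apply/funext => x; rewrite GE.
  have MH k : Mplus setT (H k) by split.
  have MGinf : Mplus setT Ginf.
    by split => // x _; apply: le_trans (H_Ginf 0%N x).
  have [_ cr] := ri_fatou rhoP MH MGinf (aeW _ (fun x _ => conj (ndH x) (cvH x))).
  rewrite -(cvg_lim _ cr)//; apply: lime_le; first by apply/cvg_ex; exists (rho Ginf).
  apply: nearW => k /=; have [[mg gf g1] _] := gP k; apply: le_trans g1.
  have Mg : Mplus setT (EFin \o g_ k).
    by apply: Mplus_real => // x; have /andP[] := gf x.
  by apply: (ri_mono rhoP) => // x; exact: H_le.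
exists G => //.
have bG := minorant_bounded MG.
have bg k := minorant_bounded (gP k).1.
have bh k : bdd (h k) by apply: bounded_on_le (bg k) (hb k).
have tail k : (\I (fun x => g_ k x - h k x) <= 2 * gap * s k)%R.
  have bgh : bdd (fun x => g_ k x - h k x)%R by apply: bounded_onB.
  pose v i x : R := `|g_ (k + i)%N x - g_ (k + i).+1 x|%R.
  have bv i : bdd (v i) by apply: bounded_on_abs; exact: bounded_onB.
  have mv i : measurable_fun setT (EFin \o v i).
    by apply/measurable_EFinP; have [] := bv i.
  have v0 i x : 0 <= (v i x)%:E by rewrite lee_fin normr_ge0.
  rewrite -lee_fin -(integral_bounded mB Boo bgh).
  apply: (@le_trans _ _ (\int[mu]_x (\sum_(i <oo) (v i x)%:E))).
    apply: ge0_le_integral => //.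
    - by move=> x _; rewrite lee_fin subr_ge0; have /andP[] := hb k x.
    - by apply/measurable_EFinP; have [] := bgh.
    - apply: ge0_emeasurable_sum => [i x _ _|i _]; [exact: v0|exact: mv].
    - move=> x _; have partial m : (g_ k x <= g_ (k + m)%N x + \sum_(i < m) v i x)%R.
        elim: m => [|m IH]; first by rewrite addn0 big_ord0 addr0.
        rewrite big_ord_recr/= addnS; apply: le_trans IH _.
        have := ler_norm (g_ (k + m)%N x - g_ (k + m).+1 x)%R.
        by rewrite -/(v m x); lra.
      have S0 : 0 <= \sum_(i <oo) (v i x)%:E.
        by apply: nneseries_ge0 => i _ _; exact: v0.
      case SE : (\sum_(i <oo) (v i x)%:E) S0 => [S| |//] S0; last by rewrite leey.
      rewrite lee_fin lerBlDl -lerBlDr -lee_fin -hE.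
      apply: le_ereal_inf_tmp => _ [j /= kj <-]; rewrite lee_fin lerBlDr.
      rewrite -(subnKC kj); apply: le_trans (partial (j - k)%N) _.
      rewrite lerD2l -lee_fin -SE -sumEFin.
      rewrite -(big_mkord xpredT (fun i => (v i x)%:E)).
      exact: nneseries_lim_ge.
  rewrite integral_nneseries//.
  apply: (@le_trans _ _ (\sum_(i <oo) (0 + ((2 * gap * s k) / (2 ^ i.+1)%:R)%:E))).
    apply: lee_nneseries => i _; first by move=> _; apply: integral_ge0.
    rewrite add0e (integral_bounded mB Boo (bv i)) lee_fin.
    apply: le_trans (consecutive_minorants (k + i)%N gP) _.
    rewrite le_eqVlt; apply/orP; left; apply/eqP; rewrite /s expnD expnS !natrM.
    by field; rewrite !gt_eqF// ltr0n expn_gt0.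
  apply: le_trans (epsilon_trick _ _ _) _ => //.
    by rewrite mulr_ge0 ?mulr_ge0// ltW.
  by rewrite eseries0// add0e.
have dG k : (distance G <= delta + (1 + 4 * `|N| * gap) * s k)%R.
  have bgh : bdd (fun x => g_ k x - h k x)%R by apply: bounded_onB.
  have bdk := bounded_distance (bg k).
  apply: (@le_trans _ _ (\I (fun x => 1 * ((f x - g_ k x) * (f x - g_ k x)) +
      (2 * `|N|) * (g_ k x - h k x))%R)).
    apply: (le_Rintegral_bounded mB Boo); first exact: bounded_distance.
      exact: bounded_onL.
    move=> x; have := hG k x; have /andP[h0 hg] := hb k x.
    have /andP[G0 Gf] := Gb x; have [[_ /(_ x)/andP[g0 gf] _] _] := gP k.
    have fN : (f x <= `|N|)%R.
      apply: le_trans (f_le x) _; apply: le_trans (ler_norm _) _.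
      by rewrite normrM ler_piMr// indicE; case: (x \in B); rewrite ?normr1 ?normr0.
    move: (normr_ge0 N) h0 hg G0 Gf g0 gf fN.
    move: (g_ k x) (h k x) (G x) (f x) `|N|%R => a b c e M M0 b0 ba c0 ce a0 ae eM bc.
    apply: (@le_trans _ _ ((e - b) * (e - b))%R).
      by apply: ler_pM; rewrite ?subr_ge0// lerD2l lerN2.
    have -> : ((e - b) * (e - b) = (e - a) * (e - a) + (2 * e - a - b) * (a - b))%R by ring.
    rewrite mul1r lerD2l ler_wpM2r ?subr_ge0//; lra.
  rewrite (Rintegral_lin mB Boo _ _ bdk bgh) mul1r -/(distance (g_ k)).
  have := (gP k).2; have := tail k.
  set I1 := (\int[mu]_x _)%R => t1 d1.
  have sk1 : (s k <= 1)%R.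
    by rewrite /s invf_le1 ?ltr0n ?expn_gt0// ler1n expn_gt0.
  have s1 : (s k ^+ 2 <= s k)%R by rewrite expr2 ler_piMl// ltW.
  have : (2 * `|N| * I1 <= 2 * `|N| * (2 * gap * s k))%R.
    by rewrite ler_wpM2l// mulr_ge0.
  by move: d1 s1; lra.
rewrite leNgt; apply/negP => dlt.
pose L := (1 + 4 * `|N| * gap)%R.
have L0 : (0 < L)%R by rewrite ltr_wpDr// !mulr_ge0.
pose k := (Num.truncn (L / (distance G - delta))).
have := dG k; rewrite -lerBlDl leNgt => /negP; apply.
rewrite -/L /s ltr_pdivrMr ?ltr0n ?expn_gt0// mulrC -ltr_pdivrMr ?subr_gt0//.
apply: lt_le_trans (truncnS_gt _) _; rewrite ler_nat; exact: ltn_expl.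
Qed.

(** First-order optimality: moving from the projection [g] towards another
    element [h] of the unit ball cannot decrease the distance to [f]. Hence the
    residual [f - g], as a functional on the ball, is maximal at [g]. *)
Lemma residual_optimal g h : minorant g -> (distance g <= delta)%R -> bdd h ->
  (forall x, 0 <= h x)%R -> rho (EFin \o h) <= 1 ->
  (\I (fun x => (f x - g x) * h x) <= \I (fun x => (f x - g x) * g x))%R.
Proof.
move=> Mg gd bh h0 h1; have [mg gf g1] := Mg; have [mh _] := bh.
have bg := minorant_bounded Mg.
pose phi x := (f x - g x)%R; pose u x := (h x - g x)%R.
have bphi : bdd phi by apply: bounded_onB => //; exact: bounded_f.
have bu : bdd u by exact: bounded_onB.
have bphi2 := bounded_onM bphi bphi; have bu2 := bounded_onM bu bu.
have bphiu := bounded_onM bphi bu.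
(* Quadratic perturbation inequality along the segment from [g] to [h]. *)
have key (t : R) : (0 < t <= 1)%R ->
    (2 * \I (fun x => phi x * u x) <= t * \I (fun x => u x * u x))%R.
  move=> /andP[t0 t1].
  pose w x := ((1 - t) * g x + t * h x)%R.
  have bw : bdd w by exact: bounded_onL.
  have w0 x : (0 <= w x)%R.
    rewrite addr_ge0// mulr_ge0//; last exact: ltW.
      by rewrite subr_ge0.
    by have /andP[] := gf x.
  have mw : measurable_fun setT w by have [] := bw.
  have rw : rho (EFin \o w) <= 1.
    by apply: ri_convex => //; [rewrite t1 andbT ltW|move=> x; have /andP[] := gf x].
  (* The segment may leave the set of minorants; cutting it at [f] brings it back
     and does not increase the distance. *)
  pose w' x := Num.min (w x) (f x).
  have mw' : measurable_fun setT w' by exact: measurable_minr.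
  have Mw' : minorant w'.
    split => // [x|].
      by rewrite /w' le_min w0 f_ge0 ge_min lexx orbT.
    apply: le_trans rw; apply: (ri_mono rhoP).
    - by apply: Mplus_real => // x; rewrite /w' le_min w0 f_ge0.
    - exact: Mplus_real.
    - by move=> x; rewrite lee_fin /w' ge_min lexx.
  have bw' := minorant_bounded Mw'.
  have H : (delta <= \I (fun x => (f x - w x) * (f x - w x)))%R.
    apply: le_trans (delta_le Mw') _.
    apply: (le_Rintegral_bounded mB Boo); [exact: bounded_distance|exact: bounded_distance|].
    move=> x; rewrite /w'; case: (leP (w x) (f x)) => // _.
    by rewrite subrr mul0r -expr2 sqr_ge0.
  have E : (\I (fun x => (f x - w x) * (f x - w x)) =
      distance g - 2 * t * \I (fun x => phi x * u x) +
      t ^+ 2 * \I (fun x => u x * u x))%R.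
    have := Rintegral_lin mB Boo 1 (t ^+ 2) (bounded_onL 1 (- (2 * t)) bphi2 bphiu) bu2.
    rewrite (Rintegral_lin mB Boo _ _ bphi2 bphiu) !mul1r mulNr => <-.
    by apply: eq_Rintegral => x _; rewrite /w /phi /u; ring.
  move: H; rewrite E => H.
  have : (t * (2 * \I (fun x => phi x * u x)) <= t * (t * \I (fun x => u x * u x)))%R.
    by move: H gd; lra.
  by rewrite ler_pM2l.
have u2_0 : (0 <= \I (fun x => u x * u x))%R.
  by apply: Rintegral_ge0 => x _; rewrite -expr2 sqr_ge0.
have le0 : (\I (fun x => phi x * u x) <= 0)%R.
  rewrite leNgt; apply/negP => p.
  move: key u2_0 p; set a := (\int[mu]_x (phi x * u x))%R.
  set b := (\int[mu]_x (u x * u x))%R => key b0 a0.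
  have := key 1%R; rewrite lexx ltr01 mul1r => /(_ isT) ab.
  have b0' : (0 < b)%R by lra.
  have := key (a / b)%R; rewrite divr_gt0// divfK ?gt_eqF// ler_pdivrMr// mul1r.
  by move=> H; have : (2 * a <= a)%R; [apply: H; lra|lra].
have bphih := bounded_onM bphi bh; have bphig := bounded_onM bphi bg.
have E : (\I (fun x => phi x * u x) = \I (fun x => phi x * h x) - \I (fun x => phi x * g x))%R.
  have := Rintegral_lin mB Boo 1 (-1) bphih bphig; rewrite mul1r mulN1r => <-.
  by apply: eq_Rintegral => x _; rewrite /u; ring.
by move: le0; rewrite E subr_le0.
Qed.

(** By [residual_optimal] the associate norm of the residual [f - g] is at
    most [\int (f - g) * g]. If the second associate norm of [f] is at most 1,
    then [\int (f - g) * f] obeys the same bound, that is,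
    [\int (f - g) ^ 2 <= 0] and [f = g] almost everywhere. *)
Lemma lorentz_luxemburg_bounded :
  associate mu setT (associate mu setT rho) (EFin \o f) <= 1 -> rho (EFin \o f) <= 1.
Proof.
move=> f2; have [g Mg gd] := minimizer_exists; have [mg gf g1] := Mg.
have bg := minorant_bounded Mg; have bf := bounded_f.
pose phi x := (f x - g x)%R.
have phi0 x : (0 <= phi x)%R by rewrite subr_ge0; have /andP[] := gf x.
have bphi : bdd phi by exact: bounded_onB.
have Mphi : Mplus setT (EFin \o phi) by apply: Mplus_real => //; exact: bphi.1.
have Mf := Mplus_real mf f_ge0.
have Mg' : Mplus setT (EFin \o g).
  by apply: Mplus_real => // x; have /andP[] := gf x.
have bphig := bounded_onM bphi bg; have bphif := bounded_onM bphi bf.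
have bphi2 := bounded_onM bphi bphi.
pose c := \I (fun x => phi x * g x)%R.
have rphi : associate mu setT rho (EFin \o phi) <= c%:E.
  apply: ge_ereal_sup => _ [h [Mh h1] <-].
  apply: integral_le_layers => // m.
  pose h' x := (layers m (h x) * \1_B x)%R.
  have mh' : measurable_fun setT h'.
    by apply: measurable_funM; [exact: (measurable_layers m Mh.1)|exact: measurable_indic].
  have h'0 x : (0 <= h' x)%R by rewrite mulr_ge0// layers_ge0.
  have bh' : bdd h'.
    split => //; exists ((m.+1 * m.+1)%N%:R * m.+1%:R^-1)%R => x.
    by rewrite ger0_norm// ler_wpM2r// layer_le_top.
  have rh' : rho (EFin \o h') <= 1.
    apply: le_trans h1; apply: (ri_mono rhoP) => //; first exact: Mplus_real.
    move=> x; apply: le_trans (layers_le m (Mh.2 x I)).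
    by rewrite lee_fin ler_piMr ?layers_ge0// indicE; case: (x \in B).
  have := residual_optimal Mg gd bh' h'0 rh'; rewrite -/phi -/c -lee_fin.
  apply: le_trans; rewrite -(integral_bounded mB Boo (bounded_onM bphi bh')).
  apply: ge0_le_integral => //.
  - by move=> x _; rewrite lee_fin mulr_ge0// layers_ge0.
  - apply/measurable_EFinP/measurable_funM; apply: measurable_layers.
      exact: Mh.1.
    exact: Mphi.1.
  - by apply/measurable_EFinP/measurable_funM => //; exact: bphi.1.
  - move=> x _; rewrite lee_fin mulrC.
    have lphi : (layers m (phi x)%:E <= phi x)%R.
      by rewrite -lee_fin; apply: layers_le; rewrite lee_fin.
    have [xB|xB] := pselect (B x).
      by rewrite /h' indicE mem_set// mulr1 ler_wpM2r// layers_ge0.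
    have phix : phi x = 0%R.
      apply/eqP; rewrite eq_le phi0 andbT.
      have /andP[gx _] := gf x; have := f_le x.
      by rewrite indicE memNset// mulr0 /phi; lra.
    have z : layers m (phi x)%:E = 0%R.
      by apply/eqP; rewrite eq_le layers_ge0 andbT -[leRHS]phix.
    by rewrite /= z phix !mul0r.
have rho'P := associate_is_ri_norm tauP rhoP.
have c0 : 0 <= c%:E by apply: le_trans rphi; exact: (ri_ge0 rho'P).
have H : \int[mu]_x ((EFin \o phi) x * (EFin \o f) x) <= c%:E.
  apply: le_trans (hoelder rho'P Mphi Mf _) _.
    by apply: le_lt_trans rphi _; rewrite ltry.
  rewrite -[leRHS]mule1; apply: lee_pmul => //; first exact: (ri_ge0 rho'P).
  by apply: (ri_ge0 (associate_is_ri_norm tauP rho'P)).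
have H' : (\I (fun x => phi x * f x) <= c)%R.
  by rewrite -lee_fin -(integral_bounded mB Boo bphif).
have E : (\I (fun x => phi x * f x) = c + \I (fun x => phi x * phi x))%R.
  have := Rintegral_lin mB Boo 1 1 bphig bphi2; rewrite !mul1r => <-.
  by apply: eq_Rintegral => x _; rewrite !mul1r -mulrDr /phi subrKC.
have phi2_0 : \int[mu]_x `|(phi x * phi x)%:E| = 0.
  rewrite (eq_integral (fun x => (phi x * phi x)%:E)); last first.
    by move=> x _; rewrite gee0_abs// lee_fin mulr_ge0.
  rewrite (integral_bounded mB Boo bphi2); congr (_%:E).
  apply/eqP; rewrite eq_le; apply/andP; split; first by move: H'; rewrite E; lra.
  by apply: Rintegral_ge0 => x _; rewrite mulr_ge0.
have mphi2 : measurable_fun setT (fun x => (phi x * phi x)%:E).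
  by apply/measurable_EFinP; have [] := bphi2.
have := (ae_eq_integral_abs mu measurableT mphi2).1 phi2_0 => ae0.
apply: le_trans g1; apply: (ri_le rhoP) => //.
apply: filterS ae0 => x /(_ I) [] /eqP; rewrite mulf_eq0 orbb => /eqP phix _.
by rewrite lee_fin; move: phix; rewrite /phi; lra.
Qed.

End projection.

Section lorentz_luxemburg.
Context d (T : measurableType d) (R : realType).
Variables (mu : {measure set T -> \bar R}) (tau : T -> lline R).
Hypothesis tauP : is_gauge mu tau.
Variable rho : (T -> \bar R) -> \bar R.
Hypothesis rhoP : is_ri_norm mu setT rho.
Local Notation rho'' := (associate mu setT (associate mu setT rho)).

Lemma lorentz_luxemburg_unit (f : T -> \bar R) : Mplus setT f ->
  rho'' f <= 1 -> rho f <= 1.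
Proof.
move=> Mf f2.
have rho''P := associate_is_ri_norm tauP (associate_is_ri_norm tauP rhoP).
pose f_ := truncate tau f.
have Mf_ k : Mplus setT (f_ k) by exact: (truncate_Mplus tauP).
have nd x : nondecreasing_seq (f_ ^~ x) by exact: truncate_nondecreasing.
have cv x : f_ ^~ x @ \oo --> f x by exact: cvg_truncate.
have [_ cr] := ri_fatou rhoP Mf_ Mf (aeW _ (fun x _ => conj (nd x) (cv x))).
rewrite -(cvg_lim _ cr)//; apply: lime_le; first by apply/cvg_ex; exists (rho f).
apply: nearW => k /=.
pose B := [set x | (tau x : R)%:E < k%:R%:E].
have top x := truncate_le_top tau f k x.
pose u x := fine (f_ k x).
have fE : f_ k = EFin \o u.
  apply/funext => x /=; rewrite fineK// ge0_fin_numE ?(Mf_ k).2//.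
  by rewrite (le_lt_trans (top x)) ?ltry.
rewrite fE; apply: (@lorentz_luxemburg_bounded _ _ _ _ _ tauP _ rhoP B k%:R).
- exact: (measurable_gauge_lt tauP).
- by rewrite [ltLHS](measure_gauge_lt tauP)// ltry.
- by apply: measurableT_comp; [exact: fine_measurable|exact: (Mf_ k).1].
- by move=> x; rewrite fine_ge0// (Mf_ k).2.
- by move=> x; rewrite -lee_fin -[X in X <= _]/((EFin \o u) x) -fE.
- rewrite -fE; apply: le_trans f2; apply: (ri_mono rho''P) => // x.
  exact: truncate_le.
Qed.

Theorem lorentz_luxemburg (f : T -> \bar R) : Mplus setT f -> rho f <= rho'' f.
Proof.
move=> Mf.
have rho''P := associate_is_ri_norm tauP (associate_is_ri_norm tauP rhoP).
have f0 := ri_ge0 rho''P Mf; have := f0.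
case fE : (rho'' f) => [c| |//] c0; last by rewrite leey.
apply/lee_addgt0Pr => e e0.
have ce0 : (0 < c + e)%R by rewrite ltr_wpDl.
have ce0' : (0 <= (c + e)^-1)%R by rewrite invr_ge0 ltW.
have := lorentz_luxemburg_unit (MplusZ ce0' Mf).
rewrite (ri_homo rho''P)// (ri_homo rhoP)// fE -EFinM lee_fin mulrC.
rewrite ler_pdivrMr// mul1r lerDl ltW// => /(_ isT).
by rewrite -[1%E]/(1%:E) lee_pdivrMl// mule1 EFinD.
Qed.

End lorentz_luxemburg.

(** * The averaging operator and its transpose *)

Section hardy_operators.
Context d (T : measurableType d) (R : realType).
Variables (mu : {sigma_finite_measure set T -> \bar R}) (tau : T -> lline R).
Hypothesis tauP : is_gauge mu tau.
Local Notation lam := (@completed_lebesgue_measure R).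
Local Notation sym := (sym mu tau).
Local Notation below t := [set x | (tau x : R)%:E < t].
Implicit Types (f g h F G H K : T -> \bar R).

(** One kernel serves both operators: integrated in [y] it gives the tail
    average, integrated in [x] the average over the set [tau < tau y]. *)
Definition hardy_kernel (x y : T) : R :=
  (((tau x : R) < tau y)%R%:R * (tau y : R)^-1)%R.

Definition tailop G x : \bar R := \int[mu]_y ((hardy_kernel x y)%:E * G y).

Definition avgop H y : \bar R := \int[mu]_x ((hardy_kernel x y)%:E * H x).

Lemma hardy_kernel_ge0 x y : (0 <= hardy_kernel x y)%R.
Proof. by rewrite mulr_ge0// invr_ge0 (gauge_ge0 tauP). Qed.

Lemma measurable_gauge_real : measurable_fun setT (fun x => tau x : R).
Proof.
exact: (measurableT_comp (@measurable_idfun_lline R) (gauge_measurable tauP)).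
Qed.

Lemma measurable_hardy_kernel :
  measurable_fun setT (fun z : T * T => hardy_kernel z.1 z.2).
Proof.
have m1 := measurableT_comp measurable_gauge_real (@measurable_fst _ _ T T).
have m2 := measurableT_comp measurable_gauge_real (@measurable_snd _ _ T T).
apply: measurable_funM; last first.
  rewrite (_ : (fun _ => _) = (fun z : T * T => (tau z.2 : R) `^ (-1)))%R.
    exact: (measurableT_comp (@measurable_powR R (-1)%R) m2).
  by apply/funext => z; rewrite powR_inv1// (gauge_ge0 tauP).
apply: (measurableT_comp (f := fun b : bool => (b%:R : R))) => //.
exact: measurable_fun_ltr.
Qed.

Lemma measurable_hardy_kernel1 x : measurable_fun setT (hardy_kernel x).
Proof.
by have := measurableT_comp measurable_hardy_kernel (@measurable_pair1 _ _ T T x).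
Qed.

Lemma measurable_hardy_kernel2 y : measurable_fun setT (hardy_kernel^~ y).
Proof.
by have := measurableT_comp measurable_hardy_kernel (@measurable_pair2 _ _ T T y).
Qed.

Let kernelG G : Mplus setT G -> forall x,
  Mplus setT (fun y => (hardy_kernel x y)%:E * G y).
Proof.
move=> MG x; apply: MplusM => //; split=> [|y _].
  by apply/measurable_EFinP; exact: measurable_hardy_kernel1.
by rewrite lee_fin hardy_kernel_ge0.
Qed.

Let kernelH H : Mplus setT H -> forall y,
  Mplus setT (fun x => (hardy_kernel x y)%:E * H x).
Proof.
move=> MH y; apply: MplusM => //; split=> [|x _].
  by apply/measurable_EFinP; exact: measurable_hardy_kernel2.
by rewrite lee_fin hardy_kernel_ge0.
Qed.

Lemma tailop_Mplus G : Mplus setT G -> Mplus setT (tailop G).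
Proof.
move=> [mG G0]; split=> [|x _]; last first.
  by apply: integral_ge0 => y _; rewrite mule_ge0 ?lee_fin ?hardy_kernel_ge0 ?G0.
apply: (@measurable_fun_fubini_tonelli_F _ _ T T R mu
  (fun z => (hardy_kernel z.1 z.2)%:E * G z.2)).
- apply: emeasurable_funM.
    by apply/measurable_EFinP; exact: measurable_hardy_kernel.
  exact: (measurableT_comp mG (@measurable_snd _ _ T T)).
- by move=> z; rewrite mule_ge0 ?lee_fin ?hardy_kernel_ge0 ?G0.
Qed.

Lemma avgop_Mplus H : Mplus setT H -> Mplus setT (avgop H).
Proof.
move=> [mH H0]; split=> [|x _]; last first.
  by apply: integral_ge0 => y _; rewrite mule_ge0 ?lee_fin ?hardy_kernel_ge0 ?H0.
apply: (@measurable_fun_fubini_tonelli_F _ _ T T R mu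
  (fun z => (hardy_kernel z.2 z.1)%:E * H z.2)).
- apply: emeasurable_funM.
    apply/measurable_EFinP.
    exact: (measurableT_comp measurable_hardy_kernel (@measurable_swap _ _ T T)).
  exact: (measurableT_comp mH (@measurable_snd _ _ T T)).
- by move=> z; rewrite mule_ge0 ?lee_fin ?hardy_kernel_ge0 ?H0.
Qed.

(** Tonelli's theorem for the common kernel. *)
Lemma hardy_duality H G : Mplus setT H -> Mplus setT G ->
  \int[mu]_x (H x * tailop G x) = \int[mu]_y (avgop H y * G y).
Proof.
move=> MH MG; have [mH H0] := MH; have [mG G0] := MG.
pose F (z : T * T) := H z.1 * ((hardy_kernel z.1 z.2)%:E * G z.2).
have F0 z : 0 <= F z by rewrite !mule_ge0 ?lee_fin ?hardy_kernel_ge0 ?H0 ?G0.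
have mF : measurable_fun setT F.
  apply: emeasurable_funM; first exact: (measurableT_comp mH (@measurable_fst _ _ T T)).
  apply: emeasurable_funM; last exact: (measurableT_comp mG (@measurable_snd _ _ T T)).
  by apply/measurable_EFinP; exact: measurable_hardy_kernel.
transitivity (\int[mu]_x \int[mu]_y F (x, y)).
  apply: eq_integral => x _; have [mk k0] := kernelG MG x.
  by rewrite /F /= ge0_integralZl// H0.
rewrite (fubini_tonelli F mF F0); apply: eq_integral => y _.
have [mk k0] := kernelH MH y.
under eq_integral => x _ do rewrite /F/= muleCA muleA muleC.
by rewrite ge0_integralZl// ?G0// muleC.
Qed.

Lemma avgopE H y : Mplus setT H -> (0 < (tau y : R))%R ->
  avgop H y = ((tau y : R)^-1)%:E * \int[mu]_(x in below (tau y : R)%:E) H x.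
Proof.
move=> MH y0; have mb := measurable_gauge_lt tauP (tau y : R)%:E.
rewrite integral_mkcond -ge0_integralZl_EFin//; last 3 first.
- move=> x _; rewrite patchE; case: ifP => // _; exact: MH.2.
- by apply/(measurable_restrictT _ mb); exact: measurable_funS MH.1.
- by rewrite invr_ge0 ltW.
apply: eq_integral => x _; rewrite /hardy_kernel patchE.
have [xy|xy] := ltP (tau x : R) (tau y); first by rewrite mem_set// mul1r.
by rewrite memNset ?mul0r ?mul0e ?mule0//= lte_fin ltNge xy.
Qed.

Lemma avgop_origin H y : (tau y : R) = 0%R -> avgop H y = 0.
Proof.
move=> y0; rewrite /avgop (eq_integral (cst 0)) ?integral0// => x _ /=.
by rewrite /hardy_kernel y0 invr0 mulr0 mul0e.
Qed.

Lemma tailop_nonincreasing G x y : Mplus setT G -> ((tau x : R) <= tau y)%R ->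
  tailop G y <= tailop G x.
Proof.
move=> MG xy; rewrite /tailop; apply: le_integral_Mplus => [||z]; try exact: kernelG.
apply: lee_wpmul2r; first exact: MG.2.
rewrite lee_fin /hardy_kernel ler_wpM2r ?invr_ge0 ?(gauge_ge0 tauP)//.
have [yz|//] := ltP (tau y : R) (tau z).
  by rewrite (le_lt_trans xy yz).
Qed.

Lemma le_tailop F G x : Mplus setT F -> Mplus setT G ->
  (forall y, (0 < (tau y : R))%R -> F y <= G y) -> tailop F x <= tailop G x.
Proof.
move=> MF MG FG; rewrite /tailop; apply: le_integral_Mplus => [||y]; try exact: kernelG.
have := gauge_ge0 tauP y; rewrite le_eqVlt => /predU1P[y0|y0].
  by rewrite /hardy_kernel -y0 invr0 mulr0 !mul0e.
by apply: lee_wpmul2l; [rewrite lee_fin hardy_kernel_ge0|exact: FG].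
Qed.

Lemma tailopZ (l : R) G x : (0 <= l)%R -> Mplus setT G ->
  tailop (fun y => l%:E * G y) x = l%:E * tailop G x.
Proof.
move=> l0 MG; have [mk k0] := kernelG MG x.
by rewrite -ge0_integralZl_EFin//; apply: eq_integral => y _; rewrite muleCA.
Qed.

Lemma cvg_tailop (G_ : (T -> \bar R)^nat) G x : (forall j, Mplus setT (G_ j)) ->
  (forall y, nondecreasing_seq (G_ ^~ y)) -> (forall y, G_ ^~ y @ \oo --> G y) ->
  tailop (G_ j) x @[j --> \oo] --> tailop G x.
Proof.
move=> MG nd cv.
have -> : tailop G x = \int[mu]_y limn (fun j => (hardy_kernel x y)%:E * G_ j y).
  apply: eq_integral => y _; apply/esym/cvg_lim => //.
  apply: ge0_cvgeMl => //; first by rewrite lee_fin hardy_kernel_ge0.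
  move=> k; rewrite (MG k).2//= -(cvg_lim _ (cv y))//.
  rewrite (cvg_lim _ (ereal_nondecreasing_cvgn (nd y)))//.
  by apply: ereal_sup_ubound; exists k.
apply: cvg_monotone_convergence => //.
- by move=> j; have [] := kernelG (MG j) x.
- by move=> j y _; have [_] := kernelG (MG j) x; apply.
- move=> y _ i j ij; apply: lee_wpmul2l; first by rewrite lee_fin hardy_kernel_ge0.
  exact: nd.
Qed.

(** A function that decreases with [tau] is its own rearrangement, except that
    [sym] is right-continuous along [tau]. *)
Lemma sym_le_radial K x : Mplus setT K -> (0 < (tau x : R))%R ->
  (forall y, ((tau x : R) <= tau y)%R -> K y <= K x) -> sym K x <= K x.
Proof.
move=> MK x0 Kx; apply: lee_real_upper; first exact: MK.2.
move=> l l0 Kl; rewrite symE rearr_le//; last exact: MK.1.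
rewrite -(measure_gauge_lt tauP (ltW x0 : 0 <= (tau x : R)%:E)) dist_Mplus//.
apply: le_measure; rewrite ?inE; [|exact: (measurable_gauge_lt tauP)|].
  rewrite -[X in measurable X]setTI.
  by apply: emeasurable_fun_o_infty => //; exact: MK.1.
move=> y /= lK; rewrite lte_fin ltNge; apply/negP => /Kx /le_trans/(_ Kl).
by rewrite leNgt lK.
Qed.

(** The second hypothesis on [K] says that [K] decreases at most like
    [1 / tau], as averages do; it replaces right-continuity along [tau]. *)
Lemma radial_le_sym K x : Mplus setT K -> (0 < (tau x : R))%R ->
  (forall y, (0 < (tau y : R) <= tau x)%R -> K x <= K y) ->
  (forall y, ((tau x : R) <= tau y)%R ->
    ((tau x : R) / (tau y : R))%:E * K x <= K y) ->
  K x <= sym K x.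
Proof.
move=> MK x0 Kle Kge; apply: lee_real_lower; first exact: sym_ge0.
move=> l l0 lK; apply: ltW; rewrite symE rearr_gt//; last exact: MK.1.
have [m lm mK] : exists2 m : R, (l < m)%R & m%:E <= K x.
  case: (K x) lK => [r| |]//; first by exists r.
  by move=> _; exists (l + 1)%R; rewrite ?leey// ltrDl.
have m0 : (0 < m)%R := le_lt_trans l0 lm.
(* This [r > 1] is such that [m / r], the midpoint of [l] and [m], exceeds [l]:
   up to a null set, the level set of [K] above [l] contains the set
   [tau < r * tau x]. *)
pose r := (2 * m / (l + m))%R.
have lm0 : (0 < l + m)%R by rewrite ltr_wpDl.
have r1 : (1 < r)%R by rewrite ltr_pdivlMr// mul1r; lra.
have r0 : (0 < r)%R by exact: lt_trans r1.
have rx0 : 0 <= (r * (tau x : R))%:E by rewrite lee_fin mulr_ge0// ltW.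
apply: (@lt_le_trans _ _ (r * (tau x : R))%:E).
  by rewrite lte_fin ltr_pMl.
rewrite -(measure_gauge_lt tauP rx0) dist_Mplus//.
apply: ae_le_measure; first exact: (measurable_gauge_lt tauP).
  rewrite -[X in measurable X]setTI.
  by apply: emeasurable_fun_o_infty => //; exact: MK.1.
exists (tau @^-1` [set 0%R]); split.
- rewrite -[X in measurable X]setTI; apply: (gauge_measurable tauP) => //.
  by apply: measurable_lline_borel; exact: measurable_set1.
- exact: gauge_null tauP.
move=> y /= /not_implyP[yr nK]; apply: contrapT => y0; apply: nK.
have {}y0 : (0 < (tau y : R))%R by rewrite lt_neqAle (gauge_ge0 tauP) andbT eq_sym; apply/eqP.
have [yx|/ltW xy] := leP (tau y : R) (tau x).
  by apply: lt_le_trans lK _; apply: Kle; rewrite y0.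
apply: lt_le_trans (Kge y xy); apply: (@lt_le_trans _ _ (r^-1 * m)%:E).
  have -> : (r^-1 * m = (l + m) / 2)%R by rewrite /r; field; rewrite !gt_eqF.
  by rewrite lte_fin; lra.
rewrite EFinM; apply: lee_pmul; rewrite ?lee_fin ?(ltW m0)//.
  by rewrite invr_ge0 ltW.
rewrite lte_fin in yr.
by rewrite ler_pdivlMr// mulrC -ler_pdivlMr ?invr_gt0// invrK mulrC ltW.
Qed.

End hardy_operators.

Section rearrangement_calculus.
Context d (T : measurableType d) (R : realType).
Variables (mu : {measure set T -> \bar R}) (tau : T -> lline R).
Hypothesis tauP : is_gauge mu tau.
Local Notation sym := (sym mu tau).
Local Notation below t := [set x | (tau x : R)%:E < t].
Implicit Types (f g : T -> \bar R).

Lemma symZ (l : R) f x : (0 < l)%R -> Mplus setT f ->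
  sym (fun y => l%:E * f y) x = l%:E * sym f x.
Proof.
move=> l0 Mf; have Mlf := MplusZ (ltW l0) Mf; rewrite !symE.
apply: eqe_real_upper; rewrite ?rearr_ge0//.
  by rewrite mule_ge0 ?rearr_ge0// lee_fin ltW.
move=> a a0; rewrite rearr_le//; last exact: Mlf.1.
rewrite -lee_pdivlMl// -EFinM rearr_le//; [|exact: Mf.1|]; last first.
  by rewrite mulr_ge0// invr_ge0 ltW.
rewrite !dist_Mplus//; congr (mu _ <= _); apply/seteqP; split => y /=;
  by rewrite EFinM lte_pdivrMl.
Qed.

Lemma sym0 x : sym (cst 0) x = 0.
Proof.
apply/eqP; rewrite eq_le sym_ge0 andbT symE rearr_le//.
rewrite distE setTI (_ : [set _ | _] = set0) ?measure0 ?lee_fin ?(gauge_ge0 tauP)//.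
by apply/seteqP; split => // y; rewrite /mkset/= normr0 ltxx.
Qed.

Lemma le_sym f g x : Mplus setT f -> Mplus setT g ->
  {ae mu, forall y, setT y -> f y <= g y} -> sym f x <= sym g x.
Proof. by move=> Mf Mg fg; rewrite !symE; exact: ae_le_rearr. Qed.

Lemma sym_indic_le (E : set T) (a : \bar R) x : measurable E -> mu E <= a ->
  sym (EFin \o \1_E) x <= (\1_(below a) x)%:E.
Proof.
move=> mE Ea; have ME := Mplus_indic R mE.
have mS l : measurable [set y | l < (EFin \o \1_E : T -> \bar R) y].
  rewrite -[X in measurable X]setTI.
  by apply: emeasurable_fun_o_infty => //; exact: ME.1.
apply: lee_real_upper; first by rewrite lee_fin.
move=> l l0; rewrite lee_fin indicE; have [|xa] := boolP (x \in below a).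
  move=> _ /= l1; rewrite symE rearr_le//; last exact: ME.1.
  rewrite dist_Mplus// (_ : [set _ | _] = set0) ?measure0 ?lee_fin ?(gauge_ge0 tauP)//.
  apply/seteqP; split => // y /=; rewrite lte_fin indicE ltNge => /negP; apply.
  by apply: le_trans l1; case: (y \in E).
move=> _; rewrite symE rearr_le//; last exact: ME.1.
rewrite dist_Mplus//; apply: (@le_trans _ _ (mu E)).
  apply: le_measure; rewrite ?inE// => y /=; rewrite lte_fin indicE.
  have [|_] := boolP (y \in E); first by rewrite inE.
  by rewrite ltNge l0.
apply: le_trans Ea _; rewrite leNgt; apply: contra xa => xa.
by rewrite inE.
Qed.

End rearrangement_calculus.

(** * Averages of radial rearrangements *)

Section averages.
Context d (T : measurableType d) (R : realType).
Variables (mu : {sigma_finite_measure set T -> \bar R}) (tau : T -> lline R).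
Hypothesis tauP : is_gauge mu tau.
Local Notation sym := (sym mu tau).
Local Notation tailop := (tailop mu tau).
Local Notation avgop := (avgop mu tau).
Local Notation below t := [set x | (tau x : R)%:E < t].
Implicit Types (f g h : T -> \bar R).

Let mb t : measurable (below t). Proof. exact: (measurable_gauge_lt tauP). Qed.

(** Enlarging the set over which a decreasing function is averaged adds
    smaller values. *)
Lemma avgop_sym_nonincreasing h x y : (0 < (tau x : R))%R ->
  ((tau x : R) <= tau y)%R -> avgop (sym h) y <= avgop (sym h) x.
Proof.
move=> x0 xy; have y0 := lt_le_trans x0 xy; have Ms := sym_Mplus tauP h.
rewrite !(avgopE tauP)//; set A := \int[mu]_(z in below (tau x : R)%:E) _.
have mD : measurable (below (tau y : R)%:E `\` below (tau x : R)%:E).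
  exact: measurableD.
have yE : below (tau y : R)%:E = below (tau x : R)%:E `|`
    (below (tau y : R)%:E `\` below (tau x : R)%:E).
  rewrite setDUK// => z /= /lt_le_trans; apply; by rewrite lee_fin.
pose c := rearr mu setT h (tau x).
have c0 : 0 <= c by exact: rearr_ge0.
have A0 : 0 <= A by apply: integral_ge0 => z _; exact: sym_ge0.
have cA : c * (tau x : R)%:E <= A.
  rewrite -(measure_gauge_lt tauP (ltW x0 : 0 <= (tau x : R)%:E)).
  rewrite -[leLHS](integral_cst mu (mb _)).
  apply: ge0_le_integral; [exact: mb|by []|exact: measurable_cst|
    exact: measurable_funS Ms.1|].
  by move=> z /=; rewrite lte_fin symE => zx; exact/rearr_nonincreasing/ltW.
have mD_E : mu (below (tau y : R)%:E `\` below (tau x : R)%:E) =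
    ((tau y : R) - (tau x : R))%:E.
  rewrite measureD//; last first.
    by rewrite [ltLHS](measure_gauge_lt tauP) ?ltry// lee_fin ltW.
  rewrite setIidr; last by move=> z /= /lt_le_trans; apply; rewrite lee_fin.
  by rewrite [X in X - _](measure_gauge_lt tauP) ?[X in _ - X](measure_gauge_lt tauP)//
    lee_fin ltW.
have Ay : \int[mu]_(z in below (tau y : R)%:E) sym h z <=
    A + c * ((tau y : R) - (tau x : R))%:E.
  rewrite yE ge0_integral_setU//; last 3 first.
  - by rewrite -yE; exact: measurable_funS Ms.1.
  - by move=> z _; exact: sym_ge0.
  - by apply/disj_set2P/seteqP; split => // z [za [_ nza]]; exact: nza.
  apply: leeD; first exact: lexx.
  rewrite -mD_E -(integral_cst mu mD).
  apply: ge0_le_integral; [exact: mD|by move=> z _; exact: sym_ge0|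
    exact: measurable_funS Ms.1|exact: measurable_cst|].
  by move=> z [_ /negP /=]; rewrite -leNgt lee_fin symE => xz; exact: rearr_nonincreasing.
have [Aoo|Aoo] := eqVneq A +oo.
  by rewrite Aoo gt0_muley ?leey// lte_fin invr_gt0.
have AE : A = (fine A)%:E by rewrite fineK// ge0_fin_numE// ltey.
have cE : c = (fine c)%:E.
  rewrite fineK// ge0_fin_numE// ltey; apply: contraNneq Aoo => coo.
  by move: cA; rewrite coo gt0_mulye ?lte_fin// leye_eq.
apply: (@le_trans _ _ (((tau y : R)^-1)%:E *
    (A + c * ((tau y : R) - (tau x : R))%:E))).
  by apply: lee_wpmul2l => //; rewrite lee_fin invr_ge0 ltW.
suff H (a e u v : R) : (0 < u)%R -> (u <= v)%R -> e%:E * u%:E <= a%:E ->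
    (v^-1)%:E * (a%:E + e%:E * (v - u)%:E) <= (u^-1)%:E * a%:E.
  by rewrite AE cE; apply: H => //; rewrite -AE -cE.
move=> u0 uv; rewrite -EFinM lee_fin => eua.
rewrite -[(e%:E * _)]EFinM -EFinD -!EFinM lee_fin.
have v0 := lt_le_trans u0 uv.
rewrite ler_pdivrMl// mulrCA ler_pdivlMl//; nra.
Qed.

(** Together with [sym_le_avgop]: averages of rearrangements are their own
    rearrangements. *)
Lemma avgop_le_sym h y : avgop (sym h) y <= sym (avgop (sym h)) y.
Proof.
have Ms := sym_Mplus tauP h; have Ma := avgop_Mplus tauP Ms.
have := gauge_ge0 tauP y; rewrite le_eqVlt => /predU1P[y0|y0].
  by rewrite avgop_origin// sym_ge0.
apply: (radial_le_sym tauP) => // z; first by move=> /andP[z0 zy]; exact: avgop_sym_nonincreasing.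
move=> yz; have z0 := lt_le_trans y0 yz.
rewrite !(avgopE tauP)// muleA -EFinM mulrAC mulfV ?gt_eqF// mul1r.
apply: lee_wpmul2l; first by rewrite lee_fin invr_ge0 ltW.
apply: ge0_subset_integral; [exact: mb|exact: mb|exact: measurable_funS Ms.1|
  by move=> w _; exact: sym_ge0|].
by move=> w /= /lt_le_trans; apply; rewrite lee_fin.
Qed.

Lemma sym_le_avgop h y : (0 < (tau y : R))%R -> sym (avgop (sym h)) y <= avgop (sym h) y.
Proof.
have Ms := sym_Mplus tauP h; have Ma := avgop_Mplus tauP Ms.
by move=> y0; apply: (sym_le_radial tauP) => // z yz; exact: avgop_sym_nonincreasing.
Qed.

Lemma ae_gauge_gt0 : {ae mu, forall x, (0 < (tau x : R))%R}.
Proof.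
exists (tau @^-1` [set 0%R]); split.
- rewrite -[X in measurable X]setTI; apply: (gauge_measurable tauP) => //.
  by apply: measurable_lline_borel; exact: measurable_set1.
- exact: gauge_null tauP.
- move=> x /= /negP; rewrite -leNgt => x0.
  by apply/eqP; rewrite eq_le x0 (gauge_ge0 tauP).
Qed.

Lemma le_integral_gauge f g : Mplus setT f -> Mplus setT g ->
  (forall x, (0 < (tau x : R))%R -> f x <= g x) ->
  \int[mu]_x f x <= \int[mu]_x g x.
Proof.
move=> [mf f0] [mg g0] fg; apply: ae_ge0_le_integral => //.
by apply: filterS ae_gauge_gt0 => x x0 _; exact: fg.
Qed.

(** Subadditivity of the maximal rearrangement in weak form. Since the
    average of [sym h] is its own rearrangement, [resonance] replaces the
    left-hand side by integrals [\int k * (f + g)], which are additive, and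
    [hardy_littlewood] estimates both terms. *)
Lemma avgop_symD h f g : Mplus setT f -> Mplus setT g ->
  \int[mu]_y (avgop (sym h) y * sym (fun x => f x + g x) y) <=
  \int[mu]_y (avgop (sym h) y * sym f y) + \int[mu]_y (avgop (sym h) y * sym g y).
Proof.
move=> Mf Mg; set K := avgop (sym h).
have Ms := sym_Mplus tauP; have MK : Mplus setT K := avgop_Mplus tauP (Ms h).
have MD := MplusD Mf Mg.
apply: (@le_trans _ _ (\int[mu]_y (sym K y * sym (fun x => f x + g x) y))).
  apply: le_integral_Mplus; [exact: MplusM|exact: MplusM|move=> y].
  by apply: lee_wpmul2r; [exact: sym_ge0|exact: avgop_le_sym].
apply: (resonance tauP) => //; first exact: MK.1.
move=> k Mk kK; have [mkf kf0] := MplusM Mk Mf; have [mkg kg0] := MplusM Mk Mg.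
rewrite (eq_integral (fun x => k x * f x + k x * g x)); last first.
  by move=> x _; rewrite ge0_muleDr ?Mf.2 ?Mg.2.
rewrite ge0_integralD//.
have H (u : T -> \bar R) : Mplus setT u ->
    \int[mu]_x (k x * u x) <= \int[mu]_y (K y * sym u y).
  move=> Mu; apply: (le_trans (hardy_littlewood tauP Mk Mu)).
  apply: le_integral_gauge; [exact: MplusM|exact: MplusM|move=> y y0].
  apply: lee_wpmul2r; first exact: sym_ge0.
  apply: le_trans (sym_le_avgop h y0); apply: le_sym_dist => //; [exact: Mk.1|exact: MK.1].
by apply: leeD; exact: H.
Qed.

Lemma avgop_below (a : R) y : (0 < (tau y : R))%R -> (tau y : R)%:E < a%:E ->
  avgop (EFin \o \1_(below a%:E)) y = 1.
Proof.
move=> y0 ya; have M1 := Mplus_indic R (mb a%:E); rewrite (avgopE tauP)//.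
rewrite (_ : \int[mu]_(x in _) _ = (tau y : R)%:E).
  by rewrite -EFinM mulVf// gt_eqF.
rewrite integral_indic; [|exact: mb|exact: mb].
rewrite setIidr; last by move=> z /= /lt_trans; apply.
by rewrite [LHS](measure_gauge_lt tauP)// lee_fin ltW.
Qed.

End averages.

(** * The optimal norm *)

Section optimal_norm.
Context d (T : measurableType d) (R : realType).
Variables (mu : {sigma_finite_measure set T -> \bar R}) (tau : T -> lline R).
Hypothesis tauP : is_gauge mu tau.
Local Notation sym := (sym mu tau).
Local Notation tailop := (tailop mu tau).
Local Notation avgop := (avgop mu tau).
Local Notation below t := [set x | (tau x : R)%:E < t].
Implicit Types (f g h : T -> \bar R).
Variable rho : (T -> \bar R) -> \bar R.
Hypothesis rhoP : is_ri_norm mu setT rho.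
Local Notation rho' := (associate mu setT rho).

(** The functional sigma of the theorem, expressed on the space itself. *)
Definition tail_norm f : \bar R := rho' (tailop (sym f)).

Let rho'P := associate_is_ri_norm tauP rhoP.
Let Ms f : Mplus setT (sym f) := sym_Mplus tauP f.
Let Mt f : Mplus setT (tailop (sym f)) := tailop_Mplus tauP (Ms f).
Let Ma f : Mplus setT (avgop (sym f)) := avgop_Mplus tauP (Ms f).

(** With [tail_norm_le] this describes [tail_norm f] as a supremum of the
    integrals of [sym f] against averages, by [hardy_duality]. *)
Lemma avgop_le_tail_norm h f : Mplus setT h -> rho h <= 1 ->
  \int[mu]_y (avgop (sym h) y * sym f y) <= tail_norm f.
Proof.
move=> Mh h1; rewrite -(hardy_duality tauP)//.
by apply: associate_ub => //; rewrite (ri_sym tauP rhoP).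
Qed.

Lemma tail_norm_le f c :
  (forall h, Mplus setT h -> rho h <= 1 ->
    \int[mu]_y (avgop (sym h) y * sym f y) <= c) -> tail_norm f <= c.
Proof.
move=> H; rewrite /tail_norm; apply: (associate_le_sym tauP (Mt f)) => h Mh h1.
apply: le_trans (H h Mh h1); rewrite -(hardy_duality tauP)//.
apply: (le_integral_gauge tauP); [exact: MplusM|exact: MplusM|move=> x x0].
apply: lee_wpmul2l; first exact: sym_ge0.
by apply: (sym_le_radial tauP) => // y xy; exact: tailop_nonincreasing.
Qed.

Lemma le_tail_norm f g : (forall x, sym f x <= sym g x) -> tail_norm f <= tail_norm g.
Proof.
move=> fg; rewrite /tail_norm; apply: (ri_mono rho'P (Mt f) (Mt g)) => x.
exact: le_tailop.
Qed.

Lemma tail_norm_cst0 : tail_norm (cst 0) = 0.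
Proof.
rewrite -[RHS](ri_zero rho'P) /tail_norm; congr rho'; apply/funext => x.
by rewrite /tailop; apply: integral0_eq => y _; rewrite (sym0 tauP) mule0.
Qed.

Lemma tail_normZ (l : R) f : (0 <= l)%R -> Mplus setT f ->
  tail_norm (fun x => l%:E * f x) = l%:E * tail_norm f.
Proof.
rewrite le_eqVlt => /predU1P[<- Mf|l0 Mf].
  rewrite mul0e -[RHS]tail_norm_cst0; congr tail_norm.
  by apply/funext => x; rewrite mul0e.
rewrite -(ri_homo rho'P) ?(ltW l0)//; congr rho'; apply/funext => x.
rewrite -(tailopZ tauP) ?(ltW l0)//; congr tailop.
by apply/funext => y; rewrite symZ.
Qed.

(** Local integrability is inherited from [rho']: the average of the indicator
    of [tau < a] is at least that indicator, so that the integral over a set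
    of measure [a] is dominated by an integral of [tailop (sym f)] over
    [tau < a]. *)
Lemma tail_norm_integral (E : set T) : measurable E -> mu E < +oo ->
  exists2 C : R, (0 < C)%R &
  forall f, Mplus setT f -> \int[mu]_(x in E) f x <= C%:E * tail_norm f.
Proof.
move=> mE Eoo; pose a := fine (mu E).
have aE : mu E = a%:E by rewrite fineK// ge0_fin_numE.
have mb : measurable (below a%:E) := measurable_gauge_lt tauP _.
have boo : mu (below a%:E) < +oo.
  by rewrite [ltLHS](measure_gauge_lt tauP) ?ltry// -aE.
have [C C0 HC] := ri_integral rho'P mb (@subsetT _ _) boo.
exists C => // f Mf; apply: le_trans (HC _ (Mt f)).
have M1 := Mplus_indic R mE; have Mb := Mplus_indic R mb.
rewrite -[leLHS]measurable_integral_indic// -[leRHS]measurable_integral_indic//.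
apply: le_trans (hardy_littlewood tauP M1 Mf) _.
rewrite (hardy_duality tauP Mb (Ms f)).
apply: (le_integral_gauge tauP);
  [exact: MplusM|by apply: MplusM => //; exact: avgop_Mplus|move=> y y0].
apply: lee_wpmul2r; first exact: sym_ge0.
apply: (@le_trans _ _ (\1_(below a%:E) y)%:E).
  by rewrite -aE; exact: (sym_indic_le tauP y mE (lexx _)).
rewrite indicE; have [ya|_] := boolP (y \in below a%:E).
  by rewrite avgop_below//; move: ya; rewrite inE.
by have [_] := avgop_Mplus tauP Mb; apply.
Qed.

(** The hypothesis supplies [ri_indic], and the triangle inequality is
    [avgop_symD]; the other axioms are inherited from [rho'] through the
    monotonicity of [sym] and [tailop]. *)
Lemma tail_norm_is_ri_norm :
  (forall E, measurable E -> mu E < +oo -> tail_norm (EFin \o \1_E) < +oo) ->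
  is_ri_norm mu setT tail_norm.
Proof.
move=> fin_indic; split.
- by move=> f _; exact: (ri_ge0 rho'P).
- move=> f Mf; split=> f0.
    apply: (ae_eq0_below tauP) => // N.
    have mE : measurable (below N%:R%:E) := measurable_gauge_lt tauP _.
    have Eoo : mu (below N%:R%:E) < +oo by rewrite [ltLHS](measure_gauge_lt tauP)// ltry.
    have [C _ HC] := tail_norm_integral mE Eoo.
    apply/eqP; rewrite eq_le; have := HC f Mf; rewrite f0 mule0 => ->.
    by apply: integral_ge0 => x _; exact: Mf.2.
  apply/eqP; rewrite eq_le -{1}tail_norm_cst0 (ri_ge0 rho'P)// andbT.
  have M0 : Mplus setT (cst 0 : T -> \bar R) by split=> [|y _] //; exact: measurable_cst.
  have f0' : {ae mu, forall y, setT y -> f y <= cst 0 y}.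
    by apply: filterS f0 => y /[apply] ->.
  by apply: le_tail_norm => x; exact: (le_sym tau x Mf M0 f0').
- by move=> f l Mf l0; exact: tail_normZ.
- move=> f g Mf Mg; apply: tail_norm_le => h Mh h1.
  apply: le_trans (avgop_symD tauP h Mf Mg) _.
  by apply: leeD; exact: avgop_le_tail_norm.
- move=> f g Mf Mg fg; apply: le_tail_norm => x; exact: (le_sym tau x Mf Mg fg).
- move=> f_ f Mf_ Mf ff.
  have symf t := rearr_ae_cvg measurableT Mf_ Mf ff t.
  have cv x : tailop (sym (f_ j)) x @[j --> \oo] --> tailop (sym f) x.
    by apply: (cvg_tailop tauP) => // y; under eq_fun do rewrite symE; rewrite ?symE;
      have [] := symf (tau y).
  have nd x : nondecreasing_seq (fun j => tailop (sym (f_ j)) x).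
    move=> i j ij; apply: le_tailop => // y _; rewrite !symE.
    by have [+ _] := symf (tau y); apply.
  exact: (ri_fatou rho'P (fun j => Mt (f_ j)) (Mt f)
    (aeW _ (fun x _ => conj (nd x) (cv x)))).
- by move=> E mE _ Eoo; exact: fin_indic.
- by move=> E mE _ Eoo; exact: tail_norm_integral.
- move=> f g Mf Mg fg; have [mf _] := Mf; have [mg _] := Mg.
  congr rho'; congr tailop; apply/funext => x.
  have D := eq_dist_rearr measurableT measurableT mf mg fg.
  by rewrite !symE; exact: eq_rearr_dist.
Qed.

(** Duality: [\int Mf * g] is estimated by averages of [sym f] against
    [sym g], the average is transposed onto [sym g], and Hoelder's inequality
    separates [rho f] from [tail_norm g]. *)
Lemma associate_tail_norm_bound (C : R) f Mf : (0 <= C)%R ->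
  Mplus setT f -> Mplus setT Mf -> rho f < +oo ->
  (forall x, (0 < (tau x : R))%R -> sym Mf x <= C%:E * avgop (sym f) x) ->
  associate mu setT tail_norm Mf <= C%:E * rho f.
Proof.
move=> C0 Pf PMf foo H; apply: ge_ereal_sup => _ [g [Mg g1] <-].
apply: le_trans (hardy_littlewood tauP Mg PMf) _.
have MC : Mplus setT (fun x => C%:E * (avgop (sym f) x * sym g x)).
  by apply: MplusZ => //; exact: MplusM.
apply: (@le_trans _ _ (\int[mu]_x (C%:E * (avgop (sym f) x * sym g x)))).
  apply: (le_integral_gauge tauP) => //; first exact: MplusM.
  move=> x x0; rewrite muleC muleA.
  by apply: lee_wpmul2r; [exact: sym_ge0|exact: H].
have [mfg fg0] := MplusM (Ma f) (Ms g).
rewrite ge0_integralZl_EFin//; apply: lee_wpmul2l; first by rewrite lee_fin.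
rewrite -(hardy_duality tauP)//.
have sf : rho (sym f) = rho f by exact: (ri_sym tauP rhoP).
apply: le_trans (hoelder rhoP (Ms f) (Mt g) _) _; first by rewrite sf.
rewrite sf -[leRHS]mule1; apply: lee_wpmul2l => //; exact: (ri_ge0 rhoP).
Qed.

(** A norm that controls the averages controls, by duality, [tail_norm]:
    Hoelder's inequality for [rhoZ] is applied to each integral that
    [tail_norm_le] asks for. *)
Lemma tail_norm_le_associate rhoZ (C : R) g : is_ri_norm mu setT rhoZ ->
  (0 < C)%R -> Mplus setT g ->
  (forall h, Mplus setT h -> rho h <= 1 -> rhoZ (avgop (sym h)) <= C%:E) ->
  tail_norm g <= C%:E * associate mu setT rhoZ g.
Proof.
move=> ZP C0 Mg H; apply: tail_norm_le => h Mh h1.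
have Z'P := associate_is_ri_norm tauP ZP.
apply: le_trans (hoelder ZP (Ma h) (Ms g) _) _.
  by apply: le_lt_trans (H h Mh h1) _; rewrite ltry.
rewrite (ri_sym tauP Z'P)//.
by apply: lee_wpmul2r; [exact: (ri_ge0 Z'P)|exact: H].
Qed.

(** Taking associates in [tail_norm_le_associate] reverses it; the theorem of
    Lorentz and Luxemburg brings [rhoZ] back. *)
Lemma optimal_embedding rhoZ (C : R) f : is_ri_norm mu setT rhoZ ->
  (0 < C)%R -> Mplus setT f ->
  (forall h, Mplus setT h -> rho h <= 1 -> rhoZ (avgop (sym h)) <= C%:E) ->
  rhoZ f <= C%:E * associate mu setT tail_norm f.
Proof.
move=> ZP C0 Pf H; apply: le_trans (lorentz_luxemburg tauP ZP Pf) _.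
apply: ge_ereal_sup => _ [g [Mg g1] <-].
have Ci0 : (0 <= C^-1)%R by rewrite invr_ge0 ltW.
have Mg' : Mplus setT (fun x => (C^-1)%:E * g x) by exact: MplusZ.
have g'1 : tail_norm (fun x => (C^-1)%:E * g x) <= 1.
  rewrite tail_normZ// lee_pdivrMl// mule1.
  apply: le_trans (tail_norm_le_associate ZP C0 Mg H) _.
  by rewrite -[leRHS]mule1; apply: lee_wpmul2l => //; rewrite lee_fin ltW.
have : \int[mu]_x ((C^-1)%:E * g x * f x) <= associate mu setT tail_norm f.
  exact: associate_ub.
rewrite [leLHS](eq_integral (fun x => (C^-1)%:E * (g x * f x))); last first.
  by move=> x _; rewrite -muleA.
have [mgf gf0] := MplusM Mg Pf.
by rewrite ge0_integralZl_EFin// lee_pdivrMl// muleC.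
Qed.

End optimal_norm.

(** * Vitali covering and weak type estimates *)

Section covering.
Context d (T : measurableType d) (R : realType).
Variables (mu : {measure set T -> \bar R}) (I : choiceType).
Variables (B B' : I -> set T) (l : I -> R) (K : R).
Hypothesis K0 : (0 <= K)%R.
Hypothesis mB : forall i, measurable (B i).
Hypothesis mB' : forall i, measurable (B' i).
Hypothesis BB' : forall i, B i `<=` B' i.
Hypothesis absorb : forall i j, (l j <= l i)%R -> B i `&` B j !=set0 -> B j `<=` B' i.

Let U (s : seq I) : set T := \bigcup_(i in [set` s]) B i.

Let mU s : measurable (U s).
Proof. by apply: fin_bigcup_measurable => // i _; exact: mB. Qed.

(** Vitali's selection: keep a largest set [B i], discard all the sets that
    meet it, since they lie in the enlargement [B' i], and continue with the
    remaining ones, which are disjoint from [B i]. *)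
Lemma vitali_covering (a : R) (f : T -> \bar R) (s : seq I) : (0 <= a)%R ->
  Mplus setT f ->
  (forall i, i \in s -> a%:E * mu (B' i) <= K%:E * \int[mu]_(x in B i) f x) ->
  a%:E * mu (U s) <= K%:E * \int[mu]_(x in U s) f x.
Proof.
move=> a0 [mf f0']; have f0 x : 0 <= f x by exact: f0'.
have [k] := ubnP (size s); elim: k s => // k IH s sk H.
have [->|[i0 i0s]] : s = [::] \/ exists i, i \in s.
- by case: s {sk H} => [|i s]; [left|right; exists i; rewrite mem_head].
- by rewrite /U (_ : [set` [::]] = set0) ?bigcup_set0 ?measure0 ?mule0 ?integral_set0 ?mule0//;
    apply/seteqP; split.
have [i is_ imax] : exists2 i, i \in s & forall j, j \in s -> (l j <= l i)%R.
  elim: s i0 i0s {sk H} => // i s IHs i0 _.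
  have [->|[j js]] : s = [::] \/ exists i, i \in s.
  - by case: s {IHs} => [|j s]; [left|right; exists j; rewrite mem_head].
  - by exists i; rewrite ?mem_head// => j; rewrite inE => /eqP ->.
  have [m ms mmax] := IHs j js; have [lim|/ltW lmi] := leP (l i) (l m).
    exists m; first by rewrite inE ms orbT.
    by move=> p; rewrite inE => /predU1P[->|/mmax].
  exists i; rewrite ?mem_head// => p; rewrite inE => /predU1P[-> //|/mmax pm].
  exact: le_trans lmi.
pose s1 := [seq j <- s | (j != i) && `[< B i `&` B j = set0 >]].
have s1s j : j \in s1 -> j \in s by rewrite mem_filter => /andP[].
have s1k : (size s1 < k)%N.
  rewrite ltnS in sk; apply: leq_trans sk; rewrite size_filter -(count_predC (predC1 i) s).
  rewrite -addn1 leq_add//; first by apply: sub_count => j /andP[].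
  by rewrite -has_count; apply/hasP; exists i => //=; rewrite negbK eqxx.
have Us : U s `<=` B' i `|` U s1.
  move=> x [j js Bx]; have [jE|ji] := eqVneq j i; first by left; apply: BB'; rewrite -jE.
  have [B0|/set0P meet_ij] := eqVneq (B i `&` B j) set0.
    by right; exists j => //=; rewrite mem_filter ji js andbT /=; exact/asboolP.
  by left; apply: absorb Bx => //; exact: imax.
have UsU : B i `|` U s1 `<=` U s.
  move=> x [Bx|[j /s1s js Bx]]; first by exists i.
  by exists j.
have fs (A : set T) : measurable_fun A f by exact: measurable_funS mf.
apply: (@le_trans _ _ (a%:E * (mu (B' i) + mu (U s1)))).
  apply: lee_wpmul2l; rewrite ?lee_fin//.
  apply: le_trans (measureU2 _ _ _) => //.
  by apply: le_measure; rewrite ?inE//; exact: measurableU.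
apply: (@le_trans _ _ (K%:E * \int[mu]_(x in B i `|` U s1) f x)); last first.
  apply: lee_wpmul2l; rewrite ?lee_fin//; apply: ge0_subset_integral => //.
  exact: measurableU.
rewrite ge0_muleDr ?measure_ge0// ge0_integral_setU//; last first.
  apply/disj_set2P/seteqP; split => // x [Bx [j]] /=.
  rewrite mem_filter => /andP[/andP[_ /asboolP meet_ij] _] Bjx.
  by have : (B i `&` B j) x by []; rewrite meet_ij.
rewrite ge0_muleDr ?integral_ge0//; apply: leeD; first exact: H.
by apply: IH => // j /s1s; exact: H.
Qed.

End covering.

Section countable_covering.
Context d (T : measurableType d) (R : realType).
Variables (mu : {measure set T -> \bar R}) (I : countType).
Variables (B B' : I -> set T) (l : I -> R) (K : R).
Hypothesis K0 : (0 <= K)%R.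
Hypothesis mB : forall i, measurable (B i).
Hypothesis mB' : forall i, measurable (B' i).
Hypothesis BB' : forall i, B i `<=` B' i.
Hypothesis absorb : forall i j, (l j <= l i)%R -> B i `&` B j !=set0 -> B j `<=` B' i.
Variable P : set I.

Let s k := [seq i <- pmap unpickle (iota 0 k) | `[< P i >]].
Let F k := \bigcup_(i in [set` s k]) B i.

Let mF k : measurable (F k).
Proof. by apply: fin_bigcup_measurable => // i _; exact: mB. Qed.

Let bigcupF : \bigcup_k F k = \bigcup_(i in P) B i.
Proof.
apply/seteqP; split => [x [k _ [i /=]]|x [i Pi Bx]].
  by rewrite mem_filter => /andP[/asboolP Pi _] Bx; exists i.
exists (pickle i).+1 => //; exists i => //=; rewrite mem_filter; apply/andP; split.
  exact/asboolP.
by rewrite mem_pmap -pickleK map_f// mem_iota/= add0n.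
Qed.

(** The constant of [vitali_covering] does not depend on the finite family. *)
Lemma countable_covering (a : R) (f : T -> \bar R) : (0 < a)%R ->
  Mplus setT f ->
  (forall i, P i -> a%:E * mu (B' i) <= K%:E * \int[mu]_(x in B i) f x) ->
  mu (\bigcup_(i in P) B i) <= (a^-1 * K)%:E * \int[mu]_x f x.
Proof.
move=> a0 Mf H; have cv : mu (F k) @[k --> \oo] --> mu (\bigcup_k F k).
  apply: nondecreasing_cvg_mu => //; first exact: bigcupT_measurable.
  move=> i j ij; apply/subsetPset => x [p /=]; rewrite mem_filter => /andP[Pp pi] Bx.
  exists p => //=; rewrite mem_filter Pp/=; move: pi; rewrite !mem_pmap.
  move=> /mapP[q qi ->]; apply: map_f; move: qi; rewrite !mem_iota !add0n.
  by move=> /= /leq_trans; apply.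
rewrite -bigcupF -(cvg_lim _ cv)//; apply: lime_le; first by apply/cvg_ex; eexists; exact: cv.
apply: nearW => k; rewrite EFinM -muleA -lee_pdivrMl ?invr_gt0// invrK.
have Hk i : i \in s k -> a%:E * mu (B' i) <= K%:E * \int[mu]_(x in B i) f x.
  by rewrite mem_filter => /andP[/asboolP Pi _]; exact: H.
apply: le_trans (vitali_covering K0 mB mB' BB' absorb (ltW a0) Mf Hk) _.
apply: lee_wpmul2l; rewrite ?lee_fin//; apply: ge0_subset_integral => //.
- exact: mF.
- exact: Mf.1.
- by move=> x _; exact: Mf.2.
Qed.

End countable_covering.

Section weak_type.
Context d (T : measurableType d) (R : realType).
Variables (mu : {sigma_finite_measure set T -> \bar R}) (tau : T -> lline R).
Hypothesis tauP : is_gauge mu tau.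
Local Notation sym := (sym mu tau).
Local Notation avgop := (avgop mu tau).
Local Notation below t := [set x | (tau x : R)%:E < t].

Lemma sym_le_average h x : (0 < (tau x : R))%R -> sym h x <= avgop (sym h) x.
Proof.
move=> x0; have Ms := sym_Mplus tauP h.
have mb : measurable (below (tau x : R)%:E) := measurable_gauge_lt tauP _.
rewrite (avgopE tauP)// -lee_pdivrMl ?invr_gt0// invrK.
rewrite -[X in X * _](measure_gauge_lt tauP) ?lee_fin ?(ltW x0)// muleC.
rewrite -[leLHS](integral_cst mu mb).
apply: ge0_le_integral; [exact: mb|by move=> y _; exact: sym_ge0|exact: measurable_cst|
  exact: measurable_funS Ms.1|].
by move=> z /=; rewrite lte_fin !symE => zx; exact/rearr_nonincreasing/ltW.
Qed.

Variables (Op : (T -> \bar R) -> T -> \bar R) (K : R).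
Hypothesis K0 : (0 <= K)%R.
Hypothesis Op_Mplus : forall f, Mplus setT f -> Mplus setT (Op f).
Hypothesis weak_type : forall f (l : R), Mplus setT f -> (0 < l)%R ->
  mu [set x | l%:E < Op f x] <= (l^-1 * K)%:E * \int[mu]_x f x.
Hypothesis Op_le_add : forall f g (c : R) x, Mplus setT f -> Mplus setT g ->
  (0 <= c)%R -> (forall y, f y <= g y + c%:E) -> Op f x <= Op g x + c%:E.

(** A weak type estimate implies the pointwise estimate of the rearrangement
    by averages. Cut [f] at the height [sym f x]: the lower part is bounded,
    while the upper part lives on a set of measure at most [tau x], so that its
    integral is at most [tau x] times the average of [sym f]. *)
Lemma sym_weak_type f x : Mplus setT f -> (0 < (tau x : R))%R ->
  sym (Op f) x <= (K + 1)%:E * avgop (sym f) x.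
Proof.
move=> Mf x0; have Ms := sym_Mplus tauP f; have Ma := avgop_Mplus tauP Ms.
have K1 : (0 < K + 1)%R by rewrite ltr_wpDl.
have [aoo|afin] := eqVneq (avgop (sym f) x) +oo.
  by rewrite aoo gt0_muley ?leey// lte_fin.
have {}afin : avgop (sym f) x \is a fin_num.
  by rewrite ge0_fin_numE ?ltey//; exact: Ma.2.
have ca := sym_le_average f x0; have c0 := sym_ge0 mu tau f x.
have cfin : sym f x \is a fin_num.
  by rewrite ge0_fin_numE//; apply: le_lt_trans ca _; rewrite ltey_eq afin.
pose c := fine (sym f x); have cE : sym f x = c%:E by rewrite fineK.
have {}c0 : (0 <= c)%R by rewrite fine_ge0.
pose E := [set y | c%:E < f y].
have mE : measurable E.
  by rewrite -[E]setTI; apply: emeasurable_fun_o_infty => //; exact: Mf.1.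
have Ex : mu E <= (tau x : R)%:E.
  by rewrite -dist_Mplus// -rearr_le//; [rewrite -symE cE|exact: Mf.1].
pose f0 := fun y => (\1_E y)%:E * f y.
have Mf0 : Mplus setT f0 by apply: MplusM => //; exact: Mplus_indic.
have ff0 y : f y <= f0 y + c%:E.
  rewrite /f0 indicE; have [|yE] := boolP (y \in E); rewrite ?mul1e ?mul0e.
    by rewrite leeDl ?lee_fin.
  by rewrite add0e leNgt; apply: contra yE => cf; rewrite inE.
have If0 : \int[mu]_y f0 y <= (tau x : R)%:E * avgop (sym f) x.
  apply: le_trans (hardy_littlewood tauP (Mplus_indic R mE) Mf) _.
  rewrite (avgopE tauP)// muleA -EFinM mulfV ?gt_eqF// mul1e.
  have mb : measurable (below (tau x : R)%:E) := measurable_gauge_lt tauP _.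
  rewrite -[leRHS]measurable_integral_indic//.
  apply: le_integral_Mplus.
  - by apply: MplusM => //; exact: sym_Mplus.
  - by apply: MplusM => //; exact: Mplus_indic.
  move=> y; apply: lee_wpmul2r; first exact: sym_ge0.
  exact: (sym_indic_le tauP y mE Ex).
move: (avgop (sym f) x) afin ca If0 => av /fineK <-; set a := fine av.
rewrite cE lee_fin -EFinM => ca If0.
have a0 : (0 <= a)%R := le_trans c0 ca.
apply/lee_addgt0Pr => e e0; rewrite symE -EFinM -EFinD rearr_le; last 2 first.
- by have [] := Op_Mplus Mf.
- by rewrite addr_ge0 ?mulr_ge0// ltW.
rewrite dist_Mplus; last exact: Op_Mplus.
have Kae : (0 < K * a + e)%R by rewrite ltr_wpDl// mulr_ge0.
have mOp g u : Mplus setT g -> measurable [set y | u < Op g y].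
  move=> /Op_Mplus[mg _]; rewrite -[X in measurable X]setTI.
  exact: emeasurable_fun_o_infty.
apply: (@le_trans _ _ (mu [set y | (K * a + e)%:E < Op f0 y])).
  apply: le_measure; rewrite ?inE; [exact: mOp|exact: mOp|].
  move=> y /=; have := Op_le_add y Mf Mf0 c0 ff0.
  rewrite -[_ < Op f0 y](lteD2rE _ _ (isT : c%:E \is a fin_num)).
  move=> H1 H2; apply: lt_le_trans H1; apply: le_lt_trans H2.
  by rewrite -EFinD lee_fin; lra.
apply: le_trans (weak_type Mf0 Kae) _.
apply: (@le_trans _ _ ((((K * a + e)^-1 * K)%:E * ((tau x : R) * a)%:E))).
  by apply: lee_wpmul2l => //; rewrite lee_fin mulr_ge0// invr_ge0 ltW.
rewrite -EFinM lee_fin -mulrA ler_pdivrMl//.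
by rewrite mulrCA [leRHS]mulrC ler_pM2l// lerDl ltW.
exact: measurableT.
Qed.

End weak_type.

(** * The Hardy-Littlewood maximal operator *)

Section maximal_operator.
Context {R : realType} {n : nat}.
Local Notation En := (euclid R n).
Local Notation mu := (@lebesgue_euclid R n).
Local Notation avgop := (@avgop _ En R mu cube_gauge).
Implicit Types (f g : En -> \bar R) (a x : 'rV[R]_n.+1) (l : R).

Lemma cube_gaugeP : is_gauge mu (cube_gauge : En -> lline R).
Proof.
split.
- exact: cube_gauge_ge0.
- exact: measurable_cube_gauge.
- exact: measure_cube_gauge0.
- exact: measure_cube_gauge.
Qed.

Lemma measurable_cube a l : measurable (cube a l : set En).
Proof. exact: measurable_box. Qed.

Lemma fine_cube a l : (0 < l)%R -> fine (mu (cube a l)) = (l ^+ n.+1)%R.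
Proof. by move=> l0; rewrite (lebesgue_euclid_cube _ (ltW l0)). Qed.

Lemma mem_cube a l x : (cube a l : set En) x <->
  forall i, (a ord0 i <= x ord0 i <= a ord0 i + l)%R.
Proof.
by split => H i; have := H i; rewrite !mxE.
Qed.

Lemma average_le_maximal f a l (x : En) : (0 < l)%R -> cube a l x ->
  ((l ^+ n.+1)^-1)%:E * \int[mu]_(y in cube a l) `|f y| <= maximal f x.
Proof.
move=> l0 Qx; apply: ereal_sup_ubound; exists (cube a l).
  by split; [exact: Qx|exists a, l].
by rewrite fine_cube.
Qed.

Lemma maximal_le f (x : En) c :
  (forall a l, (0 < l)%R -> cube a l x ->
    ((l ^+ n.+1)^-1)%:E * \int[mu]_(y in cube a l) `|f y| <= c) ->
  maximal f x <= c.
Proof.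
move=> H; apply: ge_ereal_sup => _ [Q [Qx [a [l [l0 QE]]]] <-]; move: Qx; rewrite QE.
by move=> Qx; rewrite fine_cube//; exact: H.
Qed.

Lemma maximal_ge0 f x : 0 <= maximal f x.
Proof.
have Qx : (cube x 1 : set En) x by apply/mem_cube => i; rewrite lexx lerDl ler01.
apply: le_trans (average_le_maximal f ltr01 Qx); rewrite mule_ge0//.
by apply: integral_ge0 => y _; exact: abse_ge0.
Qed.

(** Countably many cubes suffice for the level sets of the maximal function. *)
Let qcube (p : 'rV[rat]_n.+1 * rat) : set En := cube (map_mx ratr p.1) (ratr p.2).

Let level_cubes f (t : R) : set ('rV[rat]_n.+1 * rat) :=
  [set p : 'rV[rat]_n.+1 * rat | (0 < p.2)%R /\ t%:E * ((ratr p.2 : R) ^+ n.+1)%:E <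
                      \int[mu]_(y in qcube p) `|f y|].

(** The room left by the strict inequality absorbs the growth of the volume
    when the side of a cube is replaced by a slightly larger rational number. *)
Lemma enlarge_side f a l (t : R) (v : \bar R) : (0 <= t)%R -> (0 < l)%R ->
  t%:E * (l ^+ n.+1)%:E < v ->
  exists2 q : rat, (l < ratr q)%R & t%:E * ((ratr q : R) ^+ n.+1)%:E < v.
Proof.
move=> t0 l0 tv.
have [c lc H] : exists2 c : R, (l ^+ n.+1 < c)%R &
    forall u : R, (u < c)%R -> t%:E * u%:E < v.
  case: v tv => [v|_|] //.
  - rewrite -EFinM lte_fin => tv.
    move: t0; rewrite le_eqVlt => /predU1P[t0|t0].
      exists (l ^+ n.+1 + 1)%R; first by rewrite ltrDl.
      by move=> u _; rewrite -t0 mul0e lte_fin; move: tv; rewrite -t0 mul0r.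
    exists (v / t)%R; first by rewrite ltr_pdivlMr// mulrC.
    by move=> u; rewrite ltr_pdivlMr// -EFinM lte_fin mulrC.
  - by exists (l ^+ n.+1 + 1)%R => [|u _]; rewrite ?ltrDl// -EFinM ltry.
have c0 : (0 < c)%R by apply: lt_trans lc; rewrite exprn_gt0.
have lr : (l < @root R n c)%R.
  by rewrite -(@ltr_pXn2r _ n.+1)// ?nnegrE ?root_ge0 ?(ltW l0)// rootK// ltW.
have [q /andP[lq qr]] := rat_in_itvoo lr.
exists q => //; apply: H; rewrite -(@rootK R n c) ?ltW//.
by rewrite ltr_pXn2r// ?nnegrE ?root_ge0// (le_trans (ltW l0))// ltW.
Qed.

Lemma maximal_level f (t : R) : measurable_fun setT f -> (0 <= t)%R ->
  [set x | t%:E < maximal f x] = \bigcup_(p in level_cubes f t) qcube p.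
Proof.
move=> mf t0; apply/seteqP; split => x /=.
  move=> /ereal_sup_gt[_ [Q [Qx [a [l [l0 QE]]]] <-]]; move: Qx; rewrite QE => Qx.
  rewrite fine_cube// -[X in _ * X]/(\int[mu]_(y in cube a l) `|f y|) => tI.
  have ln0 : (0 < l ^+ n.+1)%R by rewrite exprn_gt0.
  have {}tI : t%:E * (l ^+ n.+1)%:E < \int[mu]_(y in cube a l) `|f y|.
    by rewrite muleC -lte_pdivlMl.
  have [q lq tq] := enlarge_side f a t0 l0 tI.
  have /choice [b ba] : forall i : 'I_n.+1, exists b : rat,
      (a ord0 i - (ratr q - l) < ratr b < a ord0 i)%R.
    move=> i; have : (a ord0 i - (ratr q - l) < a ord0 i)%R.
      by rewrite ltrBlDr ltrDl subr_gt0.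
    by move=> /rat_in_itvoo[b]; rewrite in_itv/=; exists b.
  have sub : cube a l `<=` qcube (\row_i b i, q).
    move=> y /mem_cube ay; apply/mem_cube => i; rewrite !mxE /=.
    by have := ay i; have := ba i => /andP[? ?] /andP[? ?]; apply/andP; split; lra.
  exists (\row_i b i, q); last exact: sub.
  split => /=; first by rewrite -(ltr0q R) (lt_trans l0).
  apply: lt_le_trans tq _; apply: ge0_subset_integral; [exact: measurable_cube|
    exact: measurable_cube| |by move=> y _; exact: abse_ge0|exact: sub].
  by apply: measurableT_comp => //; exact: measurable_funS mf.
move=> [[b q] [/= q0 tq] Qx].
have q0' : (0 < (ratr q : R))%R by rewrite ltr0q.
apply: lt_le_trans (average_le_maximal f q0' Qx).
by rewrite lte_pdivlMl ?exprn_gt0// muleC.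
Qed.

Lemma measurable_abse_fun f (D : set En) : measurable_fun setT f ->
  measurable_fun D (fun y => `|f y|).
Proof. by move=> mf; apply: measurableT_comp => //; exact: measurable_funS mf. Qed.

(** The cube with the same centre as [cube a l] and three times its side. *)
Let triple a l : set En := cube (a - const_mx l)%R (3 * l)%R.

Lemma cube_sub_triple a b l k : (0 < k)%R -> (k <= l)%R ->
  (cube a l : set En) `&` cube b k !=set0 -> (cube b k : set En) `<=` triple a l.
Proof.
move=> k0 kl [x [/mem_cube ax /mem_cube bx]] y /mem_cube by_; apply/mem_cube => i.
rewrite !mxE; have := ax i; have := bx i; have := by_ i.
by move=> /andP[? ?] /andP[? ?] /andP[? ?]; apply/andP; split; lra.
Qed.

Lemma maximal_Mplus f : measurable_fun setT f -> Mplus setT (maximal f).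
Proof.
move=> mf; split; last by move=> x _; exact: maximal_ge0.
apply: (measurability _ (@ErealGenOInfty.measurableE R)) => _ [_ [t ->] <-].
rewrite setTI; have [t0|t0] := leP 0%R t; last first.
  rewrite (_ : _ @^-1` _ = setT); first exact: measurableT.
  apply/seteqP; split => // x _ /=; rewrite in_itv/= andbT.
  by apply: lt_le_trans (maximal_ge0 f x); rewrite lte_fin.
rewrite (_ : _ @^-1` _ = [set x | t%:E < maximal f x]); last first.
  by apply/seteqP; split => x /=; rewrite in_itv/= andbT.
rewrite (maximal_level mf t0) bigcup_mkcond.
apply: countable_bigcupT_measurable; first exact: countableP.
by move=> p; case: ifP => _; [exact: measurable_cube|exact: measurable0].
Qed.

Lemma maximal_weak_type f (t : R) : Mplus setT f -> (0 < t)%R ->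
  mu [set x | t%:E < maximal f x] <= (t^-1 * 3 ^+ n.+1)%:E * \int[mu]_x f x.
Proof.
move=> Mf t0; have [mf f0] := Mf; rewrite (maximal_level mf (ltW t0)).
pose L := level_cubes f t.
pose B (p : 'rV[rat]_n.+1 * rat) := if (0 < p.2)%R then qcube p else set0.
pose B' (p : 'rV[rat]_n.+1 * rat) :=
  if (0 < p.2)%R then triple (map_mx ratr p.1) (ratr p.2) else set0.
have LB : \bigcup_(p in L) qcube p = \bigcup_(p in L) B p.
  by apply: eq_bigcupr => p [p0 _]; rewrite /B p0.
rewrite LB.
have mq p : measurable (qcube p) by exact: measurable_cube.
have mB p : measurable (B p).
  by rewrite /B; case: ifP => _; [exact: mq|exact: measurable0].
have mB' p : measurable (B' p).
  by rewrite /B'; case: ifP => _; [exact: measurable_cube|exact: measurable0].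
have BB' p : B p `<=` B' p.
  rewrite /B /B'; case: ifP => p0; last exact: subset_refl.
  have p0' : (0 < (ratr p.2 : R))%R by rewrite ltr0q.
  apply: (cube_sub_triple p0' (lexx _)); exists (map_mx ratr p.1).
  by split; apply/mem_cube => i; rewrite lexx lerDl (ltW p0').
have absorb p q : (ratr q.2 <= ratr p.2 :> R)%R -> B p `&` B q !=set0 -> B q `<=` B' p.
  rewrite /B /B' => qp; case: ifP => p0; last by rewrite set0I => -[].
  case: ifP => q0; last by rewrite setI0 => -[].
  have q0' : (0 < (ratr q.2 : R))%R by rewrite ltr0q.
  exact: (cube_sub_triple q0' qp).
have H p : L p -> t%:E * mu (B' p) <= (3 ^+ n.+1)%:E * \int[mu]_(x in B p) f x.
  move=> [p0 tp]; rewrite /B' /B p0 lebesgue_euclid_cube; last first.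
    by rewrite mulr_ge0// ler0q ltW.
  rewrite exprMn EFinM muleCA; apply: lee_wpmul2l; first by rewrite lee_fin exprn_ge0.
  apply: le_trans (ltW tp) _; apply: ge0_le_integral.
  + exact: mq.
  + by move=> x _; exact: abse_ge0.
  + exact: measurable_abse_fun.
  + exact: measurable_funS mf.
  + by move=> x _; rewrite gee0_abs ?lexx// f0.
have K0 : (0 <= 3 ^+ n.+1 :> R)%R by rewrite exprn_ge0.
exact: (@countable_covering _ _ R mu ('rV[rat]_n.+1 * rat)%type B B'
  (fun p => ratr p.2 : R) (3 ^+ n.+1)%R K0 mB mB' BB' absorb L t f t0 Mf H).
Qed.

(** Averages of a constant are that constant. *)
Lemma maximal_le_add f g (c : R) (x : En) : Mplus setT f -> Mplus setT g ->
  (0 <= c)%R -> (forall y, f y <= g y + c%:E) ->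
  maximal f x <= maximal g x + c%:E.
Proof.
move=> [mf f0] [mg g0] c0 fg; apply: maximal_le => a l l0 Qx.
have mQ : measurable (cube a l : set En) := measurable_cube a l.
apply: le_trans (leeD (average_le_maximal g l0 Qx) (lexx _)).
have ln0 : (0 < l ^+ n.+1)%R by rewrite exprn_gt0.
rewrite lee_pdivrMl// ge0_muleDr; [|by rewrite mule_ge0 ?lee_fin ?invr_ge0 ?(ltW ln0)//
  integral_ge0|by rewrite lee_fin].
rewrite muleA -EFinM mulfV ?gt_eqF// mul1e.
have -> : (l ^+ n.+1)%:E * c%:E = \int[mu]_(y in cube a l) c%:E.
  rewrite [RHS](integral_cst mu mQ) muleC; congr (_ * _).
  by rewrite [RHS](lebesgue_euclid_cube _ (ltW l0)).
rewrite -ge0_integralD; [|exact: mQ|by move=> y _; exact: abse_ge0|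
  exact: measurable_abse_fun|by move=> y _; rewrite lee_fin|exact: measurable_cst].
apply: ge0_le_integral.
- exact: mQ.
- by move=> y _; exact: abse_ge0.
- exact: measurable_abse_fun.
- apply: emeasurable_funD; [exact: measurable_abse_fun|exact: measurable_cst].
- by move=> y _; rewrite !gee0_abs ?f0 ?g0.
Qed.

Lemma sym_maximal_le f x : Mplus setT f -> (0 < (cube_gauge (x : En) : R))%R ->
  sym mu cube_gauge (maximal f) x <=
  (3 ^+ n.+1 + 1)%:E * avgop (sym mu cube_gauge f) x.
Proof.
move=> Mf x0; apply: (sym_weak_type cube_gaugeP) x0; first by rewrite exprn_ge0.
- by move=> g [mg _]; exact: maximal_Mplus.
- exact: maximal_weak_type.
- exact: maximal_le_add.
- exact: Mf.
Qed.

(** The set [tau <= tau x] is a cube that contains [x]. *)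
Lemma avgop_le_maximal f x : avgop (sym mu cube_gauge f) x <=
  maximal (sym mu cube_gauge f) x.
Proof.
have := cube_gauge_ge0 x; rewrite le_eqVlt => /predU1P[x0|x0].
  have -> : avgop (sym mu cube_gauge f) x = 0 by apply: avgop_origin; rewrite -x0.
  exact: maximal_ge0.
pose r := (2 * supnorm x)%R; have r0 : (0 < r)%R.
  rewrite lt_neqAle mulr_ge0 ?supnorm_ge0// andbT; apply: contraTneq x0 => r0.
  by rewrite /cube_gauge -/r -r0 expr0n ltxx.
have Q := @cube_gauge_le_cube R n r (ltW r0).
have Ms := sym_Mplus cube_gaugeP f.
rewrite (avgopE cube_gaugeP Ms x0).
have Qx : cube (const_mx (- (r / 2))%R) r x by rewrite -Q; exact: lexx.
apply: le_trans (average_le_maximal (sym mu cube_gauge f) r0 Qx).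
apply: lee_wpmul2l; first by rewrite lee_fin invr_ge0 ltW.
rewrite [leRHS](eq_integral (sym mu cube_gauge f)); last first.
  by move=> y _; rewrite gee0_abs ?sym_ge0.
apply: ge0_subset_integral.
- exact: measurable_gauge_lt cube_gaugeP _.
- exact: measurable_cube.
- exact: measurable_funS Ms.1.
- by move=> y _; exact: sym_ge0.
- by rewrite -Q => y /= /ltW; rewrite lee_fin.
Qed.

Lemma maximal_abs f : maximal (fun x => `|f x|) = maximal f.
Proof.
apply/funext => x; congr ereal_sup; apply/seteqP; split => _ [Q HQ <-]; exists Q => //;
  by congr (_ * _); apply: eq_integral => y _; rewrite abse_id.
Qed.

End maximal_operator.

(** * Tail averages of indicators *)

Section logarithm.
Context {R : realType}.
Local Notation lam := (@completed_lebesgue_measure R).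
Local Notation half := (half_line R).

Lemma integral_lline (D : set R) (f : R -> \bar R) :
  measurable (D : set (measurableTypeR R)) ->
  measurable_fun (D : set (measurableTypeR R)) f -> (forall s, D s -> 0 <= f s) ->
  \int[lam]_(s in (D : set (lline R))) f s = \int[@lebesgue_measure R]_(s in D) f s.
Proof.
move=> mD mf f0.
pose line : lline R -> measurableTypeR R := idfun.
have mline : measurable_fun setT line := @measurable_idfun_lline R.
rewrite -(@eq_measure_integral _ _ _ _ (@lebesgue_measure R)
  (measure_function_pushforward__canonical__measure_function_Measure lam mline)); last first.
  by move=> A mA _; rewrite /= /pushforward completed_lebesgueE.
by rewrite (ge0_integral_pushforward mline)// => s; rewrite inE => /f0.
Qed.

Lemma integral_inv (t a : R) : (0 < t)%R -> (t < a)%R ->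
  \int[@lebesgue_measure R]_(s in (`[t, a]%classic : set R)) (s^-1)%:E = (ln (a / t))%:E.
Proof.
move=> t0 ta; have a0 := lt_trans t0 ta.
have cinv : {within `[t, a], continuous (fun s : R => s^-1)%R}.
  apply: continuous_in_subspaceT => s /set_mem /=; rewrite in_itv/= => /andP[ts _].
  by apply: inv_continuous; rewrite gt_eqF// (lt_le_trans t0).
rewrite (@continuous_FTC2 R _ (@ln R))//.
- by rewrite ln_div// EFinB.
- split.
  + by move=> s; rewrite in_itv/= => /andP[ts _]; have := is_derive1_ln (lt_trans t0 ts); case.
  + exact/cvg_at_right_filter/continuous_ln.
  + exact/cvg_at_left_filter/continuous_ln.
- move=> s; rewrite in_itv/= => /andP[ts _].
  by rewrite derive1E; have := is_derive1_ln (lt_trans t0 ts); case.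
Qed.

Lemma measurable_inv_itv (t a : R) : (0 < t)%R ->
  measurable_fun (`]t, a[%classic : set R) (fun s : R => (s^-1)%:E).
Proof.
move=> t0; apply/measurable_EFinP; apply: subspace_continuous_measurable_fun => //.
apply: continuous_in_subspaceT => s /set_mem /=; rewrite in_itv/= => /andP[ts _].
by apply: inv_continuous; rewrite gt_eqF// (lt_trans t0).
Qed.

End logarithm.

Section tail_of_indicator.
Context d (T : measurableType d) (R : realType) (mu : {measure set T -> \bar R}).

Lemma rearr_indic (E : set T) (a s : R) : measurable E -> mu E = a%:E -> (0 <= s)%R ->
  rearr mu setT (EFin \o \1_E) s = ((s < a)%R%:R)%:E.
Proof.
move=> mE Ea s0; have M1 := Mplus_indic R mE; have [m1 _] := M1.
have levelE (l : R) : (0 <= l)%R -> (l < 1)%R ->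
    [set x | l%:E < (EFin \o \1_E : T -> \bar R) x] = E.
  move=> l0 l1; apply/seteqP; split => x /=; rewrite lte_fin indicE.
    by have [|_] := boolP (x \in E); [rewrite inE|rewrite ltNge l0].
  by move=> Ex; rewrite mem_set.
have [sa|sa] := ltP s a; last first.
  by apply/eqP; rewrite eq_le rearr_ge0 andbT rearr_le// dist_Mplus// levelE// Ea lee_fin.
apply/eqP; rewrite eq_le; apply/andP; split.
  rewrite rearr_le// dist_Mplus// (_ : [set _ | _] = set0) ?measure0 ?lee_fin//.
  apply/seteqP; split => // x /=; rewrite lte_fin ltNge indicE => /negP; apply.
  by case: (x \in E).
apply: le_ereal_inf_tmp => _ [l [l0 H] <-]; rewrite lee_fin leNgt; apply/negP => l1.
move: H; rewrite -distE dist_Mplus// levelE ?(ltW l0)// Ea.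
by rewrite lee_fin leNgt sa.
Qed.

(** The rearranged indicator is the indicator of an interval of length [a], and
    the integral of [1 / s] from [t] to [a] is [ln (a / t)]. *)
Lemma tail_average_indic (E : set T) (a t : R) : measurable E -> mu E = a%:E ->
  (0 < t)%R ->
  tail_average (rearr mu setT (EFin \o \1_E)) t = (Num.max 0 (ln (a / t)))%:E.
Proof.
move=> mE Ea t0; have a0 : (0 <= a)%R by rewrite -lee_fin -Ea.
rewrite /tail_average (_ : \int[_]_(s in _) _ =
    \int[@completed_lebesgue_measure R]_(s in (`]t, a[%classic : set R)) (s^-1)%:E);
    last first.
  rewrite integral_mkcond [RHS]integral_mkcond; apply: eq_integral => s _.
  rewrite !patchE !mem_setE !in_itv/= andbT.
  have [ts|//] := ltP t s; have s0 := lt_trans t0 ts.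
  by rewrite (rearr_indic mE Ea (ltW s0)); case: ltP => _; rewrite ?mul1e ?mul0e.
have [ta|at_] := ltP t a; last first.
  rewrite set_itv_ge ?integral_set0; last by rewrite bnd_simp -leNgt.
  by rewrite max_l// ln_le0// ler_pdivrMr// mul1r.
rewrite (@integral_lline R _ (fun s => (s^-1)%:E)); last 3 first.
- exact: measurable_itv.
- exact: measurable_inv_itv.
- by move=> s /=; rewrite in_itv/= => /andP[ts _]; rewrite lee_fin invr_ge0 ltW// (lt_trans t0).
rewrite -(@integral_itv_bndoo R t a (fun s => (s^-1)%:E) true false); last first.
  exact: measurable_inv_itv.
rewrite integral_inv// max_r// ln_ge0// ler_pdivlMr// mul1r ltW//.
Qed.
End tail_of_indicator.

(** * The function psi and the functional sigma *)

Section psi_norm.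
Context {R : realType}.
Local Notation lam := (@completed_lebesgue_measure R).
Local Notation half := (half_line R).

Lemma psiE (t : R) : (0 < t)%R -> psi R t = (Num.max 0 (ln (1 / t)))%:E.
Proof.
move=> t0; rewrite /psi indicE mem_setE in_itv/= t0/= div1r lnV ?posrE//.
have [t1|t1] := ltP t 1%R; rewrite ?mul1r ?mul0r; congr EFin.
  by rewrite max_r// oppr_ge0 ln_le0// ltW.
by rewrite max_l// oppr_le0 ln_ge0.
Qed.

Lemma psi_Mplus : Mplus half (psi R).
Proof.
split; last by move=> t; rewrite half_lineE => t0; rewrite psiE// lee_fin le_max lexx.
apply: measurable_nonincreasing; first exact: interval_is_interval.
move=> s t; rewrite !half_lineE => s0 t0 st; rewrite !psiE// lee_fin.
rewrite ge_max le_max lexx/= le_max; apply/orP; right.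
by rewrite ler_ln ?posrE ?divr_gt0// ler_pM2l// lef_pV2.
Qed.

(** Reduces sets of arbitrary finite measure to the case of measure 1, in
    which the tail average is [psi]. *)
Lemma ln_ratio_le (a t : R) : (0 <= a)%R -> (0 < t)%R ->
  (Num.max 0 (ln (a / t)) <=
   Num.max 0 (ln (1 / t)) + `|ln a| * \1_(`]0%R, a[%classic : set R) t)%R.
Proof.
move=> a0 t0; have m0 : (0 <= Num.max 0 (ln (1 / t)))%R by rewrite le_max lexx.
rewrite indicE mem_setE in_itv/= t0/=; have [ta|at_] := ltP t a; last first.
  by rewrite mulr0 addr0 max_l// ln_le0// ler_pdivrMr// mul1r.
have {}a0 := lt_trans t0 ta; rewrite mulr1 ge_max addr_ge0//=.
rewrite ln_div ?posrE// div1r lnV ?posrE// addrC lerD//; last exact: ler_norm.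
by rewrite le_max lexx orbT.
Qed.

Lemma tail_average_Mplus d (T : measurableType d) (mu : {measure set T -> \bar R}) f :
  Mplus half (tail_average (rearr mu setT f)).
Proof.
have h0 (t s : R) : (0 < t)%R -> (`]t, +oo[%classic : set R) s ->
    0 <= rearr mu setT f s * (s^-1)%:E.
  move=> t0 /=; rewrite in_itv/= andbT => ts; rewrite mule_ge0 ?rearr_ge0//.
  by rewrite lee_fin invr_ge0 ltW// (lt_trans t0).
split; last by move=> t; rewrite half_lineE => t0; apply: integral_ge0 => s; exact: h0.
apply: measurable_nonincreasing; first exact: interval_is_interval.
move=> s t; rewrite !half_lineE => s0 t0 st; apply: ge0_subset_integral.
- by apply: measurable_lline_borel; exact: measurable_itv.
- by apply: measurable_lline_borel; exact: measurable_itv.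
- apply: emeasurable_funM.
    by apply: measurable_rearr; apply: measurable_lline_borel; exact: measurable_itv.
  apply: measurable_nonincreasing; first exact: interval_is_interval.
  move=> u v /=; rewrite !in_itv/= !andbT => su sv uv.
  by rewrite lee_fin lef_pV2// posrE (lt_trans s0).
- by move=> u; exact: h0.
- by move=> u /=; rewrite !in_itv/= !andbT; exact: le_lt_trans.
Qed.

Variable r : (lline R -> \bar R) -> \bar R.
Hypothesis rP : is_ri_norm lam half r.

Lemma tail_average_indic_lty d (T : measurableType d) (mu : {measure set T -> \bar R})
  (E : set T) : r (psi R) < +oo -> measurable E -> mu E < +oo ->
  r (tail_average (rearr mu setT (EFin \o \1_E))) < +oo.
Proof.
move=> psioo mE Eoo; pose a := fine (mu E).
have Ea : mu E = a%:E by rewrite fineK// ge0_fin_numE.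
have a0 : (0 <= a)%R by rewrite fine_ge0.
pose I : set (lline R) := (`]0%R, a[%classic : set R).
have mI : measurable I by apply: measurable_lline_borel; exact: measurable_itv.
have Ih : I `<=` half by move=> t; rewrite half_lineE /I/= in_itv/= => /andP[].
pose one : lline R -> \bar R := EFin \o \1_I.
have MI : Mplus half one.
  by split => [|t _]; [exact/measurable_EFinP/measurable_indic|rewrite lee_fin].
have MaI : Mplus half (fun t => `|ln a|%:E * one t).
  split => [|t ht]; last by rewrite mule_ge0 ?lee_fin//.
  by apply: emeasurable_funM => //; exact: MI.1.
apply: (@le_lt_trans _ _ (r (fun t => psi R t + `|ln a|%:E * one t))).
  apply: (ri_le rP).
  - exact: tail_average_Mplus.
  - split; first by apply: emeasurable_funD; [exact: psi_Mplus.1|exact: MaI.1].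
    by move=> t ht; rewrite adde_ge0//; [exact: psi_Mplus.2|exact: MaI.2].
  apply: aeW => t; rewrite half_lineE => t0.
  by rewrite (tail_average_indic mE Ea t0) psiE// -EFinM -EFinD lee_fin ln_ratio_le.
apply: le_lt_trans (ri_triangle rP psi_Mplus MaI) _.
rewrite lte_add_pinfty// (ri_homo rP MI)// lte_mul_pinfty ?lee_fin//.
apply: (ri_indic rP mI Ih); rewrite [ltLHS]completed_lebesgueE.
by rewrite lebesgue_measure_itv/=; case: ifP => _; rewrite ?ltry// -EFinB ltry.
Qed.

End psi_norm.

Section sigma_norm.
Context d (T : measurableType d) (R : realType).
Variables (mu : {sigma_finite_measure set T -> \bar R}) (tau : T -> lline R).
Hypothesis tauP : is_gauge mu tau.
Local Notation lam := (@completed_lebesgue_measure R).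
Local Notation half := (half_line R).
Local Notation sym := (sym mu tau).
Local Notation tailop := (tailop mu tau).

Lemma tail_averageE f x : (0 < (tau x : R))%R ->
  tail_average (rearr mu setT f) (tau x) = tailop (sym f) x.
Proof.
move=> x0; pose E : set (lline R) := (`](tau x : R), +oo[%classic : set R).
have mE : measurable E by apply: measurable_lline_borel; exact: measurable_itv.
have EE (t : R) : E t = (tau x < t)%R by rewrite /E/= in_itv/= andbT.
have Eh : E `<=` half by move=> t; rewrite EE half_lineE; exact: lt_trans.
have Mh : Mplus half (fun s => rearr mu setT f s * (s^-1)%:E).
  split=> [|t].
    apply: emeasurable_funM; first exact/measurable_rearr/measurable_half_line.
    apply: measurable_nonincreasing; first exact: interval_is_interval.
    by move=> u v; rewrite !half_lineE => u0 v0 uv; rewrite lee_fin lef_pV2.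
  rewrite half_lineE => t0; rewrite mule_ge0 ?rearr_ge0//.
  by rewrite lee_fin invr_ge0 ltW.
rewrite /tail_average (integral_pull_setI tauP mE Eh Mh) integral_mkcond.
have yE y : (y \in tau @^-1` E) = (tau x < tau y)%R.
  by apply/idP/idP; rewrite inE /preimage/= EE.
apply: eq_integral => y _; rewrite patchE yE /hardy_kernel.
have [xy|_] := boolP (tau x < tau y)%R; last by rewrite !mul0r mul0e.
by rewrite (pullE _ (lt_trans x0 xy)) mul1r muleC symE.
Qed.

Variable rho : (T -> \bar R) -> \bar R.
Hypothesis rhoP : is_ri_norm mu setT rho.
Variable r : (lline R -> \bar R) -> \bar R.
Hypothesis rP : is_ri_norm lam half r.
Hypothesis rE : forall f, measurable_fun setT f ->
  space_norm (associate mu setT rho) f = space_norm r (rearr mu setT f).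

Lemma tail_average_tail_norm f :
  r (tail_average (rearr mu setT f)) = tail_norm mu tau rho f.
Proof.
have rho'P := associate_is_ri_norm tauP rhoP.
have Mt := tail_average_Mplus mu f.
have Mp := pull_Mplus tauP Mt; have Ms := tailop_Mplus tauP (sym_Mplus tauP f).
rewrite (representation_unique tauP rP rE Mt) /tail_norm.
have E : {ae mu, forall x, setT x -> pull tau (tail_average (rearr mu setT f)) x =
    tailop (sym f) x}.
  by apply: filterS (ae_gauge_gt0 tauP) => x x0 _; rewrite pullE// tail_averageE.
by apply/eqP; rewrite eq_le; apply/andP; split; apply: (ri_le rho'P) => //;
  apply: filterS E => x /[apply] ->.
Qed.

(** The representation norm is only pinned down on nonnegative functions of
    the half line, where it is the pull-back of [rho']. *)
Lemma sigma_tail_norm f :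
  space_norm r (tail_average (rearr mu setT f)) = tail_norm mu tau rho f.
Proof.
rewrite -tail_average_tail_norm; have Mt := tail_average_Mplus mu f.
have Ma : Mplus half (fun t => `|tail_average (rearr mu setT f) t|).
  by split => [|t _]; [exact: measurableT_comp Mt.1|exact: abse_ge0].
by apply/eqP; rewrite eq_le; apply/andP; split; apply: (ri_le rP) => //;
  apply: aeW => t ht; rewrite gee0_abs//; exact: Mt.2.
Qed.

End sigma_norm.

(** * Targets of the maximal operator *)

Section maximal_target.
Context {R : realType} {n : nat}.
Local Notation En := (euclid R n).
Local Notation mu := (@lebesgue_euclid R n).
Local Notation gauge := (@cube_gauge R n).
Local Notation tail_norm := (@tail_norm _ En R mu gauge).
Local Notation half := (half_line R).
Variable rhoX : (En -> \bar R) -> \bar R.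
Hypothesis rhoXP : is_ri_norm mu setT rhoX.

Let rho'P : is_ri_norm mu setT (associate mu setT rhoX) :=
  associate_is_ri_norm cube_gaugeP rhoXP.

Lemma representationP :
  is_representation (associate mu setT rhoX) (representation (associate mu setT rhoX)).
Proof.
apply: getPex; exists (associate mu setT rhoX \o pull gauge); split.
  exact: (representation_is_ri_norm cube_gaugeP rho'P).
by move=> f mf; exact: (representation_rearr cube_gaugeP rho'P mf).
Qed.

Local Notation rX' := (representation (associate mu setT rhoX)).

Lemma sigmaE : sigma rX' = tail_norm rhoX.
Proof.
have [rP rE] := representationP.
by apply/funext => f; exact: (sigma_tail_norm cube_gaugeP rhoXP rP rE f).
Qed.

Lemma tail_norm_indic_lty : ri_space half rX' (psi R) ->
  forall E : set En, measurable E -> mu E < +oo ->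
  tail_norm rhoX (EFin \o \1_E) < +oo.
Proof.
have [rP rE] := representationP; move=> [_ psioo] E mE Eoo.
rewrite -(tail_average_tail_norm cube_gaugeP rhoXP rP rE).
apply: (tail_average_indic_lty rP _ mE Eoo); apply: le_lt_trans psioo.
have Mpsi := @psi_Mplus R; apply: (ri_le rP); first exact: Mpsi.
  by split=> [|t _]; [exact: measurableT_comp Mpsi.1|exact: abse_ge0].
by apply: aeW => t ht; exact: lee_abs.
Qed.

(** For the unit cube the tail average is [psi] itself. *)
Lemma psi_in_space : tail_norm rhoX (EFin \o \1_(cube 0%R 1%R)) < +oo ->
  ri_space half rX' (psi R).
Proof.
have [rP rE] := representationP; have Mpsi := @psi_Mplus R.
rewrite -(tail_average_tail_norm cube_gaugeP rhoXP rP rE) => H.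
split; first exact: Mpsi.1.
have mQ : measurable (cube 0%R 1%R : set En) := measurable_cube _ _.
have Q1 : mu (cube 0%R 1%R) = 1%R%:E by rewrite lebesgue_euclid_cube ?ler01// expr1n.
apply: le_lt_trans H; apply: (ri_le rP).
- by split=> [|t _]; [exact: measurableT_comp Mpsi.1|exact: abse_ge0].
- exact: tail_average_Mplus.
- apply: aeW => t ht; rewrite gee0_abs; last exact: Mpsi.2.
  by move: ht; rewrite half_lineE => t0; rewrite psiE// (tail_average_indic mQ Q1 t0).
Qed.

(** All that optimality retains from the boundedness of the maximal operator. *)
Lemma bounded_op_avgop rhoZ : is_ri_norm mu setT rhoZ ->
  bounded_op setT maximal rhoX rhoZ ->
  exists2 C : R, (0 < C)%R & forall h, Mplus setT h -> rhoX h <= 1 ->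
    rhoZ (@avgop _ En R mu gauge (sym mu gauge h)) <= C%:E.
Proof.
move=> ZP [C C0 H]; exists C => // h Mh h1.
have Ms := sym_Mplus (cube_gaugeP (R := R) (n := n)) h.
have absE g : Mplus setT g -> (fun x => `|g x|) = g.
  by move=> [_ g0]; apply/funext => x; rewrite gee0_abs// g0.
have sh : rhoX (sym mu gauge h) = rhoX h := ri_sym cube_gaugeP rhoXP Mh.
have Mm := maximal_Mplus Ms.1.
have Xh : ri_space setT rhoX (sym mu gauge h).
  split; first exact: Ms.1.
  by rewrite /space_norm absE// sh (le_lt_trans h1)// ltry.
have := H _ Xh; rewrite /space_norm !absE// sh => Hh.
apply: (@le_trans _ _ (rhoZ (maximal (sym mu gauge h)))).
  by apply: (ri_mono ZP) => [||x];
    [exact: (avgop_Mplus cube_gaugeP)|exact: Mm|exact: avgop_le_maximal].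
apply: le_trans Hh _; rewrite -[leRHS]mule1.
by apply: lee_wpmul2l; rewrite ?lee_fin ?(ltW C0).
Qed.

Lemma maximal_bounded :
  bounded_op setT maximal rhoX (associate mu setT (tail_norm rhoX)).
Proof.
exists (3 ^+ n.+1 + 1)%R; first by rewrite ltr_wpDl// exprn_ge0.
move=> f [mf foo]; have Mf : Mplus setT (fun x => `|f x|).
  by split=> [|x _]; [exact: measurableT_comp|exact: abse_ge0].
have Mm := maximal_Mplus mf.
rewrite /space_norm (_ : (fun x => `|maximal f x|) = maximal f); last first.
  by apply/funext => x; rewrite gee0_abs// maximal_ge0.
apply: (associate_tail_norm_bound cube_gaugeP rhoXP) => //.
by move=> x x0; rewrite -maximal_abs; exact: sym_maximal_le.
Qed.

End maximal_target.

Theorem theorem3p1 (R : realType) (n : nat)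
    (rhoX : (euclid R n -> \bar R) -> \bar R)
    (hX : is_ri_norm_euclid rhoX) :
  let rX' := representation (associate_euclid rhoX) in
  let sigmaX : (euclid R n -> \bar R) -> \bar R := sigma rX' in
  let rhoY := associate_euclid sigmaX in
  (ri_space (half_line R) rX' (psi R) ->
    [/\ is_ri_norm_euclid sigmaX,
        is_ri_norm_euclid rhoY,
        bounded_op setT maximal rhoX rhoY &
        forall rhoZ : (euclid R n -> \bar R) -> \bar R,
          is_ri_norm_euclid rhoZ ->
          bounded_op setT maximal rhoX rhoZ ->
          embedded setT rhoY rhoZ]) /\
  (~ ri_space (half_line R) rX' (psi R) ->
    ~ exists rhoY' : (euclid R n -> \bar R) -> \bar R,
        is_ri_norm_euclid rhoY' /\
        bounded_op setT maximal rhoX rhoY').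
Proof.
move=> rX' sigmaX rhoY.
have sE : sigmaX = @tail_norm _ _ R (@lebesgue_euclid R n) (@cube_gauge R n) rhoX.
  exact: (sigmaE hX).
have gP := @cube_gaugeP R n.
split=> [A|nA [rhoZ [ZP B]]].
  have sP : is_ri_norm_euclid sigmaX.
    by rewrite sE; exact: (tail_norm_is_ri_norm gP hX (tail_norm_indic_lty hX A)).
  split; [exact: sP|exact: (associate_is_ri_norm gP sP)| |move=> rhoZ ZP B].
    by rewrite /rhoY sE; exact: (maximal_bounded hX).
  have [C C0 H] := bounded_op_avgop hX ZP B; exists C => // f [mf _].
  have Mf : Mplus setT (fun x => `|f x|).
    by split=> [|x _]; [exact: measurableT_comp|exact: abse_ge0].
  by rewrite /rhoY sE; exact: (optimal_embedding gP hX ZP C0 Mf H).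
apply: nA; apply: (psi_in_space hX).
have [C C0 H] := bounded_op_avgop hX ZP B.
have mQ : measurable (cube 0%R 1%R : set (euclid R n)) := measurable_cube _ _.
have Qoo : (@lebesgue_euclid R n) (cube 0%R 1%R) < +oo.
  by rewrite lebesgue_euclid_cube ?ler01// ltry.
have QC := tail_norm_le_associate gP ZP C0 (Mplus_indic R mQ) H.
apply: (@le_lt_trans _ _ (C%:E * associate_euclid rhoZ (EFin \o \1_(cube 0%R 1%R)))).
  exact: QC.
rewrite lte_mul_pinfty ?lee_fin ?(ltW C0)//.
exact: (ri_indic (associate_is_ri_norm gP ZP) mQ (@subsetT _ _) Qoo).
Qed.
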